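(* (Work in $\mathrm{ZF}+\mathrm{DC}$.) (1) If $\lambda$ is a true successor cardinal, then $\lambda$ is regular and has an onto-witness (computed uniformly from a witness). (2) Assume $\mathrm{Ax}^4_{\mu^+}$ or just $\mathrm{Ax}_{4,\mu^+,\partial}$. If $\mu$ is a singular cardinal and $\mathrm{hrtg}([\alpha]^{\aleph_0}\times\partial)<\mu$ for every $\alpha<\mu$, then $\mu^+$ is a true successor cardinal. (3) Assume $\mathrm{Ax}_{4,\lambda,\partial}$. The set of ordinals $\alpha<\lambda$ such that $|\alpha|$ is singular and $\mathrm{hrtg}([\beta]^{\aleph_0}\times\partial)\le|\alpha|$ for every $\beta<|\alpha|$ is a smooth set of ordinals. (4) Assume $\mathrm{Ax}_{4,\partial}$. For every ordinal $\alpha_*$ there is a sequence $\langle u_\alpha:\alpha<\alpha_*,\ \alpha\text{ a limit ordinal}\rangle$ such that $u_\alpha\subseteq\alpha=\sup(u_\alpha)$ and $\mathrm{otp}(u_\alpha)<\mathrm{hrtg}([\mathrm{cf}(\alpha)]^{\aleph_0}\times\partial)$ for every limit $\alpha<\alpha_*$.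
   Context: The axiom of choice is not assumed, only ZF + DC. $\partial\ge\aleph_1$ is a fixed cardinal. Cardinals are alephs. $\mathrm{hrtg}(A)$ is the least ordinal $\alpha>0$ such that there is no function from $A$ onto $\alpha$. $\mathrm{Ax}^4_\lambda$ says that $[\lambda]^{\aleph_0}$ can be well ordered (when it is used, $\partial=\aleph_1$). For $\lambda\ge\partial$, $\mathrm{Ax}_{4,\lambda,\partial}$ says there is a well-orderable $\mathcal S\subseteq[\lambda]^{<\partial}$ such that every $u_1\in[\lambda]^{<\aleph_1}$ is contained in some $u_2\in\mathcal S$. $\mathrm{Ax}_{4,\partial}$ says $\mathrm{Ax}_{4,\lambda,\partial}$ holds for every $\lambda$. A cardinal $\lambda$ is a true successor cardinal if for some cardinal $\mu$, $\lambda=\mu^+$ and there is a witness, i.e. a sequence $\bar f=\langle f_\alpha:\alpha\in[\mu,\lambda)\rangle$ where each $f_\alpha$ is a one-to-one function from $\alpha$ into $\mu$. It is an onto-witness if each $f_\alpha$ is onto $\mu$. A set $\mathcal U$ of ordinals is smooth if there is a sequence $\langle f_\alpha:\alpha\in\mathcal U\rangle$ where each $f_\alpha$ is a one-to-one function from $\alpha$ onto $|\alpha|$. *)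

(* Defs.v *)
(* "Provable in ZF + DC" is rendered as "true in every model of first-order
   ZF + DC".  Separation and Replacement range over first-order formulas with
   parameters, not over all Rocq predicates on the model: with the latter, a
   classical metatheory with choice would make the axiom of choice true in
   every model.

   All set-theoretic notions are relations on the model; [is_foo a x] or
   [foo a x] reads "x is the foo of a". *)

Set Implicit Arguments.
Unset Strict Implicit.

Record structure := Structure {
  dom :> Type;
  mem : dom -> dom -> Prop
}.

Notation "x ∈ y" := (mem x y) (at level 70, no associativity).

(* Variables are de Bruijn indices: [fAll] and [fEx] bind index 0. *)
Inductive formula : Type :=
| fMem (i j : nat)
| fEq (i j : nat)
| fBot
| fAnd (p q : formula)
| fOr (p q : formula)
| fImp (p q : formula)
| fAll (p : formula)
| fEx (p : formula).

Definition scons {T : Type} (x : T) (e : nat -> T) (n : nat) : T :=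
  match n with O => x | S m => e m end.

Fixpoint sat {M : structure} (e : nat -> M) (p : formula) : Prop :=
  match p with
  | fMem i j => e i ∈ e j
  | fEq i j => e i = e j
  | fBot => False
  | fAnd p q => sat e p /\ sat e q
  | fOr p q => sat e p \/ sat e q
  | fImp p q => sat e p -> sat e q
  | fAll p => forall x : M, sat (scons x e) p
  | fEx p => exists x : M, sat (scons x e) p
  end.

Definition subset {M : structure} (x y : M) := forall z, z ∈ x -> z ∈ y.

Definition is_empty {M : structure} (x : M) := forall z, ~ z ∈ x.

Definition is_succ {M : structure} (x s : M) := forall z, z ∈ s <-> z ∈ x \/ z = x.

Definition is_upair {M : structure} (x y p : M) :=
  forall z, z ∈ p <-> z = x \/ z = y.

Definition is_pair {M : structure} (x y p : M) :=
  forall z, z ∈ p <-> is_upair x x z \/ is_upair x y z.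

Definition is_prod {M : structure} (A B P : M) :=
  forall p, p ∈ P <-> exists x y, x ∈ A /\ y ∈ B /\ is_pair x y p.

(* (x, y) belongs to the set f; for a function f this is f(x) = y, for a set
   relation it is x f y. *)
Definition maps {M : structure} (f x y : M) := exists p, p ∈ f /\ is_pair x y p.

(* f is a function whose domain is the class D, i.e. a sequence indexed by D. *)
Definition fun_on {M : structure} (f : M) (D : M -> Prop) :=
  (forall p, p ∈ f -> exists x y, D x /\ is_pair x y p) /\
  (forall x, D x -> exists! y, maps f x y).

Definition func {M : structure} (f A B : M) :=
  fun_on f (fun x => x ∈ A) /\ (forall x y, maps f x y -> y ∈ B).

Definition injection {M : structure} (f A B : M) :=
  func f A B /\ (forall x x' y, maps f x y -> maps f x' y -> x = x').

Definition surjection {M : structure} (f A B : M) :=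
  func f A B /\ (forall y, y ∈ B -> exists x, maps f x y).

Definition bijection {M : structure} (f A B : M) :=
  injection f A B /\ surjection f A B.

Definition equipotent {M : structure} (A B : M) := exists f, bijection f A B.

Definition well_orders {M : structure} (R : M -> M -> Prop) (A : M) :=
  (forall x, x ∈ A -> ~ R x x) /\
  (forall x y z, x ∈ A -> y ∈ A -> z ∈ A -> R x y -> R y z -> R x z) /\
  (forall x y, x ∈ A -> y ∈ A -> R x y \/ x = y \/ R y x) /\
  (forall B, subset B A -> (exists x, x ∈ B) ->
     exists m, m ∈ B /\ forall x, x ∈ B -> m = x \/ R m x).

Definition well_orderable {M : structure} (A : M) :=
  exists r, well_orders (maps r) A.

Definition ordinal {M : structure} (a : M) :=
  (forall x, x ∈ a -> subset x a) /\ well_orders (@mem M) a.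

Definition ord_le {M : structure} (a b : M) := a ∈ b \/ a = b.

Definition least_ord {M : structure} (P : M -> Prop) (a : M) :=
  ordinal a /\ P a /\ (forall b, ordinal b -> P b -> ord_le a b).

Definition limit_ordinal {M : structure} (a : M) :=
  ordinal a /\ (exists x, x ∈ a) /\
  (forall x, x ∈ a -> exists s, s ∈ a /\ is_succ x s).

Definition is_omega {M : structure} (w : M) := least_ord limit_ordinal w.

(* otp(u), for u a set of ordinals. *)
Definition otp {M : structure} (u o : M) :=
  ordinal o /\
  exists f, bijection f u o /\
    forall x x' y y', maps f x y -> maps f x' y' -> (x ∈ x' <-> y ∈ y').

(* sup(u), for u a set of ordinals. *)
Definition is_sup {M : structure} (u a : M) :=
  least_ord (fun b => forall x, x ∈ u -> ord_le x b) a.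

Definition unbounded {M : structure} (u a : M) :=
  subset u a /\ (forall x, x ∈ a -> exists y, y ∈ u /\ ord_le x y).

Definition cof {M : structure} (a k : M) :=
  least_ord (fun b => exists u, unbounded u a /\ otp u b) k.

(* |A|, as an initial ordinal, for well-orderable A (finite A allowed). *)
Definition card {M : structure} (A k : M) :=
  least_ord (fun b => equipotent A b) k.

(* Cardinals are alephs: infinite initial ordinals. *)
Definition cardinal {M : structure} (k : M) :=
  card k k /\ exists w, is_omega w /\ ord_le w k.

Definition succ_cardinal {M : structure} (m l : M) :=
  cardinal m /\ least_ord (fun k => cardinal k /\ m ∈ k) l.

Definition is_aleph1 {M : structure} (a : M) :=
  exists w, is_omega w /\ succ_cardinal w a.

Definition regular {M : structure} (k : M) := cardinal k /\ cof k k.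

Definition singular {M : structure} (k : M) :=
  cardinal k /\ exists c, cof k c /\ c ∈ k.

Definition hrtg {M : structure} (A h : M) :=
  least_ord (fun a => (exists x, x ∈ a) /\ ~ exists f, surjection f A a) h.

(* P = [A]^{aleph_0} *)
Definition is_pow_aleph0 {M : structure} (A P : M) :=
  forall u, u ∈ P <-> subset u A /\ exists w, is_omega w /\ card u w.

(* u belongs to [A]^{<k} *)
Definition in_pow_lt {M : structure} (A k u : M) :=
  subset u A /\ exists n, n ∈ k /\ card u n.

(* h = hrtg([a]^{aleph_0} x d) *)
Definition hrtg_pow {M : structure} (d a h : M) :=
  exists P Q, is_pow_aleph0 a P /\ is_prod P d Q /\ hrtg Q h.

Record ZF (M : structure) : Prop := {
  zf_ext : forall x y : M, (forall z, z ∈ x <-> z ∈ y) -> x = y;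
  zf_found : forall x : M, (exists y, y ∈ x) ->
    exists y, y ∈ x /\ forall z, z ∈ x -> ~ z ∈ y;
  zf_pair : forall x y : M, exists p, is_upair x y p;
  zf_union : forall x : M, exists u, forall z, z ∈ u <-> exists y, y ∈ x /\ z ∈ y;
  zf_power : forall x : M, exists p, forall z, z ∈ p <-> subset z x;
  zf_inf : exists x : M, (exists o, is_empty o /\ o ∈ x) /\
    forall y, y ∈ x -> exists s, is_succ y s /\ s ∈ x;
  zf_sep : forall (p : formula) (e : nat -> M) (a : M),
    exists b, forall x, x ∈ b <-> x ∈ a /\ sat (scons x e) p;
  zf_repl : forall (p : formula) (e : nat -> M) (a : M),
    (forall x, x ∈ a -> exists! y, sat (scons x (scons y e)) p) ->
    exists b, forall y, y ∈ b <-> exists x, x ∈ a /\ sat (scons x (scons y e)) p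
}.

Definition DC (M : structure) : Prop :=
  forall X r : M,
    (exists x, x ∈ X) ->
    (forall x, x ∈ X -> exists y, y ∈ X /\ maps r x y) ->
    exists w f, is_omega w /\ func f w X /\
      forall n n' x y, n ∈ w -> is_succ n n' -> maps f n x -> maps f n' y ->
        maps r x y.

Definition ZFDC (M : structure) : Prop := ZF M /\ DC M.

Definition Ax4 {M : structure} (l : M) :=
  exists P, is_pow_aleph0 l P /\ well_orderable P.

(* Only meant for l >= d, which is made part of the definition. *)
Definition Ax4cov {M : structure} (d l : M) :=
  ord_le d l /\
  exists s, well_orderable s /\
    (forall u, u ∈ s -> in_pow_lt l d u) /\
    (forall a1 u1, is_aleph1 a1 -> in_pow_lt l a1 u1 ->
       exists u2, u2 ∈ s /\ subset u1 u2).

Definition Ax4all {M : structure} (d : M) :=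
  forall l, cardinal l -> ord_le d l -> Ax4cov d l.

Definition in_interval {M : structure} (m l a : M) := ord_le m a /\ a ∈ l.

Definition witness {M : structure} (m l f : M) :=
  fun_on f (in_interval m l) /\
  forall a g, in_interval m l a -> maps f a g -> injection g a m.

Definition onto_witness {M : structure} (m l f : M) :=
  witness m l f /\
  forall a g, in_interval m l a -> maps f a g -> surjection g a m.

Definition true_successor {M : structure} (l : M) :=
  exists m, succ_cardinal m l /\ exists f, witness m l f.

Definition has_onto_witness {M : structure} (l : M) :=
  exists m, succ_cardinal m l /\ exists f, onto_witness m l f.

Definition smooth {M : structure} (U : M) :=
  (forall a, a ∈ U -> ordinal a) /\
  exists f, fun_on f (fun a => a ∈ U) /\
    forall a g, a ∈ U -> maps f a g -> exists k, card a k /\ bijection g a k.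

(* The parameter-free formula p (index 0: the witness, index 1: the value)
   computes an onto-witness from each witness: its value does not depend on the
   environment e, and since m and l can be read off the domain of f they need
   not be passed to p. *)
Definition computes_onto_witness (p : formula) (M : structure) : Prop :=
  forall m l f : M, succ_cardinal m l -> witness m l f ->
    exists g, onto_witness m l g /\
      forall (e : nat -> M) g', sat (scons f (scons g' e)) p <-> g' = g.

(* Main.v *)
(* Let S be a well-ordered cover of the countable subsets of l by sets of size
   < d.  For countable v let first_cover v be the first element of S that contains v up
   to finitely many points, and let cl A add to A all the first_cover v, v in [A]^aleph_0.
   Let a be a limit ordinal below l.  If some s in S is unbounded in a, the first
   such s gives a canonical short cofinal subset of a.  Otherwise all countable
   subsets of a are bounded, so the clubs of a are closed under intersection.
   Since first_cover v depends on v only modulo finite sets, DC excludes a decreasing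
   sequence of clubs with C_n not included in cl C_(n+1); hence some club C is
   included in cl C' for all clubs C'.  Then the intersection of all the cl C'
   depends on no choice, contains C, and is included in cl C, which is an image
   of [cf a]^aleph_0 x d.

   Along these cofinal sets one builds injections a -> |a| by recursion: a is a
   union of fewer than |a| smaller ordinals, already injected uniformly into |a|,
   and |a| x |a| has a canonical injection into |a|.  Collapsing the range of an
   injection makes it a bijection.  The same union argument shows that a true
   successor cardinal is regular. *)

From Stdlib Require Import Classical ClassicalEpsilon FunctionalExtensionality PropExtensionality PeanoNat.
Require Import Defs.

(** Without choice one cannot pick a cofinal set or an injection for each ordinal separately. Every
    such object has to be a definable function of the ordinal, with a few parameters fixed once: the
    cover [S], its well-order [r] and the bound [l]. This is why a ladder is either a least element
    of [S] or an intersection over all clubs. DC occurs only inside existence proofs (a common limit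
    point, a minimal club) whose conclusions do not mention the chosen sequence. Separation and
    Replacement hold for first-order formulas only, so each construction needs a proof of
    definability. Objects are introduced by definite description, and a tactic proves definability
    along their syntax. The [epsilon] of the metatheory only evaluates definite descriptions and
    brings no choice into the model. In [cf a]^aleph_0 x d, the first factor names a countable
    subset of a club, through an injection of that club into cf a; the second is a position in the
    cover of this subset, whose order type is below [d]. *)

(** * Renaming of variables in formulas *)

Definition lift_ren (r : nat -> nat) (n : nat) : nat :=
  match n with O => O | S m => S (r m) end.

Fixpoint ren (r : nat -> nat) (p : formula) : formula :=
  match p with
  | fMem i j => fMem (r i) (r j)
  | fEq i j => fEq (r i) (r j)
  | fBot => fBot
  | fAnd p q => fAnd (ren r p) (ren r q)
  | fOr p q => fOr (ren r p) (ren r q)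
  | fImp p q => fImp (ren r p) (ren r q)
  | fAll p => fAll (ren (lift_ren r) p)
  | fEx p => fEx (ren (lift_ren r) p)
  end.

Lemma scons_lift_ren {M : structure} (x : M) (e : nat -> M) (r : nat -> nat) :
  (fun i => scons x e (lift_ren r i)) = scons x (fun i => e (r i)).
Proof. apply functional_extensionality; intros [|i]; reflexivity. Qed.

Lemma sat_ren {M : structure} (p : formula) : forall (r : nat -> nat) (e : nat -> M),
  sat e (ren r p) <-> sat (fun i => e (r i)) p.
Proof.
  induction p; intros r e; simpl; try tauto.
  - rewrite IHp1, IHp2; tauto.
  - rewrite IHp1, IHp2; tauto.
  - rewrite IHp1, IHp2; tauto.
  - split; intros H x; specialize (H x).
    + rewrite IHp, scons_lift_ren in H; exact H.
    + rewrite IHp, scons_lift_ren; exact H.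
  - split; intros [x H]; exists x.
    + rewrite IHp, scons_lift_ren in H; exact H.
    + rewrite IHp, scons_lift_ren; exact H.
Qed.

Section Model.
Context {M : structure} {HZF : ZF M} {HDC : DC M}.

(** * Definability with parameters *)

Definition assign (s : nat -> nat + M) (e : nat -> M) (i : nat) : M :=
  match s i with inl j => e j | inr c => c end.

(* The slot map [s] says which free variables of the formula are variables of
   [P] and which are parameters from [M]. *)
Definition definable (P : (nat -> M) -> Prop) : Prop :=
  exists p (s : nat -> nat + M), forall e, P e <-> sat (assign s e) p.

Definition term_definable (t : (nat -> M) -> M) : Prop :=
  definable (fun e => e 0 = t (fun n => e (S n))).

Lemma D_iff (P Q : (nat -> M) -> Prop) : (forall e, P e <-> Q e) -> definable P -> definable Q.
Proof. intros H [p [s Hp]]; exists p, s; intro e; rewrite <- H; apply Hp. Qed.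

(** By excluded middle [A] is equivalent to a true or to a false formula. So any Rocq proposition
    that does not depend on the assignment may occur inside a definable predicate. *)
Lemma D_const (A : Prop) : definable (fun _ => A).
Proof.
  destruct (classic A) as [HA|HA].
  - exists (fImp fBot fBot), (fun i => inl i); simpl; tauto.
  - exists fBot, (fun i => inl i); simpl; tauto.
Qed.

Lemma D_ren (P : (nat -> M) -> Prop) (r : nat -> nat) : definable P -> definable (fun e => P (fun n => e (r n))).
Proof.
  intros [p [s Hp]].
  exists p, (fun i => match s i with inl j => inl (r j) | inr c => inr c end).
  intro e; rewrite Hp.
  replace (assign s (fun n => e (r n))) with
    (assign (fun i => match s i with inl j => inl (r j) | inr c => inr c end) e);
    [tauto|].
  apply functional_extensionality; intro i; unfold assign; destruct (s i); reflexivity.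
Qed.

(** The two formulas come with different slot maps. Moving the slots of one to the even indices and
    those of the other to the odd indices makes a single slot map serve both. *)
Lemma D_combine (P Q : (nat -> M) -> Prop) : definable P -> definable Q ->
  exists p q (s : nat -> nat + M),
    (forall e, P e <-> sat (assign s e) p) /\ (forall e, Q e <-> sat (assign s e) q).
Proof.
  intros [p [s Hp]] [q [s' Hq]].
  exists (ren (fun i => 2 * i) p), (ren (fun i => S (2 * i)) q),
    (fun i => if Nat.even i then s (Nat.div2 i) else s' (Nat.div2 i)).
  split; intro e; rewrite sat_ren.
  - rewrite Hp. replace (fun i => assign _ e (2 * i)) with (assign s e); [tauto|].
    apply functional_extensionality; intro i; unfold assign.
    rewrite Nat.even_even, Nat.div2_double; reflexivity.
  - rewrite Hq. replace (fun i => assign _ e (S (2 * i))) with (assign s' e); [tauto|].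
    apply functional_extensionality; intro i; unfold assign.
    rewrite Nat.even_succ, Nat.odd_even, Nat.div2_succ_double; reflexivity.
Qed.

Lemma D_and (P Q : (nat -> M) -> Prop) : definable P -> definable Q -> definable (fun e => P e /\ Q e).
Proof.
  intros HP HQ; destruct (D_combine _ _ HP HQ) as [p [q [s [Hp Hq]]]].
  exists (fAnd p q), s; intro e; simpl; rewrite Hp, Hq; tauto.
Qed.

Lemma D_or (P Q : (nat -> M) -> Prop) : definable P -> definable Q -> definable (fun e => P e \/ Q e).
Proof.
  intros HP HQ; destruct (D_combine _ _ HP HQ) as [p [q [s [Hp Hq]]]].
  exists (fOr p q), s; intro e; simpl; rewrite Hp, Hq; tauto.
Qed.

Lemma D_imp (P Q : (nat -> M) -> Prop) : definable P -> definable Q -> definable (fun e => P e -> Q e).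
Proof.
  intros HP HQ; destruct (D_combine _ _ HP HQ) as [p [q [s [Hp Hq]]]].
  exists (fImp p q), s; intro e; simpl; rewrite Hp, Hq; tauto.
Qed.

Lemma D_not (P : (nat -> M) -> Prop) : definable P -> definable (fun e => ~ P e).
Proof. intro HP; apply D_imp; [exact HP|apply D_const]. Qed.

Lemma D_equiv (P Q : (nat -> M) -> Prop) : definable P -> definable Q -> definable (fun e => P e <-> Q e).
Proof. intros HP HQ; apply D_and; apply D_imp; assumption. Qed.

(** A quantifier binds index 0, while the quantified variable may occupy any number of slots. All of
    these are renamed to 0, and every other slot moves up by one. *)
Lemma D_quantifier (P : (nat -> M) -> M -> Prop) :
  definable (fun e => P (fun n => e (S n)) (e 0)) ->
  exists p (s : nat -> nat + M),
    forall e x, P e x <-> sat (scons x (assign s e)) p.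
Proof.
  intros [p [s Hp]].
  exists (ren (fun i => match s i with inl 0 => 0 | _ => S i end) p),
    (fun i => match s i with inl (S j) => inl j | _ => s i end).
  intros e x; rewrite sat_ren.
  specialize (Hp (scons x e)); simpl in Hp.
  change (fun n => e n) with e in Hp; rewrite Hp.
  match goal with |- sat ?a _ <-> sat ?b _ => replace a with b; [tauto|] end.
  apply functional_extensionality; intro i; unfold assign.
  destruct (s i) as [[|j]|c] eqn:E; simpl; try reflexivity; rewrite E; reflexivity.
Qed.

Lemma D_all (P : (nat -> M) -> M -> Prop) :
  definable (fun e => P (fun n => e (S n)) (e 0)) -> definable (fun e => forall x, P e x).
Proof.
  intro H; destruct (D_quantifier _ H) as [p [s Hp]].
  exists (fAll p), s; intro e; simpl; split; intros K x; apply Hp; apply K.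
Qed.

Lemma D_ex (P : (nat -> M) -> M -> Prop) :
  definable (fun e => P (fun n => e (S n)) (e 0)) -> definable (fun e => exists x, P e x).
Proof.
  intro H; destruct (D_quantifier _ H) as [p [s Hp]].
  exists (fEx p), s; intro e; simpl; split; intros [x K]; exists x; apply Hp; apply K.
Qed.

Lemma T_var (i : nat) : term_definable (fun e => e i).
Proof.
  exists (fEq 0 (S i)), (fun i => inl i); intro e; reflexivity.
Qed.

Lemma T_const (c : M) : term_definable (fun _ => c).
Proof.
  exists (fEq 0 1), (fun i => match i with O => inl 0 | _ => inr c end); intro e; reflexivity.
Qed.

Lemma T_ren (t : (nat -> M) -> M) (r : nat -> nat) : term_definable t -> term_definable (fun e => t (fun n => e (r n))).
Proof.
  intro H. refine (D_ren _ (lift_ren r) H).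
Qed.

Lemma D_subst (P : (nat -> M) -> M -> Prop) (t : (nat -> M) -> M) :
  term_definable t -> definable (fun e => P (fun n => e (S n)) (e 0)) -> definable (fun e => P e (t e)).
Proof.
  intros Ht HP.
  apply D_iff with (fun e => exists x, x = t e /\ P e x).
  - intro e; split; [intros [x [-> K]]; exact K|intro K; exists (t e); auto].
  - apply D_ex, D_and; [exact Ht|exact HP].
Qed.

Lemma D_subst2 (P : M -> M -> Prop) (t u : (nat -> M) -> M) :
  term_definable t -> term_definable u -> definable (fun e => P (e 0) (e 1)) -> definable (fun e => P (t e) (u e)).
Proof.
  intros Ht Hu HP.
  apply (D_subst (fun e x => P x (u e))); [exact Ht|].
  apply (D_subst (fun e x => P (e 0) x)); [exact (T_ren _ S Hu)|].
  exact (D_ren _ (fun n => match n with 0 => 1 | _ => 0 end) HP).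
Qed.

Lemma D_mem (t u : (nat -> M) -> M) : term_definable t -> term_definable u -> definable (fun e => t e ∈ u e).
Proof.
  intros Ht Hu; apply D_subst2; [exact Ht|exact Hu|].
  exists (fMem 0 1), (fun i => inl i); intro e; reflexivity.
Qed.

Lemma D_eq (t u : (nat -> M) -> M) : term_definable t -> term_definable u -> definable (fun e => t e = u e).
Proof.
  intros Ht Hu; apply D_subst2; [exact Ht|exact Hu|].
  exists (fEq 0 1), (fun i => inl i); intro e; reflexivity.
Qed.

Lemma D_exu (P : (nat -> M) -> M -> Prop) :
  definable (fun e => P (fun n => e (S n)) (e 0)) -> definable (fun e => exists! x, P e x).
Proof.
  intro H; unfold unique. apply D_ex, D_and; [exact H|].
  apply (D_all (fun e y => P (fun n => e (S n)) y -> e 0 = y)), D_imp.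
  - exact (D_ren _ (fun n => match n with 0 => 0 | S m => S (S m) end) H).
  - apply D_eq; apply T_var.
Qed.

Lemma model_inhabited : inhabited M.
Proof. destruct (zf_inf HZF) as [x _]; exact (inhabits x). Qed.

(* Definite description, with the empty set as junk value; every functional
   notation below is an instance, so that definability needs a single lemma. *)
Definition iota (P : M -> Prop) : M :=
  epsilon model_inhabited (fun x =>
    ((exists! y, P y) /\ P x) \/ (~ (exists! y, P y) /\ is_empty x)).

Lemma empty_exists : exists x : M, is_empty x.
Proof. destruct (zf_inf HZF) as [x [[o [Ho _]] _]]; exists o; exact Ho. Qed.

Lemma iota_choice (P : M -> Prop) :
  ((exists! y, P y) /\ P (iota P)) \/ (~ (exists! y, P y) /\ is_empty (iota P)).
Proof.
  apply (epsilon_spec model_inhabited (fun x =>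
    ((exists! y, P y) /\ P x) \/ (~ (exists! y, P y) /\ is_empty x))).
  destruct (classic (exists! y, P y)) as [H|H].
  - pose proof H as [x [Hx _]]; exists x; left; auto.
  - destruct empty_exists as [x Hx]; exists x; right; auto.
Qed.

Lemma iota_spec (P : M -> Prop) : (exists! y, P y) -> P (iota P).
Proof. intro H; destruct (iota_choice P) as [[_ K]|[K _]]; tauto. Qed.

Lemma iota_eq (P : M -> Prop) (x : M) : (forall y, P y <-> y = x) -> iota P = x.
Proof.
  intro H. apply H, iota_spec. exists x; split; [apply H; reflexivity|].
  intros y Hy; symmetry; apply H, Hy.
Qed.

Lemma extensionality (x y : M) : (forall z, z ∈ x <-> z ∈ y) -> x = y.
Proof. apply (zf_ext HZF). Qed.

(** The predicate given to [epsilon] has exactly one solution in either case, by extensionality.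
    Hence the graph of [iota] is first-order, and no choice function of the metatheory enters the
    model. *)
Lemma T_iota (P : (nat -> M) -> M -> Prop) :
  definable (fun e => P (fun n => e (S n)) (e 0)) -> term_definable (fun e => iota (P e)).
Proof.
  intro H; unfold term_definable.
  pose proof (D_ren _ S (D_exu _ H)) as H1; cbv beta in H1.
  apply D_iff with (fun e => ((exists! y, P (fun n => e (S n)) y) /\ P (fun n => e (S n)) (e 0))
    \/ (~ (exists! y, P (fun n => e (S n)) y) /\ is_empty (e 0))).
  - intro e; destruct (iota_choice (P (fun n => e (S n)))) as [[K1 K2]|[K1 K2]]; split.
    + intros [[_ K]|[K _]]; [|tauto].
      destruct K1 as [y [_ Hy]]; rewrite <- (Hy _ K), <- (Hy _ K2); reflexivity.
    + intros ->; tauto.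
    + intros [[K _]|[_ K]]; [tauto|].
      apply extensionality; intro z; split; intro Hz; [destruct (K z Hz)|destruct (K2 z Hz)].
    + intros ->; tauto.
  - apply D_or; apply D_and; [exact H1|exact H|apply D_not; exact H1|].
    apply D_all, D_not, D_mem; [apply (T_var 0)|apply (T_var 1)].
Qed.

(* Extended below, as lemmas on the definability of further notions are proved. *)
Ltac def_hook := fail.

Ltac def_step :=
  cbv beta;
  first
  [ lazymatch goal with
    | |- definable (fun e => _ /\ _) => apply D_and
    | |- definable (fun e => _ \/ _) => apply D_or
    | |- definable (fun e => _ <-> _) => apply D_equiv
    | |- definable (fun e => ~ _) => apply D_not
    | |- definable (fun e => ex (unique _)) => apply D_exu
    | |- definable (fun e => ex _) => apply D_ex
    | |- definable (fun e => _ = _) => apply D_eq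
    | |- definable (fun e => _ ∈ _) => apply D_mem
    | |- definable (fun e => forall _, _) => first [apply D_imp | apply D_all]
    | |- term_definable (fun e => e _) => apply T_var
    | |- term_definable (fun e => iota _) => apply T_iota
    end
  | def_hook
  | match goal with
    | H : definable _ |- definable _ => solve [exact H | apply (D_ren _ _ H)]
    | H : term_definable _ |- term_definable _ => solve [apply (T_ren _ (fun n => n) H) | apply (T_ren _ _ H)]
    | H : forall _, _ |- definable _ => apply H
    | H : forall _, _ |- term_definable _ => apply H
    end ].

(** The constant rules come first: a subterm that does not depend on the assignment is a parameter
    and must not be taken apart. *)
Ltac dd := solve [repeat first [solve [apply D_const | apply T_const] | def_step]].

(** An abstract predicate is assumed definable only in one arrangement of its variables. Further
    binders shift that arrangement, so [dd] needs the hypothesis for every renaming [r] and every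
    argument [t]. *)
Lemma D_open (P : (nat -> M) -> M -> Prop) :
  definable (fun e => P (fun n => e (S n)) (e 0)) ->
  forall r t, term_definable t -> definable (fun e => P (fun n => e (r n)) (t e)).
Proof.
  intros H r t Ht. apply (D_subst (fun e x => P (fun n => e (r n)) x)); [exact Ht|].
  exact (D_ren _ (fun n => match n with 0 => 0 | S m => S (r m) end) H).
Qed.

Lemma T_open (f : (nat -> M) -> M -> M) :
  term_definable (fun e => f (fun n => e (S n)) (e 0)) ->
  forall r t, term_definable t -> term_definable (fun e => f (fun n => e (r n)) (t e)).
Proof.
  intros H r t Ht; unfold term_definable.
  apply (D_subst (fun e x => e 0 = f (fun n => e (S (r n))) x)); [exact (T_ren _ S Ht)|].
  exact (D_ren _ (fun n => match n with 0 => 1 | 1 => 0 | S (S m) => S (S (r m)) end) H).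
Qed.

Create HintDb defs.
Hint Unfold subset is_empty is_succ is_upair is_pair is_prod maps fun_on func injection
  surjection bijection equipotent well_orders ordinal ord_le least_ord limit_ordinal is_omega otp
  unbounded cof card cardinal singular hrtg is_pow_aleph0 hrtg_pow : defs.

Lemma D_subset a b : term_definable a -> term_definable b -> definable (fun e => subset (a e) (b e)).
Proof. intros; autounfold with defs; dd. Qed.

Lemma D_maps a b c : term_definable a -> term_definable b -> term_definable c -> definable (fun e => maps (a e) (b e) (c e)).
Proof. intros; autounfold with defs; dd. Qed.

Lemma D_injection a b c : term_definable a -> term_definable b -> term_definable c -> definable (fun e => injection (a e) (b e) (c e)).
Proof. intros; autounfold with defs; dd. Qed.

Lemma D_surjection a b c : term_definable a -> term_definable b -> term_definable c -> definable (fun e => surjection (a e) (b e) (c e)).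
Proof. intros; autounfold with defs; dd. Qed.

Lemma D_bijection a b c : term_definable a -> term_definable b -> term_definable c -> definable (fun e => bijection (a e) (b e) (c e)).
Proof. intros; autounfold with defs; dd. Qed.

Lemma D_equipotent a b : term_definable a -> term_definable b -> definable (fun e => equipotent (a e) (b e)).
Proof. intros; autounfold with defs; dd. Qed.

Lemma D_ordinal a : term_definable a -> definable (fun e => ordinal (a e)).
Proof. intros; autounfold with defs; dd. Qed.

Lemma D_ord_le a b : term_definable a -> term_definable b -> definable (fun e => ord_le (a e) (b e)).
Proof. intros; autounfold with defs; dd. Qed.

Lemma D_least_ord (P : (nat -> M) -> M -> Prop) a :
  definable (fun e => P (fun n => e (S n)) (e 0)) -> term_definable a -> definable (fun e => least_ord (P e) (a e)).
Proof. intros H Ha; pose proof (D_open _ H); autounfold with defs; dd. Qed.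

Lemma D_limit_ordinal a : term_definable a -> definable (fun e => limit_ordinal (a e)).
Proof. intros; autounfold with defs; dd. Qed.

Lemma D_otp a b : term_definable a -> term_definable b -> definable (fun e => otp (a e) (b e)).
Proof. intros; autounfold with defs; dd. Qed.

Lemma D_unbounded a b : term_definable a -> term_definable b -> definable (fun e => unbounded (a e) (b e)).
Proof. intros; autounfold with defs; dd. Qed.

Lemma D_card a b : term_definable a -> term_definable b -> definable (fun e => card (a e) (b e)).
Proof. intros; autounfold with defs; dd. Qed.

Lemma D_cardinal a : term_definable a -> definable (fun e => cardinal (a e)).
Proof. intros; autounfold with defs; dd. Qed.

Lemma D_singular a : term_definable a -> definable (fun e => singular (a e)).
Proof. intros; autounfold with defs; dd. Qed.

Lemma D_hrtg_pow a b c : term_definable a -> term_definable b -> term_definable c -> definable (fun e => hrtg_pow (a e) (b e) (c e)).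
Proof. intros; autounfold with defs; dd. Qed.

Ltac def_relation :=
  lazymatch goal with
  | |- definable (fun e => subset _ _) => apply D_subset
  | |- definable (fun e => maps _ _ _) => apply D_maps
  | |- definable (fun e => injection _ _ _) => apply D_injection
  | |- definable (fun e => surjection _ _ _) => apply D_surjection
  | |- definable (fun e => bijection _ _ _) => apply D_bijection
  | |- definable (fun e => equipotent _ _) => apply D_equipotent
  | |- definable (fun e => ordinal _) => apply D_ordinal
  | |- definable (fun e => ord_le _ _) => apply D_ord_le
  | |- definable (fun e => least_ord _ _) => apply D_least_ord
  | |- definable (fun e => limit_ordinal _) => apply D_limit_ordinal
  | |- definable (fun e => otp _ _) => apply D_otp
  | |- definable (fun e => unbounded _ _) => apply D_unbounded
  | |- definable (fun e => card _ _) => apply D_card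
  | |- definable (fun e => cardinal _) => apply D_cardinal
  | |- definable (fun e => singular _) => apply D_singular
  | |- definable (fun e => hrtg_pow _ _ _) => apply D_hrtg_pow
  | _ => fail
  end.
Ltac def_hook ::= def_relation.

(** * Set constructors *)

Definition setof (P : M -> Prop) : M := iota (fun b => forall x, x ∈ b <-> P x).

Lemma setof_spec (P : M -> Prop) : (exists b : M, forall x, x ∈ b <-> P x) ->
  forall x, x ∈ setof P <-> P x.
Proof.
  intros [b Hb]. apply (iota_spec (fun b => forall x, x ∈ b <-> P x)).
  exists b; split; [exact Hb|]. intros c Hc; apply extensionality; intro z; rewrite Hb, Hc; tauto.
Qed.

Definition emp : M := setof (fun _ => False).
Definition upair (x y : M) : M := setof (fun z => z = x \/ z = y).
Definition pair (x y : M) : M := upair (upair x x) (upair x y).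
Definition Union (x : M) : M := setof (fun z => exists y, y ∈ x /\ z ∈ y).
Definition cup (x y : M) : M := setof (fun z => z ∈ x \/ z ∈ y).
Definition suc (x : M) : M := setof (fun z => z ∈ x \/ z = x).
Definition Pow (x : M) : M := setof (fun z => subset z x).
Definition sep (a : M) (P : M -> Prop) : M := setof (fun x => x ∈ a /\ P x).
Definition image (a : M) (f : M -> M) : M := setof (fun y => exists x, x ∈ a /\ y = f x).
Definition lam (a : M) (f : M -> M) : M := setof (fun p => exists x, x ∈ a /\ p = pair x (f x)).
Definition prod (a b : M) : M := setof (fun p => exists x y, x ∈ a /\ y ∈ b /\ p = pair x y).
Definition app (f x : M) : M := iota (fun y => maps f x y).
Definition ite (P : Prop) (a b : M) : M := iota (fun z => (P /\ z = a) \/ (~ P /\ z = b)).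

Hint Unfold setof upair pair Union cup suc Pow sep image lam prod app ite : defs.

Lemma T_setof (P : (nat -> M) -> M -> Prop) :
  definable (fun e => P (fun n => e (S n)) (e 0)) -> term_definable (fun e => setof (P e)).
Proof. intro H; pose proof (D_open _ H); autounfold with defs; dd. Qed.

Lemma T_upair a b : term_definable a -> term_definable b -> term_definable (fun e => upair (a e) (b e)).
Proof. intros; autounfold with defs; dd. Qed.

Lemma T_pair a b : term_definable a -> term_definable b -> term_definable (fun e => pair (a e) (b e)).
Proof. intros; autounfold with defs; dd. Qed.

Lemma T_Union a : term_definable a -> term_definable (fun e => Union (a e)).
Proof. intros; autounfold with defs; dd. Qed.

Lemma T_cup a b : term_definable a -> term_definable b -> term_definable (fun e => cup (a e) (b e)).
Proof. intros; autounfold with defs; dd. Qed.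

Lemma T_suc a : term_definable a -> term_definable (fun e => suc (a e)).
Proof. intros; autounfold with defs; dd. Qed.

Lemma T_sep a (P : (nat -> M) -> M -> Prop) :
  term_definable a -> definable (fun e => P (fun n => e (S n)) (e 0)) -> term_definable (fun e => sep (a e) (P e)).
Proof. intros Ha H; pose proof (D_open _ H); autounfold with defs; dd. Qed.

Lemma T_lam a (f : (nat -> M) -> M -> M) :
  term_definable a -> term_definable (fun e => f (fun n => e (S n)) (e 0)) -> term_definable (fun e => lam (a e) (f e)).
Proof. intros Ha H; pose proof (T_open _ H); autounfold with defs; dd. Qed.

Lemma T_prod a b : term_definable a -> term_definable b -> term_definable (fun e => prod (a e) (b e)).
Proof. intros; autounfold with defs; dd. Qed.

Lemma T_app a b : term_definable a -> term_definable b -> term_definable (fun e => app (a e) (b e)).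
Proof. intros; autounfold with defs; dd. Qed.

Lemma T_ite (P : (nat -> M) -> Prop) a b : definable P -> term_definable a -> term_definable b -> term_definable (fun e => ite (P e) (a e) (b e)).
Proof. intros; autounfold with defs; dd. Qed.

Ltac def_constructor :=
  lazymatch goal with
  | |- term_definable (fun e => setof _) => apply T_setof
  | |- term_definable (fun e => upair _ _) => apply T_upair
  | |- term_definable (fun e => pair _ _) => apply T_pair
  | |- term_definable (fun e => Union _) => apply T_Union
  | |- term_definable (fun e => cup _ _) => apply T_cup
  | |- term_definable (fun e => suc _) => apply T_suc
  | |- term_definable (fun e => sep _ _) => apply T_sep
  | |- term_definable (fun e => lam _ _) => apply T_lam
  | |- term_definable (fun e => prod _ _) => apply T_prod
  | |- term_definable (fun e => app _ _) => apply T_app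
  | |- term_definable (fun e => ite _ _ _) => apply T_ite
  | _ => def_relation
  end.
Ltac def_hook ::= def_constructor.

Lemma separation (a : M) (P : M -> Prop) : definable (fun e => P (e 0)) ->
  exists b : M, forall x, x ∈ b <-> x ∈ a /\ P x.
Proof.
  intros [p [s Hp]].
  (* [P] looks only at [e 0], so the remaining variables may have any value; [a] is an element at
     hand. *)
  destruct (zf_sep HZF (ren (fun i => match s i with inl 0 => 0 | _ => S i end) p)
    (assign s (fun _ => a)) a) as [b Hb].
  exists b; intro x; rewrite Hb, sat_ren.
  rewrite (Hp (scons x (fun _ => a))).
  match goal with |- _ /\ sat ?u _ <-> _ /\ sat ?v _ => replace u with v; [tauto|] end.
  apply functional_extensionality; intro i; unfold assign.
  destruct (s i) as [[|j]|c] eqn:E; simpl; rewrite ?E; reflexivity.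
Qed.

Lemma replacement (a : M) (f : M -> M) : term_definable (fun e => f (e 0)) ->
  exists b : M, forall y, y ∈ b <-> exists x, x ∈ a /\ y = f x.
Proof.
  intros [p [s Hp]].
  (* [zf_repl] has the argument at index 0 and the value at index 1, [term_definable] the other way
     round; the renaming swaps them. *)
  set (q := ren (fun i => match s i with inl 0 => 1 | inl 1 => 0 | _ => S (S i) end) p).
  assert (Hq : forall x y, sat (scons x (scons y (assign s (fun _ => a)))) q <-> y = f x).
  { intros x y; unfold q; rewrite sat_ren.
    rewrite (Hp (scons y (scons x (fun _ => a)))).
    match goal with |- sat ?u _ <-> sat ?v _ => replace u with v; [tauto|] end.
    apply functional_extensionality; intro i; unfold assign.
    destruct (s i) as [[|[|j]]|c] eqn:E; simpl; rewrite ?E; reflexivity. }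
  destruct (@zf_repl M HZF q (assign s (fun _ => a)) a) as [b Hb].
  - intros x _; exists (f x); split; [apply Hq; reflexivity|].
    intros y Hy; symmetry; apply Hq, Hy.
  - exists b; intro y; rewrite Hb.
    split; intros [x [Hx K]]; exists x; split; auto; apply Hq; exact K.
Qed.

Lemma sep_spec (a : M) (P : M -> Prop) : definable (fun e => P (e 0)) ->
  forall x, x ∈ sep a P <-> x ∈ a /\ P x.
Proof. intro H; apply (setof_spec (fun x => x ∈ a /\ P x)), separation, H. Qed.

Lemma image_spec (a : M) (f : M -> M) : term_definable (fun e => f (e 0)) ->
  forall y, y ∈ image a f <-> exists x, x ∈ a /\ y = f x.
Proof. intro H; apply (setof_spec (fun y => exists x, x ∈ a /\ y = f x)), replacement, H. Qed.

Lemma lam_spec (a : M) (f : M -> M) : term_definable (fun e => f (e 0)) ->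
  forall p, p ∈ lam a f <-> exists x, x ∈ a /\ p = pair x (f x).
Proof.
  intro H; apply (setof_spec (fun p => exists x, x ∈ a /\ p = pair x (f x))).
  apply replacement. dd.
Qed.

Lemma emp_spec (x : M) : ~ x ∈ emp.
Proof.
  intro H; apply (setof_spec (fun _ => False)) in H; [exact H|].
  destruct empty_exists as [o Ho]; exists o; intro y; split; [apply Ho|tauto].
Qed.

Lemma emp_eq (x : M) : (forall y, ~ y ∈ x) -> x = emp.
Proof.
  intro H; apply extensionality; intro y; split; intro K; [destruct (H y K)|destruct (emp_spec _ K)].
Qed.

Lemma nonempty (x : M) : x <> emp -> exists y, y ∈ x.
Proof.
  intro H; apply NNPP; intro K; apply H, emp_eq; intros y Hy; apply K; exists y; exact Hy.
Qed.

Lemma upair_spec (x y z : M) : z ∈ upair x y <-> z = x \/ z = y.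
Proof. apply (setof_spec (fun z => z = x \/ z = y)), (zf_pair HZF). Qed.

Lemma Union_spec (x z : M) : z ∈ Union x <-> exists y, y ∈ x /\ z ∈ y.
Proof. apply (setof_spec (fun z => exists y, y ∈ x /\ z ∈ y)), (zf_union HZF). Qed.

Lemma Pow_spec (x z : M) : z ∈ Pow x <-> subset z x.
Proof. apply (setof_spec (fun z => subset z x)), (zf_power HZF). Qed.

Lemma cup_spec (x y z : M) : z ∈ cup x y <-> z ∈ x \/ z ∈ y.
Proof.
  apply (setof_spec (fun z => z ∈ x \/ z ∈ y)). exists (Union (upair x y)); intro w.
  rewrite Union_spec; split.
  - intros [v [Hv Hw]]; apply upair_spec in Hv; destruct Hv as [->| ->]; auto.
  - intros [H|H]; [exists x|exists y]; rewrite upair_spec; auto.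
Qed.

Lemma suc_spec (x z : M) : z ∈ suc x <-> z ∈ x \/ z = x.
Proof.
  apply (setof_spec (fun z => z ∈ x \/ z = x)). exists (cup x (upair x x)); intro w.
  rewrite cup_spec, upair_spec; tauto.
Qed.

Lemma is_succ_suc (x s : M) : is_succ x s <-> s = suc x.
Proof.
  split.
  - intro H; apply extensionality; intro z; rewrite (H z), suc_spec; tauto.
  - intros -> z; apply suc_spec.
Qed.

Lemma is_upair_upair (x y p : M) : is_upair x y p <-> p = upair x y.
Proof.
  split.
  - intro H; apply extensionality; intro z; rewrite (H z), upair_spec; tauto.
  - intros -> z; apply upair_spec.
Qed.

Lemma is_pair_pair (x y p : M) : is_pair x y p <-> p = pair x y.
Proof.
  split.
  - intro H; apply extensionality; intro z; rewrite (H z), !is_upair_upair; unfold pair.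
    rewrite upair_spec; tauto.
  - intros -> z; unfold pair; rewrite upair_spec, !is_upair_upair; tauto.
Qed.

Lemma pair_inj (x y x' y' : M) : pair x y = pair x' y' -> x = x' /\ y = y'.
Proof.
  unfold pair; intro H.
  assert (U : forall a b c d : M, upair a b = upair c d -> (a = c /\ b = d) \/ (a = d /\ b = c)).
  { intros a b c d K.
    assert (Ka : a ∈ upair c d) by (rewrite <- K, upair_spec; auto).
    assert (Kb : b ∈ upair c d) by (rewrite <- K, upair_spec; auto).
    assert (Kc : c ∈ upair a b) by (rewrite K, upair_spec; auto).
    assert (Kd : d ∈ upair a b) by (rewrite K, upair_spec; auto).
    rewrite upair_spec in *; intuition congruence. }
  apply U in H; destruct H as [[H1 H2]|[H1 H2]]; apply U in H1, H2; intuition congruence.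
Qed.

Lemma maps_pair (f x y : M) : maps f x y <-> pair x y ∈ f.
Proof.
  split.
  - intros [p [Hp K]]; apply is_pair_pair in K; subst p; exact Hp.
  - intro H; exists (pair x y); split; [exact H|apply is_pair_pair; reflexivity].
Qed.

Lemma pair_in_Pow (a b x y : M) : x ∈ a -> y ∈ b -> pair x y ∈ Pow (Pow (cup a b)).
Proof.
  intros Hx Hy; rewrite Pow_spec; intros z Hz; apply Pow_spec; intros w Hw.
  unfold pair in Hz; apply upair_spec in Hz; apply cup_spec.
  destruct Hz as [->| ->]; apply upair_spec in Hw; destruct Hw as [->| ->]; auto.
Qed.

Lemma prod_spec (a b p : M) : p ∈ prod a b <-> exists x y, x ∈ a /\ y ∈ b /\ p = pair x y.
Proof.
  apply (setof_spec (fun p => exists x y, x ∈ a /\ y ∈ b /\ p = pair x y)).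
  exists (sep (Pow (Pow (cup a b))) (fun p => exists x y, x ∈ a /\ y ∈ b /\ p = pair x y)).
  intro q; rewrite sep_spec by dd. split; [tauto|].
  intros [x [y [Hx [Hy ->]]]]; split; [apply pair_in_Pow; assumption|eauto].
Qed.

Lemma pair_prod (a b x y : M) : pair x y ∈ prod a b <-> x ∈ a /\ y ∈ b.
Proof.
  rewrite prod_spec; split; [|intros []; eauto].
  intros [x' [y' [Hx [Hy K]]]]; apply pair_inj in K; destruct K; subst; auto.
Qed.

Lemma is_prod_prod (a b : M) : is_prod a b (prod a b).
Proof.
  intro p; rewrite prod_spec.
  split; intros [x [y [Hx [Hy K]]]]; exists x, y; rewrite is_pair_pair in *; auto.
Qed.

Lemma is_prod_eq (a b P : M) : is_prod a b P -> P = prod a b.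
Proof.
  intro H; apply extensionality; intro p. rewrite (H p), (is_prod_prod a b p); tauto.
Qed.

Lemma ite_true (P : Prop) (a b : M) : P -> ite P a b = a.
Proof. intro H; apply iota_eq; intro y; tauto. Qed.

Lemma ite_false (P : Prop) (a b : M) : ~ P -> ite P a b = b.
Proof. intro H; apply iota_eq; intro y; tauto. Qed.

Lemma not_mem_self (x : M) : ~ x ∈ x.
Proof.
  intro H; destruct (@zf_found M HZF (upair x x)) as [y [Hy K]].
  - exists x; rewrite upair_spec; auto.
  - apply upair_spec in Hy; assert (y = x) by tauto; subst y.
    apply (K x); [apply upair_spec; auto|exact H].
Qed.

Lemma mem_asym (x y : M) : x ∈ y -> ~ y ∈ x.
Proof.
  intros H1 H2; destruct (@zf_found M HZF (upair x y)) as [z [Hz K]].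
  - exists x; rewrite upair_spec; auto.
  - apply upair_spec in Hz; destruct Hz as [->| ->].
    + apply (K y); [apply upair_spec; auto|exact H2].
    + apply (K x); [apply upair_spec; auto|exact H1].
Qed.

Lemma no_3cycle (x y z : M) : x ∈ y -> y ∈ z -> ~ z ∈ x.
Proof.
  intros H1 H2 H3; destruct (@zf_found M HZF (cup (upair x y) (upair z z))) as [w [Hw K]].
  - exists x; rewrite cup_spec, upair_spec; auto.
  - rewrite cup_spec, !upair_spec in Hw.
    assert (E : w = x \/ w = y \/ w = z) by tauto; destruct E as [->|[->| ->]].
    + apply (K z); [rewrite cup_spec, !upair_spec; auto|exact H3].
    + apply (K x); [rewrite cup_spec, !upair_spec; auto|exact H1].
    + apply (K y); [rewrite cup_spec, !upair_spec; auto|exact H2].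
Qed.

(** * Functions *)

Lemma maps_lam (a : M) (f : M -> M) : term_definable (fun e => f (e 0)) ->
  forall x y, maps (lam a f) x y <-> x ∈ a /\ y = f x.
Proof.
  intros H x y; rewrite maps_pair, lam_spec by exact H; split.
  - intros [x' [Hx K]]; apply pair_inj in K; destruct K; subst; auto.
  - intros [Hx ->]; eauto.
Qed.

Lemma app_lam (a : M) (f : M -> M) : term_definable (fun e => f (e 0)) ->
  forall x, x ∈ a -> app (lam a f) x = f x.
Proof. intros H x Hx; apply iota_eq; intro y; rewrite maps_lam by exact H; tauto. Qed.

Lemma fun_on_lam (a : M) (f : M -> M) : term_definable (fun e => f (e 0)) ->
  fun_on (lam a f) (fun x => x ∈ a).
Proof.
  intro H; split.
  - intros p Hp; apply lam_spec in Hp; [|exact H]; destruct Hp as [x [Hx ->]].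
    exists x, (f x); split; [exact Hx|apply is_pair_pair; reflexivity].
  - intros x Hx; exists (f x); split; [apply maps_lam; auto|].
    intros y Hy; apply maps_lam in Hy; [symmetry; tauto|exact H].
Qed.

Lemma maps_app (f x y : M) (P : M -> Prop) : fun_on f P -> P x -> (maps f x y <-> y = app f x).
Proof.
  intros [_ Hf] Hx; destruct (Hf x Hx) as [v [Hv U]].
  assert (E : app f x = v).
  { apply iota_eq; intro w; split; [intro K; symmetry; apply U, K|intros ->; exact Hv]. }
  rewrite E; split; [intro K; symmetry; apply U, K|intros ->; exact Hv].
Qed.

Lemma maps_dom (f x y : M) (P : M -> Prop) : fun_on f P -> maps f x y -> P x.
Proof.
  intros [Hf _] K; apply maps_pair in K; destruct (Hf _ K) as [x' [y' [Hx K']]].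
  apply is_pair_pair, pair_inj in K'; destruct K'; subst; exact Hx.
Qed.

Lemma maps_iff (f x y : M) (P : M -> Prop) : fun_on f P -> (maps f x y <-> P x /\ y = app f x).
Proof.
  intro Hf; split.
  - intro K; pose proof (maps_dom _ _ _ _ Hf K) as Hx; split; [exact Hx|].
    apply (maps_app _ _ _ _ Hf Hx), K.
  - intros [Hx ->]; apply (maps_app _ _ _ _ Hf Hx); reflexivity.
Qed.

Lemma fun_ext (f g : M) (P : M -> Prop) : fun_on f P -> fun_on g P ->
  (forall x, P x -> app f x = app g x) -> f = g.
Proof.
  assert (W : forall f g : M, fun_on f P -> fun_on g P ->
    (forall x, P x -> app f x = app g x) -> forall p, p ∈ f -> p ∈ g).
  { intros f' g' Hf Hg H p Hp; destruct (proj1 Hf p Hp) as [x [y [Hx K]]].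
    apply is_pair_pair in K; subst p; apply maps_pair in Hp; apply maps_pair.
    rewrite maps_iff in Hp by exact Hf; rewrite maps_iff by exact Hg.
    destruct Hp as [_ ->]; split; [exact Hx|apply H, Hx]. }
  intros Hf Hg H; apply extensionality; intro p; split; apply W; auto.
  intros; symmetry; auto.
Qed.

Lemma lam_ext (a : M) (f g : M -> M) : (forall x, x ∈ a -> f x = g x) -> lam a f = lam a g.
Proof.
  intro H; unfold lam; f_equal. apply functional_extensionality; intro p.
  apply propositional_extensionality.
  split; intros [x [Hx ->]]; exists x; rewrite (H x Hx); auto.
Qed.

Definition inj_on (a : M) (f : M -> M) := forall x y, x ∈ a -> y ∈ a -> f x = f y -> x = y.

Definition inj (a b : M) := exists f, injection f a b.

Lemma func_lam (a b : M) (f : M -> M) : term_definable (fun e => f (e 0)) ->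
  (forall x, x ∈ a -> f x ∈ b) -> func (lam a f) a b.
Proof.
  intros H Hb; split; [apply fun_on_lam, H|].
  intros x y K; apply maps_lam in K; [|exact H]; destruct K as [Hx ->]; auto.
Qed.

Lemma injection_lam (a b : M) (f : M -> M) : term_definable (fun e => f (e 0)) ->
  (forall x, x ∈ a -> f x ∈ b) -> inj_on a f -> injection (lam a f) a b.
Proof.
  intros H Hb Hi; split; [apply func_lam; assumption|].
  intros x x' y K K'; apply maps_lam in K, K'; try exact H.
  destruct K as [Hx ->], K' as [Hx' E]; auto.
Qed.

Lemma surjection_lam (a b : M) (f : M -> M) : term_definable (fun e => f (e 0)) ->
  (forall x, x ∈ a -> f x ∈ b) -> (forall y, y ∈ b -> exists x, x ∈ a /\ f x = y) ->
  surjection (lam a f) a b.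
Proof.
  intros H Hb Hs; split; [apply func_lam; assumption|].
  intros y Hy; destruct (Hs y Hy) as [x [Hx <-]]; exists x; apply maps_lam; auto.
Qed.

Lemma bijection_lam (a b : M) (f : M -> M) : term_definable (fun e => f (e 0)) ->
  (forall x, x ∈ a -> f x ∈ b) -> inj_on a f ->
  (forall y, y ∈ b -> exists x, x ∈ a /\ f x = y) -> bijection (lam a f) a b.
Proof. intros; split; [apply injection_lam|apply surjection_lam]; assumption. Qed.

Lemma func_app (f a b x : M) : func f a b -> x ∈ a -> app f x ∈ b.
Proof.
  intros [Hf Hb] Hx; apply (Hb x); apply (maps_app _ _ _ _ Hf Hx); reflexivity.
Qed.

Lemma injection_app (f a b : M) : injection f a b -> inj_on a (app f).
Proof.
  intros [[Hf _] Hi] x y Hx Hy E; apply (Hi x y (app f x)).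
  - apply (maps_app _ _ _ _ Hf Hx); reflexivity.
  - apply (maps_app _ _ _ _ Hf Hy); exact E.
Qed.

Lemma surjection_app (f a b y : M) : surjection f a b -> y ∈ b -> exists x, x ∈ a /\ app f x = y.
Proof.
  intros [[Hf _] Hs] Hy; destruct (Hs y Hy) as [x K].
  rewrite (maps_iff _ _ _ _ Hf) in K; destruct K as [Hx ->]; eauto.
Qed.

Lemma inj_intro (a b : M) (f : M -> M) : term_definable (fun e => f (e 0)) ->
  (forall x, x ∈ a -> f x ∈ b) -> inj_on a f -> inj a b.
Proof. intros; exists (lam a f); apply injection_lam; assumption. Qed.

Lemma inj_elim (a b : M) : inj a b ->
  exists f, (forall x, x ∈ a -> app f x ∈ b) /\ inj_on a (app f).
Proof.
  intros [f Hf]; exists f; split; [|exact (injection_app _ _ _ Hf)].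
  intros x Hx; exact (func_app _ _ _ _ (proj1 Hf) Hx).
Qed.

Lemma inj_subset (a b : M) : subset a b -> inj a b.
Proof. intro H; apply inj_intro with (fun x => x); [dd|exact H|intros x y _ _ E; exact E]. Qed.

Lemma inj_trans (a b c : M) : inj a b -> inj b c -> inj a c.
Proof.
  intros H1 H2; destruct (inj_elim _ _ H1) as [f [Hf If]], (inj_elim _ _ H2) as [g [Hg Ig]].
  apply inj_intro with (fun x => app g (app f x)); [dd|auto|].
  intros x y Hx Hy E; apply If; auto.
Qed.

Lemma equipotent_inj (a b : M) : equipotent a b -> inj a b.
Proof. intros [f [Hf _]]; exists f; exact Hf. Qed.

Lemma equipotent_refl (a : M) : equipotent a a.
Proof.
  exists (lam a (fun x => x)); apply bijection_lam; [dd|auto|intros x y _ _ E; exact E|eauto].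
Qed.

Lemma equipotent_sym (a b : M) : equipotent a b -> equipotent b a.
Proof.
  intros [f [Hi Hs]].
  set (g := fun y => iota (fun x => x ∈ a /\ app f x = y)).
  assert (G : forall x, x ∈ a -> g (app f x) = x).
  { intros x Hx; apply iota_eq; intro z; split; [|intros ->; auto].
    intros [Hz E]; exact (injection_app _ _ _ Hi _ _ Hz Hx E). }
  exists (lam b g); apply bijection_lam; unfold g; [dd| | |]; fold g.
  - intros y Hy; destruct (surjection_app _ _ _ _ Hs Hy) as [x [Hx <-]]; fold (g (app f x)).
    rewrite G; auto.
  - intros y y' Hy Hy'; destruct (surjection_app _ _ _ _ Hs Hy) as [x [Hx <-]].
    destruct (surjection_app _ _ _ _ Hs Hy') as [x' [Hx' <-]].
    fold (g (app f x)) (g (app f x')); rewrite !G by auto; intros ->; reflexivity.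
  - intros x Hx; exists (app f x); split; [exact (func_app _ _ _ _ (proj1 Hs) Hx)|].
    fold (g (app f x)); auto.
Qed.

Lemma equipotent_trans (a b c : M) : equipotent a b -> equipotent b c -> equipotent a c.
Proof.
  intros [f [Hf Sf]] [g [Hg Sg]].
  exists (lam a (fun x => app g (app f x))); apply bijection_lam; [dd| | |].
  - intros x Hx; apply (func_app _ _ _ _ (proj1 Sg)), (func_app _ _ _ _ (proj1 Sf)), Hx.
  - intros x y Hx Hy E; apply (injection_app _ _ _ Hf); auto.
    apply (injection_app _ _ _ Hg); auto; apply (func_app _ _ _ _ (proj1 Sf)); auto.
  - intros z Hz; destruct (surjection_app _ _ _ _ Sg Hz) as [y [Hy <-]].
    destruct (surjection_app _ _ _ _ Sf Hy) as [x [Hx <-]]; eauto.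
Qed.

Lemma equipotent_image (a : M) (f : M -> M) : term_definable (fun e => f (e 0)) -> inj_on a f ->
  equipotent a (image a f).
Proof.
  intros H Hi; exists (lam a f); apply bijection_lam; auto.
  - intros x Hx; apply image_spec; eauto.
  - intros y Hy; apply image_spec in Hy; [|exact H]. destruct Hy as [x [Hx ->]]; eauto.
Qed.

Lemma T_closed (f : M -> M) : term_definable (fun e => f (e 0)) -> forall t, term_definable t -> term_definable (fun e => f (t e)).
Proof. intros H t Ht; exact (T_open (fun _ => f) H (fun n => n) _ Ht). Qed.

(** * Well-orders and recursion *)

Lemma wo_least (R : M -> M -> Prop) (A : M) (P : M -> Prop) :
  well_orders R A -> definable (fun e => P (e 0)) -> (exists x, x ∈ A /\ P x) ->
  exists m, m ∈ A /\ P m /\ forall x, x ∈ A -> P x -> m = x \/ R m x.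
Proof.
  intros [_ [_ [_ W]]] HP [x [Hx Px]].
  destruct (W (sep A P)) as [m [Hm K]].
  - intros z Hz; apply sep_spec in Hz; tauto.
  - exists x; apply sep_spec; auto.
  - apply sep_spec in Hm; [|exact HP]; exists m; split; [tauto|split; [tauto|]].
    intros z Hz Pz; apply K, sep_spec; auto.
Qed.

Lemma wo_ind (R : M -> M -> Prop) (A : M) (P : M -> Prop) :
  well_orders R A -> definable (fun e => P (e 0)) ->
  (forall x, x ∈ A -> (forall y, y ∈ A -> R y x -> P y) -> P x) -> forall x, x ∈ A -> P x.
Proof.
  intros W HP H x Hx; apply NNPP; intro K.
  destruct (wo_least R A (fun x => ~ P x) W) as [m [Hm [Pm L]]]; [dd|eauto|].
  apply Pm, H; [exact Hm|]. intros y Hy Ry; apply NNPP; intro Py.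
  destruct W as [Irr [Tr _]].
  destruct (L y Hy Py) as [->|Rm]; [apply (Irr y Hy Ry)|].
  apply (Irr y Hy), (Tr y m y); assumption.
Qed.

Definition order_iso (R : M -> M -> Prop) (A f o : M) :=
  bijection f A o /\ forall x y, x ∈ A -> y ∈ A -> (R x y <-> app f x ∈ app f y).

Section Recursion.
Context (R : M -> M -> Prop) (A : M) (G : M -> M -> M).
Context (W : well_orders R A).
Context (HR : forall t u, term_definable t -> term_definable u -> definable (fun e => R (t e) (u e))).
Context (HG : forall t u, term_definable t -> term_definable u -> term_definable (fun e => G (t e) (u e))).

Let seg (x : M) : M := sep A (fun y => R y x).
Let downclosed (B : M) := subset B A /\ forall y z, y ∈ B -> z ∈ A -> R z y -> z ∈ B.
Let attempt (h B : M) := downclosed B /\ forall y, y ∈ B -> app h y = G y (lam (seg y) (app h)).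

Lemma seg_spec (x y : M) : y ∈ seg x <-> y ∈ A /\ R y x.
Proof. unfold seg; rewrite sep_spec by dd; tauto. Qed.

Lemma D_attempt a b : term_definable a -> term_definable b -> definable (fun e => attempt (a e) (b e)).
Proof. intros; unfold attempt, downclosed, seg; dd. Qed.

Lemma attempt_agree (h B h' B' : M) : attempt h B -> attempt h' B' ->
  forall y, y ∈ A -> y ∈ B -> y ∈ B' -> app h y = app h' y.
Proof.
  intros [[S C] E] [[S' C'] E'].
  apply (wo_ind R A (fun y => y ∈ B -> y ∈ B' -> app h y = app h' y) W); [dd|].
  intros x Hx IH HB HB'; rewrite E, E' by assumption. f_equal.
  apply lam_ext; intros z Hz; apply seg_spec in Hz; destruct Hz as [Hz Rz].
  apply IH; eauto.
Qed.

(** [attempt_agree] makes the value independent of the attempt, so it can be described without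
    choosing one. *)
Let val (y : M) : M := iota (fun v => exists B h, attempt h B /\ y ∈ B /\ v = app h y).

Lemma T_val t : term_definable t -> term_definable (fun e => val (t e)).
Proof. intro Ht; unfold val; pose proof D_attempt; dd. Qed.

Lemma val_eq (h B y : M) : attempt h B -> y ∈ B -> val y = app h y.
Proof.
  intros H Hy; apply iota_eq; intro v; split; [|intros ->; eauto].
  intros [B' [h' [H' [Hy' ->]]]]; apply (attempt_agree h' B' h B); auto.
  apply (proj1 (proj1 H)), Hy.
Qed.

(** Below [x] the function [val] already obeys the recursion, since attempts exist there. One more
    application of [G] to the restrictions of [val] gives an attempt on all elements up to and
    including [x], with no need to select earlier attempts. *)
Lemma attempt_exists : forall x, x ∈ A -> exists B h, attempt h B /\ x ∈ B.
Proof.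
  pose proof T_val as Tv.
  apply (wo_ind R A _ W); [pose proof D_attempt; dd|].
  intros x Hx IH.
  assert (V : forall y, y ∈ A -> R y x -> val y = G y (lam (seg y) val)).
  { intros y Hy Ry; destruct (IH y Hy Ry) as [B [h [H HB]]].
    rewrite (val_eq h B y H HB), (proj2 H y HB); f_equal. apply lam_ext; intros z Hz.
    apply seg_spec in Hz; symmetry; apply (val_eq h B z H).
    apply (proj2 (proj1 H) y); tauto. }
  set (C := sep A (fun y => R y x \/ y = x)).
  assert (HC : forall y, y ∈ C <-> y ∈ A /\ (R y x \/ y = x)).
  { intro y; unfold C; rewrite sep_spec by dd; tauto. }
  assert (DG : term_definable (fun e => G (e 0) (lam (seg (e 0)) val))) by (unfold seg; dd).
  exists C, (lam C (fun y => G y (lam (seg y) val))).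
  destruct W as [_ [Tr _]].
  split; [split; [split|]|].
  - intros y Hy; apply HC in Hy; tauto.
  - intros y z Hy Hz Rz; apply HC in Hy; apply HC; split; [exact Hz|left].
    destruct Hy as [Hy [Ry|E]]; [apply (Tr z y x)|subst y]; assumption.
  - intros y Hy; rewrite (app_lam C (fun y => G y (lam (seg y) val))) by assumption; f_equal.
    apply HC in Hy; destruct Hy as [Hy Ry].
    apply lam_ext; intros z Hz; apply seg_spec in Hz; destruct Hz as [Hz Rz].
    assert (Rzx : R z x) by (destruct Ry as [Ry|Ey]; [apply (Tr z y x)|subst y]; assumption).
    rewrite (app_lam C (fun y => G y (lam (seg y) val))); [apply V; assumption|exact DG|].
    apply HC; auto.
  - apply HC; auto.
Qed.

Lemma recursion : exists f, fun_on f (fun x => x ∈ A) /\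
  forall x, x ∈ A -> app f x = G x (lam (sep A (fun y => R y x)) (app f)).
Proof.
  pose proof T_val as Tv.
  assert (Tv' : term_definable (fun e => val (e 0))) by dd.
  exists (lam A val); split; [apply fun_on_lam, Tv'|].
  intros x Hx; rewrite app_lam by assumption.
  destruct (attempt_exists x Hx) as [B [h [H HB]]].
  rewrite (val_eq h B x H HB), (proj2 H x HB); f_equal. apply lam_ext; intros z Hz.
  apply seg_spec in Hz; rewrite app_lam by tauto; symmetry; apply (val_eq h B z H).
  apply (proj2 (proj1 H) x); tauto.
Qed.

End Recursion.

(** * Ordinals *)

(** Foundation supplies irreflexivity, least elements and, by excluding cycles of length two and
    three, transitivity of membership. *)
Lemma ordinal_intro (a : M) : (forall x, x ∈ a -> subset x a) ->
  (forall x y, x ∈ a -> y ∈ a -> x ∈ y \/ x = y \/ y ∈ x) -> ordinal a.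
Proof.
  intros Tr Tot; split; [exact Tr|split; [|split; [|split]]].
  - intros x _; apply not_mem_self.
  - intros x y z Hx Hy Hz Hxy Hyz; destruct (Tot x z Hx Hz) as [K|[K|K]]; [exact K| |].
    + subst z; destruct (mem_asym _ _ Hxy Hyz).
    + destruct (no_3cycle _ _ _ Hxy Hyz K).
  - exact Tot.
  - intros B HB [x Hx]; destruct (@zf_found M HZF B) as [m [Hm K]]; [eauto|].
    exists m; split; [exact Hm|]. intros y Hy.
    destruct (Tot m y (HB m Hm) (HB y Hy)) as [?|[?|L]]; auto; destruct (K y Hy L).
Qed.

Lemma ordinal_tri (a x y : M) : ordinal a -> x ∈ a -> y ∈ a -> x ∈ y \/ x = y \/ y ∈ x.
Proof. intros [_ [_ [_ [H _]]]]; apply H. Qed.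

Lemma ord_trans (a x y : M) : ordinal a -> x ∈ y -> y ∈ a -> x ∈ a.
Proof. intros [H _] Hx Hy; exact (H y Hy x Hx). Qed.

Lemma ord_mem (a x : M) : ordinal a -> x ∈ a -> ordinal x.
Proof.
  intros H Hx; apply ordinal_intro.
  - intros y Hy z Hz; destruct H as [Tr [_ [Tr' _]]].
    assert (y ∈ a) by exact (Tr x Hx y Hy).
    assert (z ∈ a) by exact (Tr y H z Hz). apply (Tr' z y x); assumption.
  - intros y z Hy Hz; apply (ordinal_tri a); [exact H|..]; apply (ord_trans a _ x); assumption.
Qed.

(** If [a] is not all of [b], the least element of [b] outside [a] is [a] itself. *)
Lemma ord_subset_cases (a b : M) : ordinal a -> ordinal b -> subset a b -> a = b \/ a ∈ b.
Proof.
  intros Ha Hb S; destruct (classic (a = b)) as [E|N]; [auto|right].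
  destruct (@zf_found M HZF (sep b (fun x => ~ x ∈ a))) as [m [Hm K]].
  - apply NNPP; intro K; apply N, extensionality; intro z; split; [apply S|].
    intro Hz; apply NNPP; intro Hza; apply K; exists z; apply sep_spec; [dd|auto].
  - apply sep_spec in Hm; [|dd]; destruct Hm as [Hm Hma].
    assert (E : m = a); [|subst m; exact Hm].
    apply extensionality; intro z; split; intro Hz.
    + apply NNPP; intro Hza; apply (K z); [|exact Hz]. apply sep_spec; [dd|].
      split; [apply (ord_trans b z m); assumption|exact Hza].
    + destruct (ordinal_tri b z m Hb (S z Hz) Hm) as [L|[L|L]]; [exact L|subst z; tauto|].
      destruct Hma; apply (ord_trans a m z); assumption.
Qed.

(** The intersection of [a] and [b] is an ordinal. Were it proper in both, it would belong to both,
    hence to itself. *)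
Lemma ord_total (a b : M) : ordinal a -> ordinal b -> a ∈ b \/ a = b \/ b ∈ a.
Proof.
  intros Ha Hb; set (c := sep a (fun x => x ∈ b)).
  assert (Hc : forall x, x ∈ c <-> x ∈ a /\ x ∈ b) by (intro x; unfold c; rewrite sep_spec by dd; tauto).
  assert (Oc : ordinal c).
  { apply ordinal_intro.
    - intros x Hx y Hy; apply Hc in Hx; apply Hc; split; [apply (ord_trans a y x)|apply (ord_trans b y x)]; tauto.
    - intros x y Hx Hy; apply Hc in Hx, Hy; apply (ordinal_tri a); tauto. }
  destruct (ord_subset_cases c a Oc Ha) as [E|L]; [intros x Hx; apply Hc in Hx; tauto| |].
  - destruct (ord_subset_cases c b Oc Hb) as [E'|L']; [intros x Hx; apply Hc in Hx; tauto| |].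
    + rewrite <- E, <- E'; auto.
    + left; rewrite <- E; exact L'.
  - destruct (ord_subset_cases c b Oc Hb) as [E'|L']; [intros x Hx; apply Hc in Hx; tauto| |].
    + right; right; rewrite <- E'; exact L.
    + destruct (not_mem_self c); apply Hc; auto.
Qed.

Lemma ord_le_refl (a : M) : ord_le a a.
Proof. right; reflexivity. Qed.

Lemma ord_le_subset (a b : M) : ordinal b -> ord_le a b -> subset a b.
Proof. intros Hb [H| ->] x Hx; [exact (ord_trans b x a Hb Hx H)|exact Hx]. Qed.

Lemma ord_subset_le (a b : M) : ordinal a -> ordinal b -> subset a b -> ord_le a b.
Proof. intros Ha Hb H; destruct (ord_subset_cases a b Ha Hb H); [right|left]; assumption. Qed.

Lemma ord_le_total (a b : M) : ordinal a -> ordinal b -> ord_le a b \/ b ∈ a.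
Proof. intros Ha Hb; unfold ord_le; destruct (ord_total a b Ha Hb) as [?|[?|?]]; auto. Qed.

Lemma ord_not_lt (a b : M) : ordinal a -> ordinal b -> ~ a ∈ b -> ord_le b a.
Proof. intros Ha Hb N; destruct (ord_le_total b a Hb Ha); [assumption|contradiction]. Qed.

Lemma ord_le_lt (a b c : M) : ordinal c -> ord_le a b -> b ∈ c -> a ∈ c.
Proof. intros Hc [H| ->] K; [exact (ord_trans c a b Hc H K)|exact K]. Qed.

Lemma ord_lt_le (a b c : M) : ordinal c -> a ∈ b -> ord_le b c -> a ∈ c.
Proof. intros Hc H L; exact (ord_le_subset _ _ Hc L _ H). Qed.

Lemma ord_le_trans (a b c : M) : ordinal c -> ord_le a b -> ord_le b c -> ord_le a c.
Proof. intros Hc [H| ->] L; [left; exact (ord_lt_le a b c Hc H L)|exact L]. Qed.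

Lemma ord_lt_not_le (a b : M) : a ∈ b -> ~ ord_le b a.
Proof. intros H [K| ->]; [exact (mem_asym _ _ H K)|exact (not_mem_self _ H)]. Qed.

Lemma ord_le_antisym (a b : M) : ord_le a b -> ord_le b a -> a = b.
Proof. intros [H|H] K; [destruct (ord_lt_not_le _ _ H K)|exact H]. Qed.

Lemma ordset_wo (u : M) : (forall x, x ∈ u -> ordinal x) -> well_orders (@mem M) u.
Proof.
  intro H; split; [|split; [|split]].
  - intros x _; apply not_mem_self.
  - intros x y z _ _ Hz Hxy Hyz; apply (ord_trans z x y); auto.
  - intros x y Hx Hy; apply ord_total; auto.
  - intros B HB K; destruct (@zf_found M HZF B K) as [m [Hm L]]; exists m; split; [exact Hm|].
    intros x Hx; destruct (ord_total m x) as [?|[?|N]]; auto; destruct (L x Hx N).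
Qed.

Lemma least_exists (P : M -> Prop) : definable (fun e => P (e 0)) -> (exists a, ordinal a /\ P a) ->
  exists m, least_ord P m.
Proof.
  intros HP [a [Ha Pa]].
  destruct (classic (exists x, x ∈ a /\ P x)) as [K|K].
  - destruct (wo_least (@mem M) a P) as [m [Hm [Pm L]]]; [apply Ha|exact HP|exact K|].
    exists m; split; [exact (ord_mem a m Ha Hm)|split; [exact Pm|]]. intros b Hb Pb.
    destruct (ord_total a b Ha Hb) as [C|[C|C]].
    + left; exact (ord_trans b m a Hb Hm C).
    + left; rewrite <- C; exact Hm.
    + destruct (L b C Pb) as [->|]; [right|left]; auto.
  - exists a; split; [exact Ha|split; [exact Pa|]]. intros b Hb Pb.
    apply ord_not_lt; auto; intro C; apply K; eauto.
Qed.

Lemma least_unique (P : M -> Prop) (m m' : M) : least_ord P m -> least_ord P m' -> m = m'.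
Proof. intros [H [Pm L]] [H' [Pm' L']]; apply ord_le_antisym; auto. Qed.

Lemma ord_ind (P : M -> Prop) : definable (fun e => P (e 0)) ->
  (forall a, ordinal a -> (forall b, b ∈ a -> P b) -> P a) -> forall a, ordinal a -> P a.
Proof.
  intros HP H a Ha; apply NNPP; intro K.
  destruct (least_exists (fun x => ~ P x)) as [m [Hm [Pm L]]]; [dd|eauto|].
  apply Pm, H; [exact Hm|]. intros b Hb; apply NNPP; intro Pb.
  exact (ord_lt_not_le b m Hb (L b (ord_mem m b Hm Hb) Pb)).
Qed.

Lemma ordinal_suc (a : M) : ordinal a -> ordinal (suc a).
Proof.
  intro Ha; apply ordinal_intro.
  - intros x Hx y Hy; apply suc_spec in Hx; apply suc_spec; left.
    destruct Hx as [Hx| ->]; [exact (ord_trans a y x Ha Hy Hx)|exact Hy].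
  - intros x y Hx Hy; rewrite suc_spec in *.
    apply ord_total; [destruct Hx as [Hx| ->]|destruct Hy as [Hy| ->]]; eauto using ord_mem.
Qed.

Lemma suc_mem (a : M) : a ∈ suc a.
Proof. apply suc_spec; auto. Qed.

Lemma suc_le (a b : M) : ordinal b -> a ∈ b -> ord_le (suc a) b.
Proof.
  intros Hb H; apply ord_subset_le; [apply ordinal_suc, (ord_mem b), H; exact Hb|exact Hb|].
  intros x Hx; apply suc_spec in Hx; destruct Hx as [Hx| ->]; [exact (ord_trans b x a Hb Hx H)|exact H].
Qed.

Lemma mem_suc_le (a b : M) : a ∈ suc b <-> ord_le a b.
Proof. rewrite suc_spec; reflexivity. Qed.

Lemma suc_inj (a b : M) : suc a = suc b -> a = b.
Proof.
  intro E; assert (Ha : a ∈ suc b) by (rewrite <- E; apply suc_mem).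
  assert (Hb : b ∈ suc a) by (rewrite E; apply suc_mem).
  apply suc_spec in Ha, Hb; destruct Ha as [Ha|]; [|assumption]. destruct Hb as [Hb|]; [|auto].
  destruct (mem_asym _ _ Ha Hb).
Qed.

Lemma suc_not_emp (a : M) : suc a <> emp.
Proof. intro E; apply (emp_spec a); rewrite <- E; apply suc_mem. Qed.

Lemma ordinal_emp : ordinal emp.
Proof. apply ordinal_intro; intros x; intros; destruct (emp_spec x); assumption. Qed.

Lemma ordinal_emp_mem (a : M) : ordinal a -> a <> emp -> emp ∈ a.
Proof.
  intros Ha N; destruct (ord_total emp a ordinal_emp Ha) as [K|[K|K]]; [exact K|congruence|].
  destruct (emp_spec _ K).
Qed.

Lemma limit_spec (a : M) : limit_ordinal a <-> ordinal a /\ a <> emp /\ forall x, x ∈ a -> suc x ∈ a.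
Proof.
  unfold limit_ordinal; split; intros [H1 [H2 H3]]; split; auto; split.
  - intros ->; destruct H2 as [x Hx]; exact (emp_spec _ Hx).
  - intros x Hx; destruct (H3 x Hx) as [s [Hs K]]; apply is_succ_suc in K; subst; exact Hs.
  - apply nonempty, H2.
  - intros x Hx; exists (suc x); split; [auto|apply is_succ_suc; reflexivity].
Qed.

Lemma ordinal_cases (a : M) : ordinal a ->
  a = emp \/ (exists b, ordinal b /\ a = suc b) \/ limit_ordinal a.
Proof.
  intro Ha; destruct (classic (a = emp)) as [E|N]; [auto|right].
  destruct (classic (exists b, b ∈ a /\ ~ suc b ∈ a)) as [[b [Hb K]]|K]; [left|right].
  - exists b; split; [exact (ord_mem a b Ha Hb)|].
    destruct (suc_le b a Ha Hb) as [L|E]; [contradiction|auto].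
  - apply limit_spec; split; [exact Ha|split; [exact N|]].
    intros x Hx; apply NNPP; intro L; apply K; eauto.
Qed.

(** * The ordinal omega *)

Definition omega : M := iota is_omega.

Lemma T_omega : term_definable (fun _ => omega).
Proof. apply T_const. Qed.

(** The axiom of infinity only gives some inductive set [X], which may contain anything else. [N]
    singles out the natural numbers as the ordinals below or equal to which everything is zero or a
    successor; by induction they all lie in [X], so they form a set. *)
Lemma exists_limit : exists a : M, limit_ordinal a.
Proof.
  destruct (zf_inf HZF) as [X [[o [Ho HoX]] HX]].
  set (N := fun n => ordinal n /\ forall m, ord_le m n -> m = emp \/ exists k, k ∈ m /\ m = suc k).
  assert (DN : forall t, term_definable t -> definable (fun e => N (t e))) by (intros; unfold N; dd).
  assert (E : o = emp) by (apply emp_eq; exact Ho); subst o.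
  assert (NX : forall n, ordinal n -> N n -> n ∈ X).
  { apply (ord_ind (fun n => N n -> n ∈ X)); [dd|]. intros n _ IH [On Nn].
    destruct (Nn n (ord_le_refl n)) as [->|[k [Hk E]]]; [exact HoX|].
    destruct (HX k) as [s [Hs Hs']].
    - apply IH; [exact Hk|]. split; [exact (ord_mem n k On Hk)|].
      intros m Hm; apply Nn; left; exact (ord_le_lt m k n On Hm Hk).
    - apply is_succ_suc in Hs; subst s; rewrite E; exact Hs'. }
  set (w := sep X N).
  assert (Hw : forall x, x ∈ w <-> N x).
  { intro x; unfold w; rewrite sep_spec by dd; split; [tauto|]. intro Nx; split; [|exact Nx].
    apply NX; [apply Nx|exact Nx]. }
  assert (Ow : ordinal w).
  { apply ordinal_intro.
    - intros x Hx y Hy; apply Hw in Hx; apply Hw; destruct Hx as [Ox Nx].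
      split; [exact (ord_mem x y Ox Hy)|]. intros m Hm; apply Nx; left; exact (ord_le_lt m y x Ox Hm Hy).
    - intros x y Hx Hy; apply Hw in Hx, Hy; apply ord_total; [apply Hx|apply Hy]. }
  exists w; apply limit_spec; split; [exact Ow|split].
  - assert (K : emp ∈ w); [|intro E; rewrite E in K; exact (emp_spec _ K)].
    apply Hw; split; [apply ordinal_emp|]. intros m [Hm|Hm]; [destruct (emp_spec _ Hm)|auto].
  - intros x Hx; apply Hw in Hx; apply Hw; destruct Hx as [Ox Nx].
    split; [apply ordinal_suc, Ox|]. intros m [Hm| ->].
    + apply Nx, mem_suc_le, Hm.
    + right; exists x; split; [apply suc_mem|reflexivity].
Qed.

Lemma omega_is_omega : is_omega omega.
Proof.
  apply (iota_spec is_omega). destruct (least_exists limit_ordinal) as [w Hw]; [dd| |].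
  - destruct exists_limit as [a Ha]; exists a; split; [apply Ha|exact Ha].
  - exists w; split; [exact Hw|]. intros w'; apply least_unique, Hw.
Qed.

Lemma is_omega_eq (w : M) : is_omega w -> w = omega.
Proof. intro H; exact (least_unique _ _ _ H omega_is_omega). Qed.

Lemma ordinal_omega : ordinal omega.
Proof. apply omega_is_omega. Qed.

Lemma emp_omega : emp ∈ omega.
Proof.
  destruct omega_is_omega as [Ow [L _]]; apply ordinal_emp_mem; [exact Ow|apply limit_spec, L].
Qed.

Lemma suc_omega (n : M) : n ∈ omega -> suc n ∈ omega.
Proof. destruct omega_is_omega as [_ [L _]]; apply limit_spec in L; apply L. Qed.

Lemma omega_cases (n : M) : n ∈ omega -> n = emp \/ exists k, k ∈ omega /\ n = suc k.
Proof.
  intro Hn; destruct (ordinal_cases n (ord_mem _ _ ordinal_omega Hn)) as [E|[[b [Hb E]]|L]]; [auto| |].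
  - right; exists b; split; [|exact E]. apply (ord_trans omega b n); [apply ordinal_omega| |exact Hn].
    rewrite E; apply suc_mem.
  - destruct omega_is_omega as [_ [_ K]].
    destruct (ord_lt_not_le _ _ Hn (K n (proj1 L) L)).
Qed.

Lemma omega_ind (P : M -> Prop) : definable (fun e => P (e 0)) -> P emp ->
  (forall n, n ∈ omega -> P n -> P (suc n)) -> forall n, n ∈ omega -> P n.
Proof.
  intros HP H0 HS. apply (wo_ind (@mem M) omega P); [apply ordinal_omega|exact HP|].
  intros n Hn IH; destruct (omega_cases n Hn) as [->|[k [Hk ->]]]; [exact H0|].
  apply HS; [exact Hk|]. apply IH; [exact Hk|apply suc_mem].
Qed.

Lemma omega_le_limit (a : M) : limit_ordinal a -> ord_le omega a.
Proof. intro H; destruct omega_is_omega as [_ [_ K]]; apply K; [apply H|exact H]. Qed.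

(** * Order types *)

Lemma order_iso_value (R : M -> M -> Prop) (A f o x : M) : ordinal o -> order_iso R A f o -> x ∈ A ->
  forall z, z ∈ app f x <-> exists y, y ∈ A /\ R y x /\ z = app f y.
Proof.
  intros Ho [[Hi Hs] H] Hx z; split.
  - intro Hz. destruct (surjection_app _ _ _ z Hs) as [y [Hy <-]].
    + apply (ord_trans o z (app f x)); [exact Ho|exact Hz|apply (func_app _ _ _ _ (proj1 Hs) Hx)].
    + exists y; split; [exact Hy|split; [apply H; assumption|reflexivity]].
  - intros [y [Hy [Ry ->]]]; apply H; assumption.
Qed.

(** The value at [x] is the set of values at the predecessors of [x], so induction along [R]
    determines it. This makes collapses and order types meaningful definite descriptions. *)
Lemma order_iso_unique (R : M -> M -> Prop) (A f o g o' : M) : well_orders R A ->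
  ordinal o -> ordinal o' -> order_iso R A f o -> order_iso R A g o' -> f = g /\ o = o'.
Proof.
  intros W Ho Ho' Hf Hg.
  assert (E : forall x, x ∈ A -> app f x = app g x).
  { apply (wo_ind R A _ W); [dd|]. intros x Hx IH; apply extensionality; intro z.
    rewrite (order_iso_value R A f o), (order_iso_value R A g o') by assumption.
    split; intros [y [Hy [Ry ->]]]; exists y; rewrite (IH y Hy Ry); auto. }
  split.
  - exact (fun_ext f g _ (proj1 (proj1 (proj1 (proj1 Hf)))) (proj1 (proj1 (proj1 (proj1 Hg)))) E).
  - apply extensionality; intro z; split; intro Hz.
    + destruct (surjection_app _ _ _ z (proj2 (proj1 Hf)) Hz) as [x [Hx <-]].
      rewrite E by exact Hx; exact (func_app _ _ _ _ (proj1 (proj1 (proj1 Hg))) Hx).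
    + destruct (surjection_app _ _ _ z (proj2 (proj1 Hg)) Hz) as [x [Hx <-]].
      rewrite <- E by exact Hx; exact (func_app _ _ _ _ (proj1 (proj1 (proj1 Hf))) Hx).
Qed.

(** Mostowski collapse: by recursion, [x] is sent to the set of the values at its predecessors. *)
Lemma order_iso_exists (R : M -> M -> Prop) (A : M) : well_orders R A ->
  (forall t u, term_definable t -> term_definable u -> definable (fun e => R (t e) (u e))) ->
  exists f o, ordinal o /\ order_iso R A f o.
Proof.
  intros W HR.
  destruct (recursion R A (fun x h => setof (fun z => exists y, y ∈ A /\ R y x /\ z = app h y)) W HR)
    as [f [Hf E]]; [intros; dd|].
  assert (V : forall x, x ∈ A -> forall z, z ∈ app f x <-> exists y, y ∈ A /\ R y x /\ z = app f y).
  { intros x Hx z; rewrite (E x Hx).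
    transitivity (exists y, y ∈ A /\ R y x /\ z = app (lam (sep A (fun y => R y x)) (app f)) y).
    - apply (setof_spec (fun z => exists y, y ∈ A /\ R y x /\ z = app (lam (sep A (fun y => R y x)) (app f)) y)).
      exists (image (sep A (fun y => R y x)) (app f)); intro w; rewrite image_spec by dd.
      split; intros [y Hy].
      + destruct Hy as [Hy ->]; pose proof Hy as Hy'; apply sep_spec in Hy'; [|dd].
        exists y; rewrite app_lam; [tauto|dd|exact Hy].
      + destruct Hy as [Hy [Ry ->]]; exists y.
        assert (y ∈ sep A (fun y => R y x)) by (apply sep_spec; [dd|auto]).
        rewrite app_lam; [auto|dd|assumption].
    - split; intros [y [Hy [Ry ->]]]; exists y; rewrite app_lam; auto; try dd; apply sep_spec; auto; dd. }
  destruct W as [Irr [Tr [Tot L]]].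
  assert (I : inj_on A (app f)).
  { intros x y Hx Hy Exy; destruct (Tot x y Hx Hy) as [K|[K|K]]; [|exact K|].
    - destruct (not_mem_self (app f x)); rewrite Exy at 2; apply V; eauto.
    - destruct (not_mem_self (app f y)); rewrite <- Exy at 2; apply V; eauto. }
  assert (O : forall x y, x ∈ A -> y ∈ A -> (R x y <-> app f x ∈ app f y)).
  { intros x y Hx Hy; rewrite (V y Hy); split; [eauto|].
    intros [z [Hz [Rz Ez]]]; rewrite (I x z); auto. }
  assert (Him : forall z, z ∈ image A (app f) <-> exists x, x ∈ A /\ z = app f x).
  { apply image_spec; dd. }
  exists f, (image A (app f)); split; [|split; [|exact O]].
  - apply ordinal_intro.
    + intros z Hz w Hw; apply Him in Hz; destruct Hz as [x [Hx ->]].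
      apply V in Hw; [|exact Hx]. destruct Hw as [y [Hy [_ ->]]]; apply Him; eauto.
    + intros z w Hz Hw; apply Him in Hz, Hw; destruct Hz as [x [Hx ->]], Hw as [y [Hy ->]].
      rewrite <- !O by assumption. destruct (Tot x y Hx Hy) as [?|[->|?]]; auto.
  - assert (F : func f A (image A (app f))).
    { split; [exact Hf|]. intros x y K; rewrite (maps_iff _ _ _ _ Hf) in K.
      apply Him; exists x; exact K. }
    split; split; try exact F.
    + intros x x' y K K'; rewrite (maps_iff _ _ _ _ Hf) in K; rewrite (maps_iff _ _ _ _ Hf) in K'.
      destruct K as [Hx ->], K' as [Hx' E']; apply I; assumption.
    + intros y Hy; apply Him in Hy; destruct Hy as [x [Hx ->]]; exists x.
      apply (maps_iff _ _ _ _ Hf); auto.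
Qed.

Definition ordset (u : M) : Prop := forall x, x ∈ u -> ordinal x.
Definition ot (u : M) : M := iota (otp u).
Definition col (u : M) : M := iota (fun f => exists o, ordinal o /\ order_iso (@mem M) u f o).

Lemma D_inj a b : term_definable a -> term_definable b -> definable (fun e => inj (a e) (b e)).
Proof. intros; unfold inj; dd. Qed.

Lemma D_order_iso (R : (nat -> M) -> M -> M -> Prop) a f o :
  (forall r t u, term_definable t -> term_definable u -> definable (fun e => R (fun n => e (r n)) (t e) (u e))) ->
  term_definable a -> term_definable f -> term_definable o -> definable (fun e => order_iso (R e) (a e) (f e) (o e)).
Proof. intros; unfold order_iso; dd. Qed.

Lemma T_col a : term_definable a -> term_definable (fun e => col (a e)).
Proof. intros; unfold col, order_iso; dd. Qed.

Ltac def_order_type :=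
  lazymatch goal with
  | |- definable (fun e => inj _ _) => apply D_inj
  | |- definable (fun e => order_iso _ _ _ _) => apply D_order_iso; [intros|..]
  | |- term_definable (fun e => col _) => apply T_col
  | _ => def_constructor
  end.
Ltac def_hook ::= def_order_type.

Lemma ordinal_ordset (a : M) : ordinal a -> ordset a.
Proof. intros Ha x; apply ord_mem, Ha. Qed.

Lemma ordset_subset (u v : M) : ordset v -> subset u v -> ordset u.
Proof. intros H S x Hx; apply H, S, Hx. Qed.

Lemma otp_iff (u o : M) : otp u o <-> ordinal o /\ exists f, order_iso (@mem M) u f o.
Proof.
  unfold otp, order_iso; split; intros [Ho [f [Hf H]]]; (split; [exact Ho|]); exists f;
    (split; [exact Hf|]); pose proof (proj1 (proj1 (proj1 Hf))) as F.
  - intros x y Hx Hy; apply H; apply (maps_app _ _ _ _ F); auto.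
  - intros x x' y y' K K'; rewrite (maps_iff _ _ _ _ F) in K; rewrite (maps_iff _ _ _ _ F) in K'.
    destruct K as [Hx ->], K' as [Hx' ->]; auto.
Qed.

Lemma col_spec (u : M) : ordset u -> ordinal (ot u) /\ order_iso (@mem M) u (col u) (ot u).
Proof.
  intro H; pose proof (ordset_wo u H) as W.
  destruct (order_iso_exists _ u W) as [f [o [Ho Hf]]]; [intros; dd|].
  assert (E : ot u = o).
  { apply iota_eq; intro o'; rewrite otp_iff; split; [|intros ->; eauto].
    intros [Ho' [g Hg]]; exact (proj2 (order_iso_unique _ _ _ _ _ _ W Ho' Ho Hg Hf)). }
  assert (E' : col u = f).
  { apply iota_eq; intro g; split; [|intros ->; eauto].
    intros [o' [Ho' Hg]]; exact (proj1 (order_iso_unique _ _ _ _ _ _ W Ho' Ho Hg Hf)). }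
  rewrite E, E'; auto.
Qed.

Lemma otp_eq (u o : M) : ordset u -> (otp u o <-> o = ot u).
Proof.
  intro H; pose proof (ordset_wo u H) as W; destruct (col_spec u H) as [Ho Hf].
  rewrite otp_iff; split; [|intros ->; eauto].
  intros [Ho' [g Hg]]; exact (proj2 (order_iso_unique _ _ _ _ _ _ W Ho' Ho Hg Hf)).
Qed.

Lemma ordinal_ot (u : M) : ordset u -> ordinal (ot u).
Proof. intro H; apply col_spec, H. Qed.

Lemma col_in (u x : M) : ordset u -> x ∈ u -> app (col u) x ∈ ot u.
Proof.
  intros H Hx; destruct (col_spec u H) as [_ [[[F _] _] _]]; exact (func_app _ _ _ _ F Hx).
Qed.

Lemma col_mono (u x y : M) : ordset u -> x ∈ u -> y ∈ u ->
  (x ∈ y <-> app (col u) x ∈ app (col u) y).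
Proof. intros H Hx Hy; destruct (col_spec u H) as [_ [_ K]]; apply K; assumption. Qed.

Lemma col_inj (u : M) : ordset u -> inj_on u (app (col u)).
Proof. intro H; destruct (col_spec u H) as [_ [[F _] _]]; exact (injection_app _ _ _ F). Qed.

Lemma col_surj (u y : M) : ordset u -> y ∈ ot u -> exists x, x ∈ u /\ app (col u) x = y.
Proof. intros H; destruct (col_spec u H) as [_ [[_ F] _]]; apply (surjection_app _ _ _ _ F). Qed.

Lemma equipotent_ot (u : M) : ordset u -> equipotent u (ot u).
Proof. intro H; exists (col u); apply col_spec, H. Qed.

(** An increasing map satisfies x <= f x: at a least counterexample [x], the point f x would be a
    smaller one. *)
Lemma embedding_le (a b : M) (f : M -> M) : ordinal a -> ordinal b -> term_definable (fun e => f (e 0)) ->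
  (forall x, x ∈ a -> f x ∈ b) -> (forall x y, x ∈ a -> y ∈ a -> x ∈ y -> f x ∈ f y) -> ord_le a b.
Proof.
  intros Ha Hb Hf Hab Hm; pose proof (T_closed f Hf) as Tf.
  assert (K : forall x, x ∈ a -> ord_le x (f x)).
  { apply (wo_ind (@mem M) a _ (proj2 Ha)); [dd|]. intros x Hx IH.
    assert (Of : ordinal (f x)) by (apply (ord_mem b); auto).
    assert (Ox : ordinal x) by (apply (ord_mem a); auto).
    apply ord_not_lt; [exact Of|exact Ox|]. intro L.
    assert (Hfx : f x ∈ a) by (apply (ord_trans a (f x) x); assumption).
    apply (ord_lt_not_le (f (f x)) (f x)); auto. }
  apply ord_subset_le; [exact Ha|exact Hb|].
  intros x Hx; apply (ord_le_lt x (f x) b Hb); auto.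
Qed.

Lemma ot_le_of_increasing (u k : M) (f : M -> M) : ordset u -> ordinal k -> term_definable (fun e => f (e 0)) ->
  (forall x, x ∈ u -> f x ∈ k) -> (forall x y, x ∈ u -> y ∈ u -> x ∈ y -> f x ∈ f y) ->
  ord_le (ot u) k.
Proof.
  intros Hu Hk Hf Hb Hm; pose proof (T_closed f Hf) as Tf.
  set (g := fun y => iota (fun x => x ∈ u /\ app (col u) x = y)).
  assert (G : forall x, x ∈ u -> g (app (col u) x) = x).
  { intros x Hx; apply iota_eq; intro z; split; [|intros ->; auto].
    intros [Hz E]; exact (col_inj u Hu _ _ Hz Hx E). }
  apply (embedding_le (ot u) k (fun y => f (g y))); [apply ordinal_ot, Hu|exact Hk|unfold g; dd| |].
  - intros y Hy; destruct (col_surj u y Hu Hy) as [x [Hx <-]]; rewrite G; auto.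
  - intros y y' Hy Hy' L; destruct (col_surj u y Hu Hy) as [x [Hx <-]].
    destruct (col_surj u y' Hu Hy') as [x' [Hx' <-]]; rewrite !G by assumption.
    apply Hm; auto; apply (col_mono u); auto.
Qed.

Lemma ot_subset (u v : M) : ordset v -> subset u v -> ord_le (ot u) (ot v).
Proof.
  intros Hv S; pose proof S as S'; unfold subset in S'; apply (ot_le_of_increasing u (ot v) (app (col v))); [exact (ordset_subset u v Hv S)|
    apply ordinal_ot, Hv|dd| |].
  - intros x Hx; apply col_in; auto.
  - intros x y Hx Hy L; apply -> (col_mono v); auto.
Qed.

Lemma otp_self (a : M) : ordinal a -> otp a a.
Proof.
  intro Ha; apply otp_iff; split; [exact Ha|]. exists (lam a (fun x => x)).
  assert (Hid : term_definable (fun e : nat -> M => e 0)) by dd. split.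
  - apply bijection_lam; [exact Hid|auto|intros x y _ _ E; exact E|eauto].
  - intros x y Hx Hy; rewrite !(app_lam a (fun x => x)) by assumption; tauto.
Qed.

Lemma ot_self (a : M) : ordinal a -> ot a = a.
Proof. intro Ha; symmetry; apply otp_eq; [apply ordinal_ordset, Ha|apply otp_self, Ha]. Qed.

Lemma ot_subset_ordinal (u a : M) : ordinal a -> subset u a -> ord_le (ot u) a.
Proof.
  intros Ha S; rewrite <- (ot_self a Ha) at 1; apply ot_subset; [apply ordinal_ordset, Ha|exact S].
Qed.

(** * Cardinals *)

Lemma inj_ordinal (A k : M) : ordinal k -> inj A k -> exists o, ord_le o k /\ ordinal o /\ equipotent A o.
Proof.
  intros Hk H; destruct (inj_elim _ _ H) as [f [Hf If]].
  assert (S : subset (image A (app f)) k).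
  { intros y Hy; apply image_spec in Hy; [|dd]. destruct Hy as [x [Hx ->]]; auto. }
  assert (O : ordset (image A (app f))) by exact (ordset_subset _ k (ordinal_ordset k Hk) S).
  exists (ot (image A (app f))); split; [exact (ot_subset_ordinal _ _ Hk S)|split].
  - apply ordinal_ot, O.
  - apply equipotent_trans with (image A (app f)); [|apply equipotent_ot, O].
    apply equipotent_image; [dd|exact If].
Qed.

Lemma card_exists (A k : M) : ordinal k -> inj A k -> exists c, card A c /\ ord_le c k.
Proof.
  intros Hk H; destruct (inj_ordinal A k Hk H) as [o [L [Ho E]]].
  destruct (least_exists (fun b => equipotent A b)) as [c Hc]; [dd|eauto|].
  exists c; split; [exact Hc|]. apply (ord_le_trans c o k Hk); [|exact L].
  apply Hc; assumption.
Qed.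

Lemma card_initial (A k : M) : card A k -> card k k.
Proof.
  intros [Hk [E L]]; split; [exact Hk|split; [apply equipotent_refl|]].
  intros b Hb Eb; apply L; [exact Hb|]. exact (equipotent_trans _ _ _ E Eb).
Qed.

Lemma initial_not_inj (k b : M) : card k k -> b ∈ k -> ~ inj k b.
Proof.
  intros [Hk [_ L]] Hb H.
  assert (Ob : ordinal b) by exact (ord_mem k b Hk Hb).
  destruct (inj_ordinal k b Ob H) as [o [Lo [Ho E]]].
  apply (ord_lt_not_le o k); [exact (ord_le_lt o b k Hk Lo Hb)|apply L; assumption].
Qed.

Lemma initial_le (k b : M) : card k k -> ordinal b -> inj k b -> ord_le k b.
Proof.
  intros Hk Hb H; apply ord_not_lt; [exact Hb|apply Hk|]. intro L; exact (initial_not_inj k b Hk L H).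
Qed.

(** Cantor-Bernstein is easy here because [k] is initial: [A] is equipotent to some ordinal [o] <=
    [k], and since [k] injects into [o], the two are equal. *)
Lemma card_eq (k A : M) : card k k -> inj A k -> inj k A -> card A k.
Proof.
  intros Hk H1 H2. destruct (inj_ordinal A k (proj1 Hk) H1) as [o [Lo [Ho E]]].
  assert (K : ord_le k o) by (apply initial_le; [exact Hk|exact Ho|
    exact (inj_trans _ _ _ H2 (equipotent_inj _ _ E))]).
  rewrite (ord_le_antisym _ _ Lo K) in E. split; [apply Hk|split; [exact E|]].
  intros b Hb Eb; apply initial_le; [exact Hk|exact Hb|].
    exact (inj_trans _ _ _ H2 (equipotent_inj _ _ Eb)).
Qed.

Lemma card_unique (A k k' : M) : card A k -> card A k' -> k = k'.
Proof. apply least_unique. Qed.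

Lemma card_inj (A k : M) : card A k -> inj A k.
Proof. intros [_ [E _]]; exact (equipotent_inj _ _ E). Qed.

Lemma card_inj_sym (A k : M) : card A k -> inj k A.
Proof. intros [_ [E _]]; exact (equipotent_inj _ _ (equipotent_sym _ _ E)). Qed.

Lemma card_le (A k b : M) : card A k -> ordinal b -> inj A b -> ord_le k b.
Proof.
  intros H Hb K; apply initial_le; [exact (card_initial A k H)|exact Hb|].
  exact (inj_trans _ _ _ (card_inj_sym A k H) K).
Qed.

(** * Finite sets *)

Definition Fin (a : M) : Prop := exists n, n ∈ omega /\ inj a n.

Lemma D_Fin a : term_definable a -> definable (fun e => Fin (a e)).
Proof. intros; unfold Fin; dd. Qed.

Ltac def_finite :=
  lazymatch goal with
  | |- definable (fun e => Fin _) => apply D_Fin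
  | _ => def_order_type
  end.
Ltac def_hook ::= def_finite.

Lemma Fin_inj (a b : M) : inj a b -> Fin b -> Fin a.
Proof. intros H [n [Hn K]]; exists n; split; [exact Hn|exact (inj_trans _ _ _ H K)]. Qed.

Lemma Fin_subset (a b : M) : subset a b -> Fin b -> Fin a.
Proof. intro H; apply Fin_inj, inj_subset, H. Qed.

Lemma omega_ordinal (n : M) : n ∈ omega -> ordinal n.
Proof. apply ord_mem, ordinal_omega. Qed.

Lemma Fin_insert (a b x : M) : Fin a -> (forall y, y ∈ b -> y ∈ a \/ y = x) -> Fin b.
Proof.
  intros [n [Hn H]] K; destruct (inj_elim _ _ H) as [f [Hf If]].
  exists (suc n); split; [apply suc_omega, Hn|].
  apply inj_intro with (fun y => ite (y ∈ a) (app f y) n); [dd| |].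
  - intros y Hy; apply suc_spec. destruct (classic (y ∈ a)) as [Ha|Ha].
    + rewrite ite_true by exact Ha; auto.
    + rewrite ite_false by exact Ha; auto.
  - intros y z Hy Hz.
    destruct (classic (y ∈ a)) as [Ha|Ha]; [rewrite (ite_true _ _ _ Ha)|rewrite (ite_false _ _ _ Ha)];
    (destruct (classic (z ∈ a)) as [Hb|Hb]; [rewrite (ite_true _ _ _ Hb)|rewrite (ite_false _ _ _ Hb)]);
    intro E.
    + apply If; assumption.
    + destruct (not_mem_self n); rewrite <- E at 1; apply Hf, Ha.
    + destruct (not_mem_self n); rewrite E at 1; apply Hf, Hb.
    + destruct (K y Hy), (K z Hz); try contradiction; congruence.
Qed.

Lemma inj_emp (a : M) : inj a emp -> a = emp.
Proof.
  intro H; destruct (inj_elim _ _ H) as [f [Hf _]]; apply emp_eq; intros y Hy.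
  exact (emp_spec _ (Hf y Hy)).
Qed.

Lemma Fin_union (a b c : M) : Fin a -> Fin b -> (forall y, y ∈ c -> y ∈ a \/ y ∈ b) -> Fin c.
Proof.
  intros Ha [n [Hn H]].
  assert (K : forall b, inj b n -> Fin (cup a b)).
  { revert n Hn H.
    enough (K : forall n, n ∈ omega -> forall b, inj b n -> Fin (cup a b)) by (intros; eauto).
    apply (omega_ind (fun n => forall b, inj b n -> Fin (cup a b))); [dd| |].
    - intros b' Hb; apply inj_emp in Hb; subst b'; apply (Fin_subset _ a); [|exact Ha].
      intros y Hy; apply cup_spec in Hy; destruct Hy as [Hy|Hy]; [exact Hy|destruct (emp_spec _ Hy)].
    - intros n Hn IH b' Hb; destruct (inj_elim _ _ Hb) as [f [Hf If]].
      set (d := sep b' (fun y => app f y <> n)).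
      assert (Hd : forall y, y ∈ d <-> y ∈ b' /\ app f y <> n)
        by (intro y; unfold d; rewrite sep_spec by dd; tauto).
      assert (Fd : Fin (cup a d)).
      { apply IH, inj_intro with (app f); [dd| |].
        - intros y Hy; apply Hd in Hy; destruct Hy as [Hy N]. apply Hf, suc_spec in Hy; tauto.
        - intros y z Hy Hz; apply Hd in Hy, Hz; apply If; tauto. }
      (* As [f] is injective, at most one element of [b'] goes to [n], and the description names it.
         If there is none, the junk value is harmless. *)
      apply (Fin_insert (cup a d) _ (iota (fun x => x ∈ b' /\ app f x = n))); [exact Fd|].
      intros y Hy; rewrite cup_spec in *; rewrite Hd.
      destruct Hy as [Hy|Hy]; [auto|]. destruct (classic (app f y = n)) as [E|N]; [right|auto].
      symmetry; apply iota_eq; intro z; split; [|intros ->; auto].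
      intros [Hz Ez]; apply If; congruence. }
  intro Hc; apply (Fin_subset c (cup a b)); [|apply K, H].
  intros y Hy; apply cup_spec; auto.
Qed.

Definition fst (q : M) : M := iota (fun x => exists y, q = pair x y).
Definition snd (q : M) : M := iota (fun y => exists x, q = pair x y).

Lemma T_fst a : term_definable a -> term_definable (fun e => fst (a e)).
Proof. intros; unfold fst; dd. Qed.

Lemma T_snd a : term_definable a -> term_definable (fun e => snd (a e)).
Proof. intros; unfold snd; dd. Qed.

Ltac def_projection :=
  lazymatch goal with
  | |- term_definable (fun e => fst _) => apply T_fst
  | |- term_definable (fun e => snd _) => apply T_snd
  | _ => def_finite
  end.
Ltac def_hook ::= def_projection.

Lemma fst_pair (x y : M) : fst (pair x y) = x.
Proof.
  apply iota_eq; intro z; split; [|intros ->; eauto]. intros [w E]; apply pair_inj in E; destruct E; auto.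
Qed.

Lemma snd_pair (x y : M) : snd (pair x y) = y.
Proof.
  apply iota_eq; intro z; split; [|intros ->; eauto]. intros [w E]; apply pair_inj in E; destruct E; auto.
Qed.

Lemma Fin_prod (a n : M) : Fin a -> n ∈ omega -> Fin (prod a n).
Proof.
  intro Ha; revert n. apply (omega_ind (fun n => Fin (prod a n))); [dd| |].
  - apply (Fin_subset _ a); [|exact Ha]. intros q Hq; apply prod_spec in Hq.
    destruct Hq as [x [y [_ [Hy _]]]]; destruct (emp_spec _ Hy).
  - intros n Hn IH. apply (Fin_union (prod a n) (prod a (upair n n))); [exact IH| |].
    + apply (Fin_inj _ a); [|exact Ha]. apply inj_intro with fst; [dd| |].
      * intros q Hq; apply prod_spec in Hq; destruct Hq as [x [y [Hx [Hy ->]]]]; rewrite fst_pair; exact Hx.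
      * intros q q' Hq Hq'; apply prod_spec in Hq, Hq'; destruct Hq as [x [y [Hx [Hy ->]]]].
        destruct Hq' as [x' [y' [Hx' [Hy' ->]]]]; rewrite !fst_pair; intros ->.
        apply upair_spec in Hy, Hy'; f_equal; destruct Hy, Hy'; congruence.
    + intros q Hq; apply prod_spec in Hq; destruct Hq as [x [y [Hx [Hy ->]]]].
      rewrite !pair_prod, upair_spec; apply suc_spec in Hy; tauto.
Qed.

Lemma pigeonhole (n : M) : n ∈ omega -> ~ inj (suc n) n.
Proof.
  revert n; apply (omega_ind (fun n => ~ inj (suc n) n)); [dd| |].
  - intro H; apply inj_emp in H; exact (suc_not_emp _ H).
  - intros n Hn IH H; apply IH; destruct (inj_elim _ _ H) as [f [Hf If]].
    assert (S : forall x, x ∈ suc n -> x ∈ suc (suc n) /\ x <> suc n).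
    { intros x Hx; split; [apply suc_spec; auto|]. intros ->; exact (not_mem_self _ Hx). }
    pose proof (suc_mem (suc n)) as HS.
    apply inj_intro with (fun x => ite (app f x = n) (app f (suc n)) (app f x)); [dd| |].
    + intros x Hx; destruct (S x Hx) as [Hx' N]; destruct (classic (app f x = n)) as [E|E].
      * rewrite ite_true by exact E. assert (K : app f (suc n) ∈ suc n) by auto.
        apply suc_spec in K; destruct K as [K|K]; [exact K|].
        destruct N; apply If; congruence.
      * rewrite ite_false by exact E. assert (K : app f x ∈ suc n) by auto.
        apply suc_spec in K; tauto.
    + intros x y Hx Hy; destruct (S x Hx) as [Hx' Nx], (S y Hy) as [Hy' Ny].
      destruct (classic (app f x = n)) as [Ex|Ex]; [rewrite (ite_true _ _ _ Ex)|rewrite (ite_false _ _ _ Ex)];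
      (destruct (classic (app f y = n)) as [Ey|Ey]; [rewrite (ite_true _ _ _ Ey)|rewrite (ite_false _ _ _ Ey)]);
      intro E.
      * apply If; congruence.
      * destruct Ny; symmetry; apply If; auto.
      * destruct Nx; apply If; auto.
      * apply If; auto.
Qed.

Lemma omega_not_Fin : ~ Fin omega.
Proof.
  intros [n [Hn H]]; apply (pigeonhole n Hn), (inj_trans _ omega); [|exact H].
  apply inj_subset, ord_le_subset; [apply ordinal_omega|left; apply suc_omega, Hn].
Qed.

Lemma card_omega : card omega omega.
Proof.
  split; [apply ordinal_omega|split; [apply equipotent_refl|]].
  intros b Hb E; apply ord_not_lt; [exact Hb|apply ordinal_omega|].
  intro K; apply omega_not_Fin; exists b; split; [exact K|apply equipotent_inj, E].
Qed.

Lemma cardinal_iff (k : M) : cardinal k <-> card k k /\ ord_le omega k.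
Proof.
  unfold cardinal; split; intros [H K]; (split; [exact H|]).
  - destruct K as [w [Hw K]]; rewrite (is_omega_eq w Hw) in K; exact K.
  - exists omega; split; [apply omega_is_omega|exact K].
Qed.

Lemma cardinal_ordinal (k : M) : cardinal k -> ordinal k.
Proof. intro H; apply H. Qed.

(** Hilbert's hotel: shifting omega by one frees zero for the new point [b]. *)
Lemma inj_suc (b : M) : ordinal b -> ord_le omega b -> inj (suc b) b.
Proof.
  intros Hb L; pose proof (ord_le_subset _ _ Hb L) as S.
  apply inj_intro with (fun x => ite (x = b) emp (ite (x ∈ omega) (suc x) x)); [dd| |].
  - intros x Hx; destruct (classic (x = b)) as [E|E].
    + rewrite ite_true by exact E; apply S, emp_omega.
    + rewrite ite_false by exact E; destruct (classic (x ∈ omega)) as [W|W].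
      * rewrite ite_true by exact W; apply S, suc_omega, W.
      * rewrite ite_false by exact W; apply suc_spec in Hx; tauto.
  - intros x y Hx Hy.
    destruct (classic (x = b)) as [Ex|Ex]; [rewrite (ite_true _ _ _ Ex)|rewrite (ite_false _ _ _ Ex)];
    (destruct (classic (y = b)) as [Ey|Ey]; [rewrite (ite_true _ _ _ Ey)|rewrite (ite_false _ _ _ Ey)]).
    + congruence.
    + destruct (classic (y ∈ omega)) as [W|W]; [rewrite (ite_true _ _ _ W)|rewrite (ite_false _ _ _ W)]; intro E.
      * destruct (suc_not_emp y); auto.
      * subst y; destruct W; apply emp_omega.
    + destruct (classic (x ∈ omega)) as [W|W]; [rewrite (ite_true _ _ _ W)|rewrite (ite_false _ _ _ W)]; intro E.
      * destruct (suc_not_emp x); auto.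
      * subst x; destruct W; apply emp_omega.
    + destruct (classic (x ∈ omega)) as [W|W]; [rewrite (ite_true _ _ _ W)|rewrite (ite_false _ _ _ W)];
      (destruct (classic (y ∈ omega)) as [W'|W']; [rewrite (ite_true _ _ _ W')|rewrite (ite_false _ _ _ W')]); intro E.
      * apply suc_inj, E.
      * destruct W'; rewrite <- E; apply suc_omega, W.
      * destruct W; rewrite E; apply suc_omega, W'.
      * exact E.
Qed.

Lemma cardinal_suc_mem (k b : M) : cardinal k -> b ∈ k -> suc b ∈ k.
Proof.
  rewrite cardinal_iff; intros [Hk L] Hb.
  assert (Ok : ordinal k) by apply Hk. assert (Ob : ordinal b) by exact (ord_mem k b Ok Hb).
  destruct (ord_le_total omega b ordinal_omega Ob) as [W|W].
  - destruct (suc_le b k Ok Hb) as [K|E]; [exact K|].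
    destruct (initial_not_inj k b Hk Hb); rewrite <- E; apply inj_suc; assumption.
  - apply (ord_lt_le _ omega _ Ok); [apply suc_omega, W|exact L].
Qed.

Lemma cardinal_limit (k : M) : cardinal k -> limit_ordinal k.
Proof.
  intro Hk; pose proof Hk as Hk'; apply cardinal_iff in Hk'; destruct Hk' as [[Ok _] L].
  apply limit_spec; split; [exact Ok|split].
  - intros ->; exact (emp_spec _ (ord_lt_le _ _ _ Ok emp_omega L)).
  - intros x; apply cardinal_suc_mem, Hk.
Qed.

(** * Pairing on a cardinal *)

(* Goedel's order on pairs; [cup] computes the maximum of two ordinals. *)
Definition max_coord (q : M) : M := cup (fst q) (snd q).
Definition godel (q r : M) : Prop :=
  max_coord q ∈ max_coord r \/ (max_coord q = max_coord r /\ (fst q ∈ fst r \/ (fst q = fst r /\ snd q ∈ snd r))).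

Definition godel_iso (k : M) : M :=
  iota (fun f => exists o, ordinal o /\ order_iso godel (prod k k) f o).

Definition godel_pair (k x y : M) : M := app (godel_iso k) (pair x y).

Lemma T_max_coord a : term_definable a -> term_definable (fun e => max_coord (a e)).
Proof. intros; unfold max_coord; dd. Qed.

Lemma D_godel a b : term_definable a -> term_definable b -> definable (fun e => godel (a e) (b e)).
Proof. intros; unfold godel, max_coord; dd. Qed.

Lemma T_godel_pair a b c : term_definable a -> term_definable b -> term_definable c -> term_definable (fun e => godel_pair (a e) (b e) (c e)).
Proof. intros; unfold godel_pair, godel_iso, order_iso, godel, max_coord; dd. Qed.

Ltac def_godel :=
  lazymatch goal with
  | |- term_definable (fun e => max_coord _) => apply T_max_coord
  | |- definable (fun e => godel _ _) => apply D_godel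
  | |- term_definable (fun e => godel_pair _ _ _) => apply T_godel_pair
  | _ => def_projection
  end.
Ltac def_hook ::= def_godel.

Lemma prod_elim (a b q : M) : q ∈ prod a b -> q = pair (fst q) (snd q) /\ fst q ∈ a /\ snd q ∈ b.
Proof.
  intro H; apply prod_spec in H; destruct H as [x [y [Hx [Hy ->]]]].
  rewrite fst_pair, snd_pair; auto.
Qed.

Lemma cup_max (k x y : M) : ordinal k -> x ∈ k -> y ∈ k -> cup x y ∈ k.
Proof.
  intros Hk Hx Hy; destruct (ord_le_total x y) as [L|L]; [exact (ord_mem k x Hk Hx)|exact (ord_mem k y Hk Hy)| |].
  - replace (cup x y) with y; [exact Hy|]. apply extensionality; intro z; rewrite cup_spec.
    split; [auto|intros [H|H]; [|exact H]]. apply (ord_le_subset x y (ord_mem k y Hk Hy) L z H).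
  - replace (cup x y) with x; [exact Hx|]. apply extensionality; intro z; rewrite cup_spec.
    split; [auto|intros [H|H]; [exact H|]]. exact (ord_trans x z y (ord_mem k x Hk Hx) H L).
Qed.

Lemma godel_wo (k : M) : ordinal k -> well_orders godel (prod k k).
Proof.
  intro Hk.
  assert (O : forall q, q ∈ prod k k -> q = pair (fst q) (snd q) /\ fst q ∈ k /\ snd q ∈ k /\ max_coord q ∈ k).
  { intros q Hq; destruct (prod_elim k k q Hq) as [E [H1 H2]]; repeat split; auto.
    apply cup_max; assumption. }
  assert (Tr : forall x y z, z ∈ k -> x ∈ y -> y ∈ z -> x ∈ z).
  { intros x y z Hz; apply ord_trans; exact (ord_mem k z Hk Hz). }
  split; [|split; [|split]].
  - intros q _ [H|[_ [H|[_ H]]]]; exact (not_mem_self _ H).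
  - intros q r s Hq Hr Hs.
    destruct (O q Hq) as [_ [Q1 [Q2 Q3]]], (O r Hr) as [_ [R1 [R2 R3]]], (O s Hs) as [_ [S1 [S2 S3]]].
    unfold godel; intros H K; destruct H as [H|[E1 H]], K as [K|[F1 K]].
    + left; apply (Tr _ (max_coord r)); assumption.
    + left; rewrite <- F1; exact H.
    + left; rewrite E1; exact K.
    + right; split; [congruence|]. destruct H as [H|[E2 H]], K as [K|[F2 K]].
      * left; apply (Tr _ (fst r)); assumption.
      * left; rewrite <- F2; exact H.
      * left; rewrite E2; exact K.
      * right; split; [congruence|]. apply (Tr _ (snd r)); assumption.
  - intros q r Hq Hr; destruct (O q Hq) as [Eq [Q1 [Q2 Q3]]], (O r Hr) as [Er [R1 [R2 R3]]].
    unfold godel.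
    destruct (ordinal_tri k (max_coord q) (max_coord r) Hk Q3 R3) as [?|[E1|?]]; auto.
    destruct (ordinal_tri k (fst q) (fst r) Hk Q1 R1) as [?|[E2|?]]; auto 10.
    destruct (ordinal_tri k (snd q) (snd r) Hk Q2 R2) as [?|[E3|?]]; auto 10.
    right; left; rewrite Eq, Er, E2, E3; reflexivity.
  - intros B HB [q0 Hq0].
    assert (OB : forall q, q ∈ B -> q = pair (fst q) (snd q) /\ fst q ∈ k /\ snd q ∈ k /\ max_coord q ∈ k) by auto.
    assert (L : forall P : M -> Prop, definable (fun e => P (e 0)) -> (exists x, x ∈ k /\ P x) ->
      exists m, m ∈ k /\ P m /\ forall x, x ∈ k -> P x -> ord_le m x).
    { intros P HP K; destruct (wo_least (@mem M) k P) as [m [Hm [Pm L]]]; [apply Hk|exact HP|exact K|].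
      exists m; split; [exact Hm|split; [exact Pm|]]. intros x Hx Px; destruct (L x Hx Px); [right|left]; auto. }
    destruct (L (fun m => exists q, q ∈ B /\ max_coord q = m)) as [m [Hm [[q1 [Hq1 E1]] Lm]]];
      [dd|exists (max_coord q0); split; [apply OB, Hq0|eauto]|].
    destruct (L (fun x => exists q, q ∈ B /\ max_coord q = m /\ fst q = x)) as [x [Hx [[q2 [Hq2 [E2 E2']]] Lx]]];
      [dd|exists (fst q1); split; [apply OB, Hq1|eauto]|].
    destruct (L (fun y => exists q, q ∈ B /\ max_coord q = m /\ fst q = x /\ snd q = y))
      as [y [Hy [[q3 [Hq3 [E3 [E3' E3'']]]] Ly]]];
      [dd|exists (snd q2); split; [apply OB, Hq2|eauto]|].
    exists q3; split; [exact Hq3|]. intros r Hr; destruct (OB r Hr) as [Er [R1 [R2 R3]]].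
    unfold godel; rewrite E3, E3', E3''.
    destruct (Lm (max_coord r) R3) as [K|K]; [eauto|auto|].
    destruct (Lx (fst r) R1) as [K'|K']; [eauto|auto|].
    destruct (Ly (snd r) R2) as [K''|K'']; [eauto 6|auto 10|].
    left; destruct (OB q3 Hq3) as [E _]; rewrite E, Er; congruence.
Qed.

Lemma godel_iso_spec (k : M) : ordinal k ->
  exists o, ordinal o /\ order_iso godel (prod k k) (godel_iso k) o.
Proof.
  intro Hk; apply (iota_spec (fun f => exists o, ordinal o /\ order_iso godel (prod k k) f o)).
  pose proof (godel_wo k Hk) as W.
  destruct (order_iso_exists _ _ W) as [f [o [Ho Hf]]]; [intros; dd|].
  exists f; split; [eauto|]. intros g [o' [Ho' Hg]].
  exact (proj1 (order_iso_unique _ _ _ _ _ _ W Ho Ho' Hf Hg)).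
Qed.

(** Hessenberg's theorem by induction on [k]. If the order type exceeded [k], some pair [r] would
    have [k] predecessors. They lie in g x g with [g] the successor of the larger coordinate, and
    [g] is below [k]. For infinite [g] the induction hypothesis at |g| injects g x g into |g|, which
    is below [k]; for finite [g] the square is finite. Either way [k] would be too small. *)
Lemma godel_iso_bound (k : M) : ordinal k -> cardinal k ->
  forall q, q ∈ prod k k -> app (godel_iso k) q ∈ k.
Proof.
  revert k; apply (ord_ind (fun k => cardinal k -> forall q, q ∈ prod k k -> app (godel_iso k) q ∈ k));
    [unfold godel_iso; dd|].
  intros k Hk IH Ck q Hq.
  destruct (godel_iso_spec k Hk) as [o [Ho Hf]]; set (f := godel_iso k) in *.
  pose proof Hf as [[[Ff If] [_ Sf]] Mf].
  pose proof (injection_app f _ _ (conj Ff If)) as I.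
  enough (L : ord_le o k) by (apply (ord_lt_le _ o k Hk); [exact (func_app _ _ _ _ Ff Hq)|exact L]).
  apply ord_not_lt; [exact Hk|exact Ho|]. intro Lk.
  destruct (surjection_app f (prod k k) o k (conj Ff Sf) Lk) as [r [Hr Er]].
  assert (Mr : max_coord r ∈ k).
  { destruct (prod_elim k k r Hr) as [_ [H1 H2]]; apply cup_max; assumption. }
  assert (Hg : suc (max_coord r) ∈ k) by (apply cardinal_suc_mem; assumption).
  set (g := suc (max_coord r)) in *.
  assert (Og : ordinal g) by exact (ord_mem k g Hk Hg).
  assert (K : inj k (prod g g)).
  { apply inj_trans with (sep (prod k k) (fun q => godel q r)).
    - apply inj_intro with (fun x => iota (fun q => q ∈ prod k k /\ app f q = x)); [dd| |].
      + intros x Hx. assert (Hx' : x ∈ app f r) by (rewrite Er; exact Hx).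
        apply (order_iso_value godel (prod k k) f o r Ho Hf Hr) in Hx'.
        destruct Hx' as [s [Hs [Rs ->]]].
        rewrite (iota_eq _ s); [apply sep_spec; [dd|auto]|].
        intro y; split; [|intros ->; auto]. intros [Hy E]; apply I; assumption.
      + assert (V : forall x, x ∈ k -> app f (iota (fun q => q ∈ prod k k /\ app f q = x)) = x).
        { intros x Hx; refine (proj2 (iota_spec (fun q => q ∈ prod k k /\ app f q = x) _)).
          destruct (surjection_app f (prod k k) o x (conj Ff Sf)) as [s [Hs <-]];
            [exact (ord_trans o x k Ho Hx Lk)|].
          exists s; split; [auto|]. intros y [Hy E]; apply I; auto. }
        intros x y Hx Hy E; rewrite <- (V x Hx), <- (V y Hy), E; reflexivity.
    - apply inj_subset; intros s Hs; apply sep_spec in Hs; [|dd]. destruct Hs as [Hs Rs].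
      destruct (prod_elim k k s Hs) as [Es [H1 H2]]; rewrite Es; apply pair_prod.
      assert (Ms : ord_le (max_coord s) (max_coord r)) by (destruct Rs as [Rs|[Rs _]]; [left|right]; assumption).
      assert (Os : max_coord s ∈ k) by (apply cup_max; assumption).
      assert (B : forall x, x ∈ k -> subset x (max_coord s) -> x ∈ g).
      { intros x Hx S; apply suc_spec, (ord_le_trans x (max_coord s)); [exact (ord_mem k _ Hk Mr)| |exact Ms].
        apply ord_subset_le; [exact (ord_mem k x Hk Hx)|exact (ord_mem k _ Hk Os)|exact S]. }
      split; apply B; try assumption; intros z Hz; unfold max_coord; apply cup_spec; auto. }
  apply cardinal_iff in Ck; destruct Ck as [Ik Lw].
  destruct (ord_le_total omega g ordinal_omega Og) as [W|W].
  - destruct (card_exists g g Og) as [c [Hc Lc]]; [apply inj_subset; intro; auto|].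
    assert (Hck : c ∈ k) by exact (ord_le_lt c g k Hk Lc Hg).
    assert (Cc : cardinal c).
    { apply cardinal_iff; split; [exact (card_initial g c Hc)|].
      apply initial_le; [apply card_omega|apply Hc|].
      apply (inj_trans _ g); [apply inj_subset, ord_le_subset; assumption|exact (card_inj g c Hc)]. }
    apply (initial_not_inj k c Ik Hck), (inj_trans _ _ _ K).
    destruct (inj_elim _ _ (card_inj g c Hc)) as [h [Hh Ih]].
    destruct (godel_iso_spec c (proj1 Hc)) as [oc [_ [[Fc _] _]]].
    pose proof (injection_app _ _ _ Fc) as Ic.
    assert (P : forall s, s ∈ prod g g -> pair (app h (fst s)) (app h (snd s)) ∈ prod c c).
    { intros s Hs; destruct (prod_elim g g s Hs) as [_ [H1 H2]]; apply pair_prod; auto. }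
    apply inj_intro with (fun s => godel_pair c (app h (fst s)) (app h (snd s))); [dd| |].
    + intros s Hs; apply IH; auto.
    + intros s t Hs Ht E; apply Ic in E; auto. apply pair_inj in E; destruct E as [E1 E2].
      destruct (prod_elim g g s Hs) as [Es [H1 H2]], (prod_elim g g t Ht) as [Et [H3 H4]].
      rewrite Es, Et, (Ih _ _ H1 H3 E1), (Ih _ _ H2 H4 E2); reflexivity.
  - apply omega_not_Fin, (Fin_inj omega (prod g g)).
    + apply (inj_trans _ k); [|exact K]. apply inj_subset, ord_le_subset; assumption.
    + apply Fin_prod; [exists g; split; [exact W|apply inj_subset; intro; auto]|exact W].
Qed.

Lemma godel_pair_in (k x y : M) : cardinal k -> x ∈ k -> y ∈ k -> godel_pair k x y ∈ k.
Proof.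
  intros Hk Hx Hy; apply godel_iso_bound; [apply Hk|exact Hk|apply pair_prod; auto].
Qed.

Lemma godel_pair_inj (k x y x' y' : M) : cardinal k -> x ∈ k -> y ∈ k -> x' ∈ k -> y' ∈ k ->
  godel_pair k x y = godel_pair k x' y' -> x = x' /\ y = y'.
Proof.
  intros Hk Hx Hy Hx' Hy' E.
  destruct (godel_iso_spec k (cardinal_ordinal k Hk)) as [o [_ [[F _] _]]].
  apply pair_inj, (injection_app _ _ _ F); [apply pair_prod; auto..|exact E].
Qed.

(** * Hartogs numbers *)

Lemma Union_ordinal (u : M) : ordset u -> ordinal (Union u).
Proof.
  intro H; apply ordinal_intro.
  - intros x Hx y Hy; apply Union_spec in Hx; destruct Hx as [a [Ha Hx]].
    apply Union_spec; exists a; split; [exact Ha|exact (ord_trans a y x (H a Ha) Hy Hx)].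
  - intros x y Hx Hy; apply Union_spec in Hx, Hy; destruct Hx as [a [Ha Hx]], Hy as [b [Hb Hy]].
    apply ord_total; [exact (ord_mem a x (H a Ha) Hx)|exact (ord_mem b y (H b Hb) Hy)].
Qed.

Lemma ordinals_not_set (Z : M) : ~ forall a, ordinal a -> a <> emp -> a ∈ Z.
Proof.
  intro H; set (u := sep Z ordinal).
  assert (Hu : forall x, x ∈ u <-> x ∈ Z /\ ordinal x) by (intro x; unfold u; rewrite sep_spec by dd; tauto).
  assert (O : ordinal (Union u)) by (apply Union_ordinal; intros x Hx; apply Hu in Hx; tauto).
  apply (not_mem_self (Union u)), Union_spec; exists (suc (Union u)); split; [|apply suc_mem].
  apply Hu; split; [apply H|]; try (apply ordinal_suc, O). apply suc_not_emp.
Qed.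

(** A surjection onto an ordinal pulls membership back to a relation on [Q], from which the
    surjection is recovered by induction on its values. *)
Lemma surjection_order_unique (Q a b f g : M) : ordinal a -> ordinal b ->
  surjection f Q a -> surjection g Q b ->
  (forall x y, x ∈ Q -> y ∈ Q -> (app f x ∈ app f y <-> app g x ∈ app g y)) -> a = b.
Proof.
  intros Ha Hb Hf Hg H.
  assert (E : forall v, ordinal v -> forall x, x ∈ Q -> app f x = v -> app g x = v).
  { apply (ord_ind (fun v => forall x, x ∈ Q -> app f x = v -> app g x = v)); [dd|].
    intros v Ov IH x Hx Ev; apply extensionality; intro z; split; intro Hz.
    - destruct (surjection_app g Q b z Hg) as [y [Hy <-]].
      { apply (ord_trans b z (app g x)); [exact Hb|exact Hz|exact (func_app _ _ _ _ (proj1 Hg) Hx)]. }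
      assert (L : app f y ∈ v) by (rewrite <- Ev; apply H; assumption).
      rewrite (IH _ L y Hy eq_refl); exact L.
    - destruct (surjection_app f Q a z Hf) as [y [Hy Ez]].
      { apply (ord_trans a z v); [exact Ha|exact Hz|]. rewrite <- Ev; exact (func_app _ _ _ _ (proj1 Hf) Hx). }
      rewrite <- (IH z Hz y Hy Ez). apply H; [assumption..|]. rewrite Ez, Ev; exact Hz. }
  assert (E' : forall x, x ∈ Q -> app f x = app g x).
  { intros x Hx; symmetry; apply E; auto. apply (ord_mem a); [exact Ha|exact (func_app _ _ _ _ (proj1 Hf) Hx)]. }
  apply extensionality; intro z; split; intro Hz.
  - destruct (surjection_app _ _ _ z Hf Hz) as [x [Hx <-]]; rewrite E' by exact Hx.
    exact (func_app _ _ _ _ (proj1 Hg) Hx).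
  - destruct (surjection_app _ _ _ z Hg Hz) as [x [Hx <-]]; rewrite <- E' by exact Hx.
    exact (func_app _ _ _ _ (proj1 Hf) Hx).
Qed.

(** Otherwise every nonzero ordinal is an image of [Q], hence is coded by the relation that it
    induces on [Q]. Decoding would map the set of all relations on [Q] onto a set containing all
    nonzero ordinals. *)
Lemma hrtg_exists (Q : M) : exists h, hrtg Q h.
Proof.
  apply least_exists; [dd|]. apply NNPP; intro K.
  set (F := fun r => iota (fun a => ordinal a /\ exists f, surjection f Q a /\
    forall x y, x ∈ Q -> y ∈ Q -> (app f x ∈ app f y <-> pair x y ∈ r))).
  apply (ordinals_not_set (image (Pow (prod Q Q)) F)).
  intros a Ha Na; apply image_spec; [unfold F; dd|].
  assert (S : exists f, surjection f Q a).
  { apply NNPP; intro N; apply K; exists a; split; [exact Ha|split; [apply nonempty, Na|exact N]]. }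
  destruct S as [f Hf]; exists (sep (prod Q Q) (fun q => app f (fst q) ∈ app f (snd q))); split.
  - apply Pow_spec; intros q Hq; apply sep_spec in Hq; [tauto|dd].
  - assert (V : forall x y, x ∈ Q -> y ∈ Q -> (app f x ∈ app f y <->
      pair x y ∈ sep (prod Q Q) (fun q => app f (fst q) ∈ app f (snd q)))).
    { intros x y Hx Hy; rewrite sep_spec by dd; rewrite fst_pair, snd_pair, pair_prod; tauto. }
    symmetry; apply iota_eq; intro b; split; [|intros ->; eauto].
    intros [Hb [g [Hg G]]]; apply (surjection_order_unique Q b a g f); auto.
    intros x y Hx Hy; rewrite V by assumption; apply G; assumption.
Qed.

(** It suffices that the values of [F] cover [o]: if [h] <= [o], they also cover [h], and cutting
    them down to [h] would give a forbidden surjection. *)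
Lemma hrtg_above (Q h o : M) (F : M -> M) : hrtg Q h -> ordinal o -> term_definable (fun e => F (e 0)) ->
  (forall y, y ∈ o -> exists q, q ∈ Q /\ F q = y) -> o ∈ h.
Proof.
  intros [Hh [[[z Hz] N] _]] Ho HF S; pose proof (T_closed F HF) as TF.
  apply NNPP; intro K; apply N. apply ord_not_lt in K; [|assumption..].
  assert (H0 : emp ∈ h) by (apply ordinal_emp_mem; [exact Hh|]; intros ->; exact (emp_spec _ Hz)).
  (* Values outside [h] are sent to zero, which belongs to [h] because Hartogs numbers are nonzero
     by definition. *)
  exists (lam Q (fun q => ite (F q ∈ h) (F q) emp)); apply surjection_lam; [dd| |].
  - intros q _; destruct (classic (F q ∈ h)) as [C|C]; [rewrite ite_true|rewrite ite_false]; assumption.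
  - intros y Hy; destruct (S y) as [q [Hq E]]; [exact (ord_le_subset _ _ Ho K y Hy)|].
    exists q; split; [exact Hq|]. rewrite ite_true; [exact E|rewrite E; exact Hy].
Qed.

Lemma hrtg_below (Q h b : M) : hrtg Q h -> b ∈ h -> b <> emp -> exists f, surjection f Q b.
Proof.
  intros [Hh [_ L]] Hb N; apply NNPP; intro K.
  apply (ord_lt_not_le b h Hb), L; [exact (ord_mem h b Hh Hb)|].
  split; [apply nonempty, N|exact K].
Qed.

(** The domain is an ordinal, so the least preimage serves in place of a choice function. *)
Lemma surjection_inj (a b f : M) : ordinal a -> surjection f a b -> inj b a.
Proof.
  intros Ha Hf; set (g := fun y => iota (least_ord (fun x => x ∈ a /\ app f x = y))).
  assert (G : forall y, y ∈ b -> g y ∈ a /\ app f (g y) = y).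
  { intros y Hy; apply (iota_spec (least_ord (fun x => x ∈ a /\ app f x = y))).
    destruct (least_exists (fun x => x ∈ a /\ app f x = y)) as [m Hm]; [dd| |].
    - destruct (surjection_app _ _ _ y Hf Hy) as [x [Hx E]]; exists x.
      split; [exact (ord_mem a x Ha Hx)|auto].
    - exists m; split; [exact Hm|]. intros m'; apply least_unique, Hm. }
  apply inj_intro with g; [unfold g; dd|apply G|].
  intros y y' Hy Hy' E; rewrite <- (proj2 (G y Hy)), E; apply G, Hy'.
Qed.

Lemma hrtg_cardinal (a h : M) : ordinal a -> ord_le omega a -> hrtg a h -> cardinal h /\ a ∈ h.
Proof.
  intros Ha L Hh.
  assert (Oh : ordinal h) by apply Hh.
  assert (K : a ∈ h) by (apply (hrtg_above a h a (fun x => x)); [exact Hh|exact Ha|dd|eauto]).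
  split; [|exact K]. apply cardinal_iff; split; [|left; exact (ord_le_lt _ _ _ Oh L K)].
  split; [exact Oh|split; [apply equipotent_refl|]].
  intros b Hb E; apply ord_not_lt; [exact Hb|exact Oh|]. intro C.
  assert (N : b <> emp).
  { intros ->; pose proof (inj_emp h (equipotent_inj _ _ E)) as E'; rewrite E' in K; exact (emp_spec _ K). }
  destruct (hrtg_below a h b Hh C N) as [f Hf].
  destruct (equipotent_sym _ _ E) as [g [_ Hg]].
  destruct Hh as [_ [[_ S] _]]; apply S. exists (lam a (fun x => app g (app f x))).
  apply surjection_lam; [dd| |].
  - intros x Hx; apply (func_app g b); [apply Hg|]. apply (func_app f a); [apply Hf|exact Hx].
  - intros y Hy; destruct (surjection_app _ _ _ y Hg Hy) as [z [Hz <-]].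
    destruct (surjection_app _ _ _ z Hf Hz) as [x [Hx <-]]; eauto.
Qed.

(** For an ordinal [a], surjections from [a] turn into injections into [a]; a cardinal strictly
    between [a] and [h] would thus inject into [a]. *)
Lemma succ_cardinal_hrtg (a h : M) : cardinal a -> hrtg a h -> succ_cardinal a h.
Proof.
  intros Ca Hh; pose proof Ca as Ca'; apply cardinal_iff in Ca'; destruct Ca' as [Ia La].
  destruct (hrtg_cardinal a h (proj1 Ia) La Hh) as [Ch K].
  split; [exact Ca|split; [apply Hh|split; [auto|]]].
  intros b Hb [Cb Hab]; apply ord_not_lt; [exact Hb|apply Hh|]. intro C.
  destruct (hrtg_below a h b Hh C) as [f Hf]; [intros ->; exact (emp_spec _ Hab)|].
  apply (initial_not_inj b a); [apply Cb|exact Hab|].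
  exact (surjection_inj a b f (proj1 Ia) Hf).
Qed.

Lemma cardinal_omega : cardinal omega.
Proof. apply cardinal_iff; split; [apply card_omega|apply ord_le_refl]. Qed.

Lemma aleph1_exists : exists a1, is_aleph1 a1 /\ omega ∈ a1.
Proof.
  destruct (hrtg_exists omega) as [h Hh]; exists h; split.
  - exists omega; split; [apply omega_is_omega|]. apply succ_cardinal_hrtg; [apply cardinal_omega|exact Hh].
  - apply (hrtg_cardinal omega h ordinal_omega (ord_le_refl _) Hh).
Qed.

Lemma countable_in_pow_lt (l u a1 : M) : omega ∈ a1 -> ordinal a1 -> subset u l -> inj u omega ->
  in_pow_lt l a1 u.
Proof.
  intros W O S H; split; [exact S|].
  destruct (card_exists u omega ordinal_omega H) as [c [Hc L]].
  exists c; split; [exact (ord_le_lt c omega a1 O L W)|exact Hc].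
Qed.

Lemma exists_pow_aleph0 (a : M) : exists P : M, is_pow_aleph0 a P /\
  forall u, u ∈ P <-> subset u a /\ card u omega.
Proof.
  set (P := sep (Pow a) (fun u => card u omega)).
  assert (H : forall u, u ∈ P <-> subset u a /\ card u omega).
  { intro u; unfold P; rewrite sep_spec by dd; rewrite Pow_spec; tauto. }
  exists P; split; [|exact H]. intro u; rewrite H; split; intros [H1 H2]; (split; [exact H1|]).
  - exists omega; split; [apply omega_is_omega|exact H2].
  - destruct H2 as [w [Hw K]]; rewrite (is_omega_eq w Hw) in K; exact K.
Qed.

Lemma hrtg_pow_exists (d a : M) : exists h, hrtg_pow d a h.
Proof.
  destruct (exists_pow_aleph0 a) as [P [HP _]]; destruct (hrtg_exists (prod P d)) as [h Hh].
  exists h, P, (prod P d); split; [exact HP|split; [apply is_prod_prod|exact Hh]].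
Qed.

Lemma hrtg_pow_above (d a h o : M) (F : M -> M -> M) : hrtg_pow d a h -> ordinal o ->
  (forall t u, term_definable t -> term_definable u -> term_definable (fun e => F (t e) (u e))) ->
  (forall y, y ∈ o -> exists v j, subset v a /\ card v omega /\ j ∈ d /\ F v j = y) -> o ∈ h.
Proof.
  intros [P [Q [HP [HQ Hh]]]] Ho HF S; apply is_prod_eq in HQ; subst Q.
  apply (hrtg_above (prod P d) h o (fun q => F (fst q) (snd q)) Hh Ho); [dd|].
  intros y Hy; destruct (S y Hy) as [v [j [Hv [Cv [Hj <-]]]]].
  exists (pair v j); rewrite fst_pair, snd_pair, pair_prod; split; [split; [|exact Hj]|reflexivity].
  apply HP; split; [exact Hv|]. exists omega; split; [apply omega_is_omega|exact Cv].
Qed.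

(** * Canonical cofinal subsets *)

Lemma dependent_choice (X : M) (R : M -> M -> Prop) :
  (forall t u, term_definable t -> term_definable u -> definable (fun e => R (t e) (u e))) ->
  (exists x, x ∈ X) -> (forall x, x ∈ X -> exists y, y ∈ X /\ R x y) ->
  exists f, (forall n, n ∈ omega -> app f n ∈ X) /\
    (forall n, n ∈ omega -> R (app f n) (app f (suc n))).
Proof.
  intros HR NX H.
  assert (K : forall x y, maps (sep (prod X X) (fun q => R (fst q) (snd q))) x y <->
    x ∈ X /\ y ∈ X /\ R x y).
  { intros x y; rewrite maps_pair, sep_spec by dd; rewrite fst_pair, snd_pair, pair_prod; tauto. }
  destruct (HDC X (sep (prod X X) (fun q => R (fst q) (snd q))) NX) as [w [f [Hw [Hf S]]]].
  { intros x Hx; destruct (H x Hx) as [y [Hy Ry]]; exists y; rewrite K; auto. }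
  apply is_omega_eq in Hw; subst w; pose proof Hf as [Ff _].
  exists f; split; intros n Hn; [exact (func_app _ _ _ _ Hf Hn)|].
  apply K, (S n (suc n)); [exact Hn|apply is_succ_suc; reflexivity|..];
    apply (maps_app _ _ _ _ Ff); auto using suc_omega.
Qed.

Lemma image_inj (a : M) (f : M -> M) : ordinal a -> term_definable (fun e => f (e 0)) -> inj (image a f) a.
Proof.
  intros Ha Hf; apply (surjection_inj a _ (lam a f) Ha), surjection_lam; [exact Hf| |].
  - intros x Hx; apply image_spec; eauto.
  - intros y Hy; apply image_spec in Hy; [|exact Hf]. destruct Hy as [x [Hx ->]]; eauto.
Qed.

Lemma card_omega_intro (u : M) : inj u omega -> ~ Fin u -> card u omega.
Proof.
  intros H N; apply card_eq; [apply card_omega|exact H|].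
  destruct (inj_ordinal u omega ordinal_omega H) as [o [[L| ->] [_ E]]].
  - destruct N; exists o; split; [exact L|apply equipotent_inj, E].
  - apply equipotent_inj, equipotent_sym, E.
Qed.

Lemma card_equipotent (a b k : M) : card a k -> equipotent a b -> card b k.
Proof.
  intros H E; apply card_eq; [exact (card_initial a k H)|..].
  - exact (inj_trans _ _ _ (equipotent_inj _ _ (equipotent_sym _ _ E)) (card_inj _ _ H)).
  - exact (inj_trans _ _ _ (card_inj_sym _ _ H) (equipotent_inj _ _ E)).
Qed.

(** * Limit points, clubs and cofinality *)

Definition diff (a b : M) : M := sep a (fun x => ~ x ∈ b).
Definition cap (a b : M) : M := sep a (fun x => x ∈ b).
Definition nxt (u x : M) : M := iota (least_ord (fun y => y ∈ u /\ ord_le x y)).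
(** Limit points of [u]. The first clause excludes zero, for which the second is vacuous. *)
Definition acc (u x : M) : Prop :=
  (exists z, z ∈ x) /\ forall z, z ∈ x -> exists y, y ∈ x /\ y ∈ u /\ z ∈ y.
Definition club (C a : M) : Prop := unbounded C a /\ forall x, x ∈ a -> acc C x -> x ∈ C.

Lemma T_diff a b : term_definable a -> term_definable b -> term_definable (fun e => diff (a e) (b e)).
Proof. intros; unfold diff; dd. Qed.

Lemma T_cap a b : term_definable a -> term_definable b -> term_definable (fun e => cap (a e) (b e)).
Proof. intros; unfold cap; dd. Qed.

Lemma T_nxt a b : term_definable a -> term_definable b -> term_definable (fun e => nxt (a e) (b e)).
Proof. intros; unfold nxt; dd. Qed.

Lemma D_acc a b : term_definable a -> term_definable b -> definable (fun e => acc (a e) (b e)).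
Proof. intros; unfold acc; dd. Qed.

Lemma D_club a b : term_definable a -> term_definable b -> definable (fun e => club (a e) (b e)).
Proof. intros; unfold club, acc; dd. Qed.

Ltac def_club :=
  lazymatch goal with
  | |- term_definable (fun e => diff _ _) => apply T_diff
  | |- term_definable (fun e => cap _ _) => apply T_cap
  | |- term_definable (fun e => nxt _ _) => apply T_nxt
  | |- definable (fun e => acc _ _) => apply D_acc
  | |- definable (fun e => club _ _) => apply D_club
  | _ => def_godel
  end.
Ltac def_hook ::= def_club.

Lemma diff_spec (a b x : M) : x ∈ diff a b <-> x ∈ a /\ ~ x ∈ b.
Proof. unfold diff; rewrite sep_spec by dd; tauto. Qed.

Lemma cap_spec (a b x : M) : x ∈ cap a b <-> x ∈ a /\ x ∈ b.
Proof. unfold cap; rewrite sep_spec by dd; tauto. Qed.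

Lemma nxt_spec (u a x : M) : ordinal a -> unbounded u a -> x ∈ a ->
  nxt u x ∈ u /\ ord_le x (nxt u x) /\ forall y, y ∈ u -> ord_le x y -> ord_le (nxt u x) y.
Proof.
  intros Ha [S U] Hx.
  assert (E : exists m, least_ord (fun y => y ∈ u /\ ord_le x y) m).
  { apply least_exists; [dd|]. destruct (U x Hx) as [y [Hy L]]; exists y.
    split; [exact (ord_mem a y Ha (S y Hy))|auto]. }
  assert (K : least_ord (fun y => y ∈ u /\ ord_le x y) (nxt u x)).
  { apply (iota_spec (least_ord _)). destruct E as [m Hm]; exists m; split; [exact Hm|].
    intros m'; apply least_unique, Hm. }
  destruct K as [_ [[K1 K2] K3]]; split; [exact K1|split; [exact K2|]].
  intros y Hy L; apply K3; [exact (ord_mem a y Ha (S y Hy))|auto].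
Qed.

Lemma acc_subset (u v x : M) : subset u v -> acc u x -> acc v x.
Proof.
  intros S [N H]; split; [exact N|]. intros z Hz; destruct (H z Hz) as [y [Hy [Hu L]]]; eauto.
Qed.

Lemma unbounded_ordset (u a : M) : ordinal a -> unbounded u a -> ordset u.
Proof. intros Ha [S _] x Hx; exact (ord_mem a x Ha (S x Hx)). Qed.

Lemma unbounded_mono (u v a : M) : unbounded u a -> subset u v -> subset v a -> unbounded v a.
Proof.
  intros [_ U] S S'; split; [exact S'|]. intros x Hx; destruct (U x Hx) as [y [Hy L]]; eauto.
Qed.

Lemma unbounded_self (a : M) : unbounded a a.
Proof. split; [intros x; auto|]. intros x Hx; exists x; split; [exact Hx|apply ord_le_refl]. Qed.

Lemma cof_elim (a c : M) : ordinal a -> cof a c ->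
  exists u, unbounded u a /\ ordset u /\ c = ot u.
Proof.
  intros Ha [Hc [[u [Hu Ou]] _]]; exists u.
  pose proof (unbounded_ordset u a Ha Hu) as O; rewrite otp_eq in Ou by exact O; auto.
Qed.

Lemma cof_le (a c u : M) : ordinal a -> cof a c -> unbounded u a -> ord_le c (ot u).
Proof.
  intros Ha [Hc [_ L]] Hu; pose proof (unbounded_ordset u a Ha Hu) as O.
  apply L; [apply ordinal_ot, O|]. exists u; split; [exact Hu|apply otp_eq; auto].
Qed.

Lemma cof_exists (a : M) : ordinal a -> exists c, cof a c /\ ord_le c a.
Proof.
  intro Ha; destruct (least_exists (fun b => exists u, unbounded u a /\ otp u b)) as [c Hc]; [dd| |].
  - exists a; split; [exact Ha|]. exists a; split; [apply unbounded_self|apply otp_self, Ha].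
  - exists c; split; [exact Hc|]. rewrite <- (ot_self a Ha).
    apply (cof_le a c a Ha Hc), unbounded_self.
Qed.

Lemma cof_limit (a c : M) : limit_ordinal a -> cof a c -> limit_ordinal c.
Proof.
  intros La Hc; apply limit_spec in La; destruct La as [Ha [Na Sa]].
  destruct (cof_elim a c Ha Hc) as [u [[Su Uu] [Ou ->]]].
  destruct (ordinal_cases (ot u) (ordinal_ot u Ou)) as [E|[[b [Hb E]]|L]]; [| |exact L].
  - destruct (nonempty a Na) as [x Hx], (Uu x Hx) as [y [Hy _]].
    pose proof (col_in u y Ou Hy) as K; rewrite E in K; destruct (emp_spec _ K).
  - destruct (col_surj u b Ou) as [y [Hy Ey]]; [rewrite E; apply suc_mem|].
    destruct (Uu (suc y) (Sa y (Su y Hy))) as [z [Hz L]].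
    assert (Lyz : y ∈ z) by (exact (ord_lt_le y (suc y) z (Ou z Hz) (suc_mem y) L)).
    apply (col_mono u) in Lyz; [|assumption..]. rewrite Ey in Lyz.
    pose proof (col_in u z Ou Hz) as K; rewrite E in K; apply mem_suc_le in K.
    destruct (ord_lt_not_le _ _ Lyz K).
Qed.

(** * Clubs in a limit ordinal whose countable subsets are bounded *)

Section CountablyClosed.
Context (a : M) (La : limit_ordinal a).
Context (Hctbl : forall v, subset v a -> inj v omega -> exists x, x ∈ a /\ forall y, y ∈ v -> y ∈ x).

(** DC builds a sequence above [x0] in which every gap contains a point of [C1] and a point of [C2].
    Its range is countable, hence bounded in [a], and both sets accumulate at its supremum. *)
Lemma common_accumulation (C1 C2 x0 : M) : unbounded C1 a -> unbounded C2 a -> x0 ∈ a ->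
  exists x, x ∈ a /\ x0 ∈ x /\ acc C1 x /\ acc C2 x.
Proof.
  intros [S1 U1] [S2 U2] Hx0; apply limit_spec in La; destruct La as [Ha [Na Sa]].
  set (X := sep a (fun y => x0 ∈ y)).
  assert (HX : forall y, y ∈ X <-> y ∈ a /\ x0 ∈ y) by (intro y; unfold X; rewrite sep_spec by dd; tauto).
  set (R := fun y z : M => (exists c, c ∈ C1 /\ y ∈ c /\ c ∈ z) /\ (exists c, c ∈ C2 /\ y ∈ c /\ c ∈ z)).
  destruct (dependent_choice X R) as [f [Hf Rf]]; [intros; unfold R; dd| | |].
  - exists (suc x0); apply HX; split; [auto|apply suc_mem].
  - intros y Hy; apply HX in Hy; destruct Hy as [Hy Ly].
    assert (Y : forall c, c ∈ a -> ord_le (suc y) c -> y ∈ c).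
    { intros c Hc L; exact (ord_lt_le y (suc y) c (ord_mem a c Ha Hc) (suc_mem y) L). }
    destruct (U1 _ (Sa y Hy)) as [c1 [Hc1 L1]], (U2 _ (Sa y Hy)) as [c2 [Hc2 L2]].
    pose proof (S1 c1 Hc1) as A1; pose proof (S2 c2 Hc2) as A2.
    pose proof (cup_max a c1 c2 Ha A1 A2) as A3.
    assert (K : forall c, c ∈ a -> subset c (cup c1 c2) -> c ∈ suc (cup c1 c2)).
    { intros c Hc S; apply mem_suc_le, ord_subset_le; [exact (ord_mem a c Ha Hc)|exact (ord_mem a _ Ha A3)|exact S]. }
    assert (K1 : c1 ∈ suc (cup c1 c2)) by (apply K; [exact A1|intros z Hz; apply cup_spec; auto]).
    assert (K2 : c2 ∈ suc (cup c1 c2)) by (apply K; [exact A2|intros z Hz; apply cup_spec; auto]).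
    exists (suc (cup c1 c2)); split.
    + apply HX; split; [auto|].
      assert (Os : ordinal (suc (cup c1 c2))) by (apply ordinal_suc, (ord_mem a _ Ha A3)).
      apply (ord_trans _ x0 c1 Os); [|exact K1].
      apply (ord_trans c1 x0 y (ord_mem a c1 Ha A1) Ly), Y; assumption.
    + split; [exists c1|exists c2]; auto.
  - assert (Of : forall n, n ∈ omega -> ordinal (app f n)).
    { intros n Hn; apply Hf, HX in Hn; apply (ord_mem a); tauto. }
    destruct (Hctbl (image omega (app f))) as [b [Hb Lb]].
    { intros y Hy; apply image_spec in Hy; [|dd]. destruct Hy as [n [Hn ->]]; apply HX; auto. }
    { apply image_inj; [apply ordinal_omega|dd]. }
    (* The sequence has no largest term, so its least strict upper bound is its supremum. *)
    destruct (least_exists (fun x => forall n, n ∈ omega -> app f n ∈ x)) as [m [Om [Hm Lm]]]; [dd| |].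
    { exists b; split; [exact (ord_mem a b Ha Hb)|]. intros n Hn; apply Lb, image_spec; [dd|eauto]. }
    assert (Hma : m ∈ a).
    { apply (ord_le_lt m b a Ha); [|exact Hb]. apply Lm; [exact (ord_mem a b Ha Hb)|].
      intros n Hn; apply Lb, image_spec; [dd|eauto]. }
    assert (Kc : forall C, subset C a -> (forall n, n ∈ omega -> exists c, c ∈ C /\ app f n ∈ c /\ c ∈ app f (suc n)) -> acc C m).
    { intros C SC H; split; [exists (app f emp); apply Hm, emp_omega|].
      intros z Hz; pose proof (ord_mem m z Om Hz) as Oz.
      assert (K : exists n, n ∈ omega /\ ~ app f n ∈ z).
      { apply NNPP; intro N; apply (ord_lt_not_le z m Hz), Lm; [exact Oz|].
        intros n Hn; apply NNPP; intro N'; apply N; eauto. }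
      destruct K as [n [Hn Nz]]; destruct (H n Hn) as [c [Hc [L1 L2]]].
      exists c; split; [|split; [exact Hc|]].
      - apply (ord_trans m c (app f (suc n)) Om L2), Hm, suc_omega, Hn.
      - apply (ord_le_lt z (app f n) c); [exact (ord_mem a c Ha (SC c Hc))| |exact L1].
        apply ord_not_lt; auto. }
    exists m; split; [exact Hma|split; [|split]].
    + apply (ord_trans m x0 (app f emp) Om); [apply HX, Hf, emp_omega|apply Hm, emp_omega].
    + apply Kc; [exact S1|]. intros n Hn; apply (Rf n Hn).
    + apply Kc; [exact S2|]. intros n Hn; apply (Rf n Hn).
Qed.

Lemma club_cap (C1 C2 : M) : club C1 a -> club C2 a -> club (cap C1 C2) a.
Proof.
  intros [U1 K1] [U2 K2]; split; [split|].
  - intros x Hx; apply cap_spec in Hx; apply U1; tauto.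
  - intros x Hx; destruct (common_accumulation C1 C2 x U1 U2 Hx) as [y [Hy [L [A1 A2]]]].
    exists y; split; [apply cap_spec; auto|left; exact L].
  - intros x Hx A; apply cap_spec; split; [apply K1|apply K2]; try assumption;
      refine (acc_subset _ _ _ _ A); intros y Hy; apply cap_spec in Hy; tauto.
Qed.

(** Unboundedness is the previous construction with [u] in both places; closure holds because a
    limit of limit points is a limit point. *)
Lemma club_acc (u : M) : unbounded u a -> club (sep a (acc u)) a.
Proof.
  intro U; assert (H : forall x, x ∈ sep a (acc u) <-> x ∈ a /\ acc u x) by (intro x; apply sep_spec; dd).
  split; [split|].
  - intros x Hx; apply H in Hx; tauto.
  - intros x Hx; destruct (common_accumulation u u x U U Hx) as [y [Hy [L [A _]]]].
    exists y; split; [apply H; auto|left; exact L].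
  - intros x Hx [N A]; apply H; split; [exact Hx|split; [exact N|]].
    intros z Hz; destruct (A z Hz) as [y [Hy [Ay Lz]]]; apply H in Ay; destruct Ay as [_ [_ Ay]].
    destruct (Ay z Lz) as [w [Hw [Wu L]]]; exists w; split; [|auto].
    apply limit_spec in La; apply (ord_trans x w y); [apply (ord_mem a); tauto|assumption..].
Qed.

End CountablyClosed.

(** * Ladders from a well-ordered cover of the countable subsets *)

Section Cover.
Context (d l S r : M).
Context (Hd : cardinal d) (Hl : ordinal l) (W : well_orders (maps r) S).
Context (HS : forall s, s ∈ S -> in_pow_lt l d s).
Context (Cov : forall u, subset u l -> inj u omega -> exists s, s ∈ S /\ subset u s).

Definition leastS (P : M -> Prop) : M :=
  iota (fun s => s ∈ S /\ P s /\ forall t, t ∈ S -> P t -> s = t \/ maps r s t).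

Definition first_cover (v : M) : M := leastS (fun s => Fin (diff v s)).

Definition cl (A : M) : M :=
  sep l (fun x => x ∈ A \/ exists v, subset v A /\ card v omega /\ x ∈ first_cover v).

(* Ordinals coded by countable sets: [i] outside omega is coded by omega + {i},
   and [i] in omega by omega - {i}. *)
Definition decode (v : M) : M :=
  iota (fun i => (i ∈ v /\ ~ i ∈ omega) \/ (subset v omega /\ i ∈ omega /\ ~ i ∈ v)).

Lemma T_leastS (P : (nat -> M) -> M -> Prop) :
  definable (fun e => P (fun n => e (Datatypes.S n)) (e 0)) -> term_definable (fun e => leastS (P e)).
Proof. intro H; pose proof (D_open _ H); unfold leastS; dd. Qed.

Lemma T_first_cover a : term_definable a -> term_definable (fun e => first_cover (a e)).
Proof. intros; unfold first_cover, leastS; dd. Qed.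

Lemma T_cl a : term_definable a -> term_definable (fun e => cl (a e)).
Proof. intros; unfold cl, first_cover, leastS; dd. Qed.

Lemma T_decode a : term_definable a -> term_definable (fun e => decode (a e)).
Proof. pose proof T_omega; intros; unfold decode; dd. Qed.

Ltac def_cover :=
  lazymatch goal with
  | |- term_definable (fun e => leastS _) => apply T_leastS
  | |- term_definable (fun e => first_cover _) => apply T_first_cover
  | |- term_definable (fun e => cl _) => apply T_cl
  | |- term_definable (fun e => decode _) => apply T_decode
  | _ => def_club
  end.
Ltac def_hook ::= def_cover.

Lemma leastS_spec (P : M -> Prop) : definable (fun e => P (e 0)) -> (exists s, s ∈ S /\ P s) ->
  leastS P ∈ S /\ P (leastS P).
Proof.
  intros HP H.
  assert (K : leastS P ∈ S /\ P (leastS P) /\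
    forall t, t ∈ S -> P t -> leastS P = t \/ maps r (leastS P) t); [|tauto].
  apply (iota_spec (fun s => s ∈ S /\ P s /\ forall t, t ∈ S -> P t -> s = t \/ maps r s t)).
  destruct (wo_least (maps r) S P W HP H) as [m [Hm [Pm Lm]]].
  exists m; split; [auto|]. intros m' [Hm' [Pm' Lm']].
  destruct W as [Irr [Tr _]].
  destruct (Lm m' Hm' Pm') as [E|R1]; [exact E|]. destruct (Lm' m Hm Pm) as [E|R2]; [auto|].
  destruct (Irr m Hm (Tr m m' m Hm Hm' Hm R1 R2)).
Qed.

Lemma first_cover_spec (v : M) : subset v l -> inj v omega -> first_cover v ∈ S /\ Fin (diff v (first_cover v)).
Proof.
  intros Sv Hv; apply (leastS_spec (fun s => Fin (diff v s))); [dd|].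
  destruct (Cov v Sv Hv) as [s [Hs Ss]]; exists s; split; [exact Hs|].
  apply (Fin_subset _ emp); [intros x Hx; apply diff_spec in Hx; destruct Hx; exfalso; auto|].
  exists emp; split; [apply emp_omega|apply inj_subset; intro; auto].
Qed.

Lemma first_cover_ext (v v' : M) : (forall s, Fin (diff v s) <-> Fin (diff v' s)) -> first_cover v = first_cover v'.
Proof.
  intro H; unfold first_cover; f_equal; apply functional_extensionality; intro s.
  apply propositional_extensionality, H.
Qed.

Lemma cl_spec (A x : M) : x ∈ cl A <->
  x ∈ l /\ (x ∈ A \/ exists v, subset v A /\ card v omega /\ x ∈ first_cover v).
Proof. unfold cl; rewrite sep_spec by dd; tauto. Qed.

Lemma cl_mono (A B : M) : subset A B -> subset (cl A) (cl B).
Proof.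
  intros H x Hx; apply cl_spec in Hx; apply cl_spec; destruct Hx as [Hx K]; split; [exact Hx|].
  destruct K as [K|[v [Sv [Cv K]]]]; [auto|right; exists v; split; [|auto]].
  intros y Hy; auto.
Qed.

(** An order type of at least [d] would inject the initial ordinal [d] into the cardinality of [s],
    which is below [d]. *)
Lemma ot_cover (s : M) : s ∈ S -> ordset s /\ ot s ∈ d.
Proof.
  intro Hs; destruct (HS s Hs) as [Sl [n [Hn Cn]]].
  assert (O : ordset s) by exact (ordset_subset s l (ordinal_ordset l Hl) Sl).
  split; [exact O|]. pose proof (cardinal_ordinal d Hd) as Od.
  apply NNPP; intro K; apply ord_not_lt in K; [|apply ordinal_ot, O|exact Od].
  apply (initial_not_inj d n (proj1 Hd) Hn).
  apply (inj_trans _ (ot s)); [apply inj_subset, ord_le_subset; [apply ordinal_ot, O|exact K]|].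
  apply (inj_trans _ s); [apply equipotent_inj, equipotent_sym, equipotent_ot, O|exact (card_inj s n Cn)].
Qed.

Definition core (a : M) : M := sep a (fun x => forall C, club C a -> x ∈ cl C).

Definition ladder (a : M) : M :=
  ite (exists s, s ∈ S /\ unbounded (cap s a) a)
    (cap (leastS (fun s => unbounded (cap s a) a)) a) (core a).

(** Definability in [a], with parameters fixed for all [a] at once, is what lets Replacement collect
    the ladders into one sequence. *)
Lemma T_ladder a : term_definable a -> term_definable (fun e => ladder (a e)).
Proof. intros; unfold ladder, core; dd. Qed.

Lemma core_spec (a x : M) : x ∈ core a <-> x ∈ a /\ forall C, club C a -> x ∈ cl C.
Proof. unfold core; rewrite sep_spec by dd; tauto. Qed.

(** The first factor of the set whose Hartogs number is taken consists of countably infinite subsets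
    of [c], so a single element of [c] has to be coded by one of them. *)
Lemma decode_onto (c i : M) : subset omega c -> i ∈ c ->
  exists v, subset v c /\ card v omega /\ decode v = i.
Proof.
  intros Hc Hi; destruct (classic (i ∈ omega)) as [Wi|Wi].
  - exists (diff omega (upair i i)).
    assert (H : forall x, x ∈ diff omega (upair i i) <-> x ∈ omega /\ x <> i).
    { intro x; rewrite diff_spec, upair_spec; tauto. }
    assert (Sub : subset (diff omega (upair i i)) omega) by (intros x Hx; apply H in Hx; tauto).
    split; [intros x Hx; auto|split].
    + apply card_omega_intro; [apply inj_subset, Sub|].
      intro F; apply omega_not_Fin, (Fin_insert _ omega i F).
      intros y Hy; rewrite H; destruct (classic (y = i)); auto.
    + apply iota_eq; intro y; rewrite H; split.
      * intros [[[? _] ?]|[_ [Hy N]]]; [contradiction|]. apply NNPP; intro; apply N; auto.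
      * intros ->; right; split; [exact Sub|split; [exact Wi|tauto]].
  - exists (cup omega (upair i i)).
    assert (H : forall x, x ∈ cup omega (upair i i) <-> x ∈ omega \/ x = i).
    { intro x; rewrite cup_spec, upair_spec; tauto. }
    split; [|split].
    + intros x Hx; apply H in Hx; destruct Hx as [Hx| ->]; auto.
    + apply card_omega_intro.
      * apply (inj_trans _ (suc omega)); [|apply inj_suc; [apply ordinal_omega|apply ord_le_refl]].
        apply inj_intro with (fun x => ite (x ∈ omega) x omega); [dd| |].
        -- intros x Hx; apply suc_spec; destruct (classic (x ∈ omega)) as [E|E];
             [rewrite ite_true by exact E; auto|rewrite ite_false by exact E; auto].
        -- intros x y Hx Hy; apply H in Hx, Hy.
           destruct (classic (x ∈ omega)) as [E|E]; [rewrite (ite_true _ _ _ E)|rewrite (ite_false _ _ _ E)];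
           (destruct (classic (y ∈ omega)) as [E'|E']; [rewrite (ite_true _ _ _ E')|rewrite (ite_false _ _ _ E')]);
           intro K; try exact K.
           ++ subst x; destruct (not_mem_self _ E).
           ++ subst y; destruct (not_mem_self _ E').
           ++ destruct Hx, Hy; try contradiction; congruence.
      * intro F; apply omega_not_Fin, (Fin_subset _ (cup omega (upair i i))); [|exact F].
        intros x Hx; apply H; auto.
    + apply iota_eq; intro y; rewrite H; split.
      * intros [[[Hy|Hy] N]|[K _]]; [contradiction|exact Hy|].
        destruct Wi; apply K, H; auto.
      * intros ->; left; auto.
Qed.

Section Minimal.
Context (a : M) (La : limit_ordinal a) (Sal : subset a l).
Context (Hctbl : forall v, subset v a -> inj v omega -> exists x, x ∈ a /\ forall y, y ∈ v -> y ∈ x).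

(* A failing sequence of clubs [C_n] yields points [x_n] of [C_n] outside
   [cl C_(n+1)].  All tails of [x] are equal modulo finite sets, so they have
   the same cover, which contains some [x_k]: then [x_k] is in [cl C_(k+1)]. *)
Lemma minimal_club : exists C, club C a /\
  forall C', club C' a -> subset C' C -> subset C (cl C').
Proof.
  apply NNPP; intro N.
  assert (K : forall C, club C a -> exists C', club C' a /\ subset C' C /\ exists x, x ∈ C /\ ~ x ∈ cl C').
  { intros C HC; apply NNPP; intro K; apply N; exists C; split; [exact HC|].
    intros C' HC' S' x Hx; apply NNPP; intro Kx; apply K; exists C'; eauto. }
  assert (HX : forall C, C ∈ sep (Pow a) (fun C => club C a) <-> club C a).
  { intro C; rewrite sep_spec, Pow_spec by dd; split; [tauto|]. intro HC; split; [apply HC|exact HC]. }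
  destruct (dependent_choice (sep (Pow a) (fun C => club C a))
    (fun C C' => subset C' C /\ exists x, x ∈ C /\ ~ x ∈ cl C')) as [f [Hf Rf]]; [intros; dd| | |].
  { exists a; apply HX; split; [apply unbounded_self|auto]. }
  { intros C HC; apply HX in HC; destruct (K C HC) as [C' [HC' K']]; exists C'.
    split; [apply HX, HC'|exact K']. }
  assert (Cf : forall n, n ∈ omega -> club (app f n) a) by (intros n Hn; apply HX; auto).
  assert (Oa : ordinal a) by apply La.
  (* DC provides only the clubs; the failing points are then definable as least ordinals. *)
  set (x := fun n => iota (least_ord (fun y => y ∈ app f n /\ ~ y ∈ cl (app f (suc n))))).
  assert (Tx : forall t, term_definable t -> term_definable (fun e => x (t e))) by (intros; unfold x; dd).
  assert (Tx0 : term_definable (fun e => x (e 0))) by dd.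
  assert (Hx : forall n, n ∈ omega -> x n ∈ app f n /\ ~ x n ∈ cl (app f (suc n))).
  { intros n Hn; apply (iota_spec (least_ord (fun y => y ∈ app f n /\ ~ y ∈ cl (app f (suc n))))).
    destruct (least_exists (fun y => y ∈ app f n /\ ~ y ∈ cl (app f (suc n)))) as [m Hm]; [dd| |].
    - destruct (Rf n Hn) as [_ [y Hy]]; exists y; split; [|exact Hy].
      apply (ord_mem a); [exact Oa|]. apply (Cf n Hn), Hy.
    - exists m; split; [exact Hm|]. intros m'; apply least_unique, Hm. }
  assert (Dec : forall n, n ∈ omega -> forall m, ord_le m n -> subset (app f n) (app f m)).
  { apply (omega_ind (fun n => forall m, ord_le m n -> subset (app f n) (app f m))); [dd| |].
    - intros m [Hm| ->]; [destruct (emp_spec _ Hm)|intros y; auto].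
    - intros n Hn IH m [Hm| ->]; [|intros y; auto].
      intros y Hy; apply (IH m); [apply mem_suc_le, Hm|]. apply (proj1 (Rf n Hn)), Hy. }
  assert (Fl : forall n, n ∈ omega -> subset (app f n) l).
  { intros n Hn y Hy; apply Sal, (Cf n Hn), Hy. }
  (* If [x m] equalled [x n] for [m] below [n], then it would lie in the club numbered [n], hence in
     the one numbered [suc m] and in its closure, which [x m] avoids. *)
  assert (Lt : forall m n, n ∈ omega -> m ∈ n -> x m <> x n).
  { intros m n Hn L E; assert (Hm : m ∈ omega) by exact (ord_trans omega m n ordinal_omega L Hn).
    apply (proj2 (Hx m Hm)), cl_spec; rewrite E; split; [apply (Fl n Hn), Hx, Hn|left].
    apply (Dec n Hn); [apply suc_le; [apply omega_ordinal, Hn|exact L]|apply Hx, Hn]. }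
  assert (Ix : inj_on omega x).
  { intros m n Hm Hn E; destruct (ordinal_tri omega m n ordinal_omega Hm Hn) as [L|[L|L]]; [|exact L|].
    - destruct (Lt m n Hn L E).
    - destruct (Lt n m Hm L); auto. }
  set (X := fun k => image (sep omega (fun n => ord_le k n)) x).
  assert (SX : forall k y, y ∈ X k <-> exists n, n ∈ omega /\ ord_le k n /\ y = x n).
  { intros k y; unfold X; rewrite image_spec by exact Tx0. split; intros [n Hn]; exists n.
    - destruct Hn as [Hn E]; apply sep_spec in Hn; [tauto|dd].
    - split; [apply sep_spec; [dd|tauto]|tauto]. }
  assert (Xf : forall k, subset (X k) (app f k)).
  { intros k y Hy; apply SX in Hy; destruct Hy as [n [Hn [L ->]]]. apply (Dec n Hn k L), Hx, Hn. }
  assert (Xl : forall k, subset (X k) l).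
  { intros k y Hy; apply SX in Hy; destruct Hy as [n [Hn [L ->]]]. apply (Fl n Hn), Hx, Hn. }
  assert (Xw : forall k, inj (X k) omega).
  { intro k; apply (inj_trans _ (image omega x)); [apply inj_subset|apply image_inj; [apply ordinal_omega|exact Tx0]].
    intros y Hy; apply SX in Hy; destruct Hy as [n [Hn [_ ->]]]; apply image_spec; eauto. }
  assert (Tail : forall k, k ∈ omega -> forall y, y ∈ X emp -> y ∈ X k \/ y ∈ image k x).
  { intros k Hk y Hy; apply SX in Hy; destruct Hy as [n [Hn [_ ->]]].
    destruct (ord_le_total k n (omega_ordinal k Hk) (omega_ordinal n Hn)) as [L|L].
    - left; apply SX; eauto.
    - right; apply image_spec; eauto. }
  assert (FI : forall k, k ∈ omega -> Fin (image k x)).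
  { intros k Hk; exists k; split; [exact Hk|apply image_inj; [apply omega_ordinal, Hk|exact Tx0]]. }
  assert (X0 : subset (image omega x) (X emp)).
  { intros y Hy; apply image_spec in Hy; [|exact Tx0]. destruct Hy as [n [Hn ->]]; apply SX.
    exists n; split; [exact Hn|split; [|reflexivity]]. apply ord_subset_le; [apply ordinal_emp|apply omega_ordinal, Hn|].
    intros z Hz; destruct (emp_spec _ Hz). }
  assert (NF0 : ~ Fin (X emp)).
  { intro F; apply omega_not_Fin, (Fin_inj _ (X emp)); [|exact F].
    apply inj_intro with x; [exact Tx0| |exact Ix].
    intros n Hn; apply X0, image_spec; eauto. }
  assert (CX : forall k, k ∈ omega -> card (X k) omega).
  { intros k Hk; apply card_omega_intro; [apply Xw|]. intro F; apply NF0.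
    apply (Fin_union (X k) (image k x)); [exact F|exact (FI k Hk)|exact (Tail k Hk)]. }
  assert (EX : forall k, k ∈ omega -> first_cover (X k) = first_cover (X emp)).
  { intros k Hk; apply first_cover_ext; intro s; split; intro F.
    - apply (Fin_union (diff (X k) s) (image k x)); [exact F|exact (FI k Hk)|].
      intros y Hy; rewrite diff_spec in *; destruct (Tail k Hk y); tauto.
    - apply (Fin_subset _ (diff (X emp) s)); [|exact F].
      intros y Hy; rewrite diff_spec in *; split; [|tauto]. apply X0, image_spec; [exact Tx0|].
      destruct Hy as [Hy _]; apply SX in Hy; destruct Hy as [n [Hn [_ E]]]; eauto. }
  destruct (first_cover_spec (X emp) (Xl emp) (Xw emp)) as [_ F0].
  assert (E : exists k, k ∈ omega /\ x k ∈ first_cover (X emp)).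
  { apply NNPP; intro Z; apply NF0, (Fin_subset _ (diff (X emp) (first_cover (X emp)))); [|exact F0].
    intros y Hy; apply diff_spec; split; [exact Hy|]. intro Hy'; apply Z.
    apply SX in Hy; destruct Hy as [n [Hn [_ ->]]]; eauto. }
  destruct E as [k [Hk Ek]]; pose proof (suc_omega k Hk) as Hk'.
  apply (proj2 (Hx k Hk)), cl_spec; split; [apply (Fl k Hk), Hx, Hk|right].
  exists (X (suc k)); split; [apply Xf|split; [apply CX, Hk'|]].
  rewrite EX by exact Hk'; exact Ek.
Qed.

(** The minimal club [C0] is thinned to limit points of a set [u] of order type cf(a). Between two
    such points lies an element of [u], so the next element of [u] identifies a point. The thinned
    club [C1] thereby injects into [c], and its countable subsets become countable subsets of [c].
    It remains to list [cl C1], which contains the core, by pairs in [c]^aleph_0 x d. *)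
Lemma core_small (c h : M) : cof a c -> hrtg_pow d c h ->
  unbounded (core a) a /\ ot (core a) ∈ h.
Proof.
  intros Hc Hh; assert (Oa : ordinal a) by apply La.
  destruct minimal_club as [C0 [HC0 M0]].
  destruct (cof_elim a c Oa Hc) as [u [Hu [Ou Ec]]].
  set (C2 := sep a (acc u)).
  assert (HC2 : club C2 a) by (apply club_acc; assumption).
  assert (SC2 : forall x, x ∈ C2 -> x ∈ a /\ acc u x) by (intros x Hx; apply sep_spec in Hx; [exact Hx|dd]).
  set (C1 := cap C0 C2).
  assert (HC1 : club C1 a) by (apply club_cap; assumption).
  assert (S10 : subset C1 C0) by (intros x Hx; apply cap_spec in Hx; tauto).
  assert (S12 : subset C1 C2) by (intros x Hx; apply cap_spec in Hx; tauto).
  (* For any club [C], the set [cap C1 C] is a club inside [C0]; by minimality its closure contains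
     [C0], and by monotonicity so does [cl C]. *)
  assert (S1 : subset C1 (core a)).
  { intros x Hx; apply core_spec; split; [apply HC1, Hx|]. intros C HC.
    assert (HC' : club (cap C1 C) a) by (apply club_cap; assumption).
    apply (cl_mono (cap C1 C)); [intros y Hy; apply cap_spec in Hy; tauto|].
    apply (M0 (cap C1 C) HC'); [intros y Hy; apply cap_spec in Hy; apply S10; tauto|exact (S10 x Hx)]. }
  assert (Sa : subset (core a) a) by (intros x Hx; apply core_spec in Hx; tauto).
  split; [exact (unbounded_mono C1 (core a) a (proj1 HC1) S1 Sa)|].
  assert (Oc : ordset (core a)) by exact (ordset_subset _ a (ordinal_ordset a Oa) Sa).
  set (g := fun x => app (col u) (nxt u x)).
  assert (Tg : forall t, term_definable t -> term_definable (fun e => g (t e))) by (intros; unfold g; dd).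
  assert (Nx : forall x, x ∈ C1 -> nxt u x ∈ u /\ ord_le x (nxt u x) /\ forall y, y ∈ u -> ord_le x y -> ord_le (nxt u x) y).
  { intros x Hx; apply (nxt_spec u a); [exact Oa|exact Hu|apply HC1, Hx]. }
  assert (Hg : forall x, x ∈ C1 -> g x ∈ c) by (intros x Hx; rewrite Ec; apply col_in; [exact Ou|apply Nx, Hx]).
  assert (Lg : forall x y, x ∈ C1 -> y ∈ C1 -> x ∈ y -> g x <> g y).
  { intros x y Hx Hy L E; apply (col_inj u Ou) in E; [|apply Nx; assumption..].
    destruct (SC2 y (S12 y Hy)) as [_ [_ A]]; destruct (A x L) as [w [Hw [Uw Lw]]].
    assert (K : ord_le (nxt u x) w) by (apply Nx; [exact Hx|exact Uw|left; exact Lw]).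
    rewrite E in K. apply (ord_lt_not_le w y Hw), (ord_le_trans y (nxt u y) w (Ou w Uw)); [apply Nx, Hy|exact K]. }
  assert (Ig : inj_on C1 g).
  { intros x y Hx Hy E; assert (Hxa : x ∈ a) by (apply HC1, Hx); assert (Hya : y ∈ a) by (apply HC1, Hy).
    destruct (ordinal_tri a x y Oa Hxa Hya) as [L|[L|L]]; [|exact L|].
    - destruct (Lg x y Hx Hy L E).
    - destruct (Lg y x Hy Hx L); auto. }
  (* The cofinality of a limit ordinal is a limit, so [c] contains omega, as the coding of elements
     by countable sets requires. *)
  assert (Wc : subset omega c) by (apply ord_le_subset; [apply Hc|apply omega_le_limit, (cof_limit a c La Hc)]).
  set (pre := fun v => sep C1 (fun x => g x ∈ v)).
  assert (Tpre : forall t, term_definable t -> term_definable (fun e => pre (t e))) by (intros; unfold pre; dd).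
  (* The index zero means a point of [C1], decoded from [v]. An index [suc i] means the element in
     position [i] of the cover of the subset of [C1] coded by [v]; it stays below [d] because [d] is
     a limit. *)
  set (F := fun v j => ite (j = emp)
    (iota (fun x => x ∈ C1 /\ g x = decode v))
    (iota (fun x => x ∈ first_cover (pre v) /\ suc (app (col (first_cover (pre v))) x) = j))).
  apply (hrtg_pow_above d c h (ot (core a)) (fun v j => app (col (core a)) (F v j)) Hh);
    [apply ordinal_ot, Oc|intros; unfold F; dd|].
  intros y Hy; destruct (col_surj (core a) y Oc Hy) as [x [Hx <-]].
  enough (K : exists v j, subset v c /\ card v omega /\ j ∈ d /\ F v j = x).
  { destruct K as [v [j [H1 [H2 [H3 <-]]]]]; exists v, j; auto. }
  assert (Hx1 : x ∈ cl C1) by (apply core_spec in Hx; apply Hx, HC1).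
  pose proof (cardinal_ordinal d Hd) as Od.
  apply cl_spec in Hx1; destruct Hx1 as [_ [Hx1|[v' [Sv' [Cv' Hx1]]]]].
  - destruct (decode_onto c (g x) Wc (Hg x Hx1)) as [v [Sv [Cv Ev]]].
    exists v, emp; split; [exact Sv|split; [exact Cv|split]].
    + apply ordinal_emp_mem; [exact Od|]. pose proof (cardinal_limit d Hd) as Ld; apply limit_spec in Ld; tauto.
    + unfold F; rewrite ite_true by reflexivity. apply iota_eq; intro z; rewrite Ev; split; [|intros ->; auto].
      intros [Hz E]; apply Ig; assumption.
  - assert (Iv : inj_on v' g) by (intros z w Hz Hw; apply Ig; auto).
    (* Injectivity of [g] on [C1] recovers a countable subset of [C1] from its image in [c], which
       is all that [F] is given. *)
    assert (Ep : pre (image v' g) = v').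
    { apply extensionality; intro z; unfold pre; rewrite sep_spec, image_spec by dd; split.
      - intros [Hz [w [Hw E]]]; rewrite (Ig z w); auto.
      - intro Hz; split; [auto|eauto]. }
    assert (Sl : subset v' l) by (intros z Hz; apply Sal, HC1, Sv', Hz).
    destruct (first_cover_spec v' Sl (card_inj _ _ Cv')) as [Hs _]; destruct (ot_cover _ Hs) as [Os Ls].
    exists (image v' g), (suc (app (col (first_cover v')) x)); split; [|split; [|split]].
    + intros z Hz; apply image_spec in Hz; [|dd]. destruct Hz as [w [Hw ->]]; auto.
    + apply (card_equipotent v'); [exact Cv'|apply equipotent_image; [dd|exact Iv]].
    + apply cardinal_suc_mem; [exact Hd|]. apply (ord_trans d _ (ot (first_cover v')) Od); [apply col_in; assumption|exact Ls].
    + unfold F; rewrite ite_false by apply suc_not_emp. rewrite Ep.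
      apply iota_eq; intro z; split; [|intros ->; auto].
      intros [Hz E]; apply suc_inj in E; apply (col_inj (first_cover v') Os); assumption.
Qed.

End Minimal.

(** A ladder taken from [S] has order type below [d], and [d] is below [h] by projection to the
    second factor. If no element of [S] is unbounded in [a], then no countable subset of [a] is
    either, as some element of [S] would contain it; so the core is available. *)
Lemma ladder_spec (a : M) : limit_ordinal a -> subset a l ->
  unbounded (ladder a) a /\
  forall c h, cof a c -> hrtg_pow d c h -> ot (ladder a) ∈ h.
Proof.
  intros La Sal; assert (Oa : ordinal a) by apply La.
  unfold ladder; destruct (classic (exists s, s ∈ S /\ unbounded (cap s a) a)) as [A|A].
  - rewrite ite_true by exact A. destruct (leastS_spec (fun s => unbounded (cap s a) a)) as [Hs Us]; [dd|exact A|].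
    split; [exact Us|]. intros c h Hc Hh.
    destruct (ot_cover _ Hs) as [Os Ls].
    assert (Oh : ordinal h) by (destruct Hh as [? [? [_ [_ [K _]]]]]; exact K).
    (* The projection needs one countable subset of [c] as first coordinate; omega is one because
       [c] is infinite. *)
    assert (Dh : d ∈ h).
    { apply (hrtg_pow_above d c h d (fun _ j => j) Hh); [apply Hd|intros; dd|].
      intros y Hy; exists omega, y; split; [|split; [apply card_omega|auto]].
      apply ord_le_subset; [apply Hc|apply omega_le_limit, (cof_limit a c La Hc)]. }
    apply (ord_trans h _ d Oh); [|exact Dh].
    eapply ord_le_lt; [apply (cardinal_ordinal d Hd)| |exact Ls].
    apply ot_subset; [exact Os|]. intros x Hx; apply cap_spec in Hx; tauto.
  - rewrite ite_false by exact A.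
    assert (Hctbl : forall v, subset v a -> inj v omega -> exists x, x ∈ a /\ forall y, y ∈ v -> y ∈ x).
    { intros v Sv Cv; destruct (Cov v) as [s [Hs Ss]]; [intros x Hx; auto|exact Cv|].
      apply NNPP; intro N; apply A; exists s; split; [exact Hs|].
      apply (unbounded_mono v); [split; [exact Sv|]|intros x Hx; apply cap_spec; auto|
        intros x Hx; apply cap_spec in Hx; tauto].
      intros x Hx; apply NNPP; intro N'; apply N; exists x; split; [exact Hx|].
      intros y Hy; apply NNPP; intro N''; apply N'; exists y; split; [exact Hy|].
      apply ord_not_lt; [exact (ord_mem a y Oa (Sv y Hy))|exact (ord_mem a x Oa Hx)|exact N'']. }
    split.
    + destruct (cof_exists a Oa) as [c [Hc _]], (hrtg_pow_exists d c) as [h Hh].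
      apply (core_small a La Sal Hctbl c h Hc Hh).
    + intros c h Hc Hh; apply (core_small a La Sal Hctbl c h Hc Hh).
Qed.

End Cover.

(** * Smooth sequences *)

(** The code of [x] is the index of the next element of [u] paired with the code of [x] inside that
    element. A point of [u] is its own next element and gets zero; the successor keeps the two cases
    apart. *)
Definition step (k u : M) (rho : M -> M) (g : M -> M -> M) (x : M) : M :=
  godel_pair k (rho (nxt u x)) (ite (x = nxt u x) emp (suc (g (nxt u x) x))).

Definition by_value (g x y : M) : Prop := app g x ∈ app g y.

(** Ordering [a] by the values of [g] and collapsing amounts to collapsing the range of [g]. The
    target ordinal is left existential, so the result depends on [a] and [g] alone. *)
Definition straighten (a g : M) : M :=
  iota (fun h => exists o, ordinal o /\ order_iso (by_value g) a h o).

Definition good (d a : M) : Prop := exists k, card a k /\ singular k /\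
  forall b, b ∈ k -> exists h, hrtg_pow d b h /\ ord_le h k.

Definition crd (a : M) : M := iota (card a).

Lemma T_step k u (rho : (nat -> M) -> M -> M) (g : (nat -> M) -> M -> M -> M) x :
  term_definable k -> term_definable u -> term_definable x ->
  (forall t, term_definable t -> term_definable (fun e => rho e (t e))) ->
  (forall t s, term_definable t -> term_definable s -> term_definable (fun e => g e (t e) (s e))) ->
  term_definable (fun e => step (k e) (u e) (rho e) (g e) (x e)).
Proof. intros; unfold step; dd. Qed.

Lemma T_straighten a g : term_definable a -> term_definable g -> term_definable (fun e => straighten (a e) (g e)).
Proof. intros; unfold straighten, order_iso, by_value; dd. Qed.

Lemma D_good a b : term_definable a -> term_definable b -> definable (fun e => good (a e) (b e)).
Proof. intros; unfold good; dd. Qed.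

Lemma T_crd a : term_definable a -> term_definable (fun e => crd (a e)).
Proof. intros; unfold crd; dd. Qed.

Ltac def_smooth :=
  lazymatch goal with
  | |- term_definable (fun e => step _ _ _ _ _) => apply T_step; [..|intros|intros]
  | |- term_definable (fun e => straighten _ _) => apply T_straighten
  | |- definable (fun e => good _ _) => apply D_good
  | |- term_definable (fun e => crd _) => apply T_crd
  | _ => def_club
  end.
Ltac def_hook ::= def_smooth.

(* [a] is the union of the ordinals in [u], which are injected into [k]
   uniformly; so [a] injects into [u] times [k]. *)
Lemma step_injective (a k u : M) (rho : M -> M) (g : M -> M -> M) :
  cardinal k -> ordinal a -> unbounded u a ->
  (forall y, y ∈ u -> rho y ∈ k) -> inj_on u rho ->
  (forall y x, y ∈ u -> x ∈ y -> g y x ∈ k) -> (forall y, y ∈ u -> inj_on y (g y)) ->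
  (forall x, x ∈ a -> step k u rho g x ∈ k) /\ inj_on a (step k u rho g).
Proof.
  intros Hk Ha Hu Hr Ir Hg Ig.
  assert (N : forall x, x ∈ a -> nxt u x ∈ u /\ (x <> nxt u x -> x ∈ nxt u x)).
  { intros x Hx; destruct (nxt_spec u a x Ha Hu Hx) as [H1 [H2 _]]; split; [exact H1|].
    destruct H2 as [H2|H2]; [auto|contradiction]. }
  assert (E0 : emp ∈ k).
  { pose proof (cardinal_limit k Hk) as L; apply limit_spec in L; apply ordinal_emp_mem; tauto. }
  assert (V : forall x, x ∈ a -> ite (x = nxt u x) emp (suc (g (nxt u x) x)) ∈ k).
  { intros x Hx; destruct (N x Hx) as [H1 H2]; destruct (classic (x = nxt u x)) as [E|E].
    - rewrite ite_true by exact E; exact E0.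
    - rewrite ite_false by exact E; apply cardinal_suc_mem; auto. }
  split.
  - intros x Hx; apply godel_pair_in; [exact Hk|apply Hr, N, Hx|apply V, Hx].
  - intros x y Hx Hy E; destruct (N x Hx) as [H1 H2], (N y Hy) as [H3 H4].
    apply godel_pair_inj in E; auto; destruct E as [E1 E2]; apply Ir in E1; [|assumption..].
    destruct (classic (x = nxt u x)) as [Ex|Ex]; [rewrite (ite_true _ _ _ Ex) in E2|rewrite (ite_false _ _ _ Ex) in E2];
    (destruct (classic (y = nxt u y)) as [Ey|Ey]; [rewrite (ite_true _ _ _ Ey) in E2|rewrite (ite_false _ _ _ Ey) in E2]).
    + congruence.
    + destruct (suc_not_emp _ (eq_sym E2)).
    + destruct (suc_not_emp _ E2).
    + apply suc_inj in E2; rewrite E1 in E2; apply (Ig (nxt u y)); auto.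
      rewrite <- E1; auto.
Qed.

Lemma by_value_wo (a g k : M) : ordinal k -> (forall x, x ∈ a -> app g x ∈ k) -> inj_on a (app g) ->
  well_orders (by_value g) a.
Proof.
  intros Hk Hg Ig; unfold by_value; split; [|split; [|split]].
  - intros x _; apply not_mem_self.
  - intros x y z _ _ Hz; apply ord_trans, (ord_mem k); auto.
  - intros x y Hx Hy; destruct (ordinal_tri k (app g x) (app g y)) as [?|[E|?]]; auto.
  - intros B HB [x Hx].
    destruct (wo_least (@mem M) k (fun v => exists y, y ∈ B /\ v = app g y)) as [m [_ [[y [Hy ->]] L]]];
      [apply Hk|dd|exists (app g x); split; [apply Hg, HB, Hx|eauto]|].
    exists y; split; [exact Hy|]. intros z Hz; destruct (L (app g z)) as [E|E]; [apply Hg, HB, Hz|eauto| |auto].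
    left; apply Ig; auto.
Qed.

Lemma straighten_spec (a g k : M) : ordinal k -> (forall x, x ∈ a -> app g x ∈ k) -> inj_on a (app g) ->
  exists o, ordinal o /\ ord_le o k /\ order_iso (by_value g) a (straighten a g) o /\
    forall h o', ordinal o' -> order_iso (by_value g) a h o' -> h = straighten a g.
Proof.
  intros Hk Hg Ig; pose proof (by_value_wo a g k Hk Hg Ig) as W.
  destruct (order_iso_exists _ a W) as [f [o [Ho Hf]]]; [intros; unfold by_value; dd|].
  assert (U : forall h o', ordinal o' -> order_iso (by_value g) a h o' -> h = f).
  { intros h o' Ho' Hh; exact (proj1 (order_iso_unique _ _ _ _ _ _ W Ho' Ho Hh Hf)). }
  assert (E : straighten a g = f).
  { apply iota_eq; intro h; split; [|intros ->; eauto]. intros [o' [Ho' Hh]]; exact (U h o' Ho' Hh). }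
  rewrite E; exists o; split; [exact Ho|split; [|auto]].
  destruct Hf as [[If Sf] Mf]; pose proof (injection_app _ _ _ If) as Jf.
  set (inv := fun y => iota (fun x => x ∈ a /\ app f x = y)).
  assert (V : forall x, x ∈ a -> inv (app f x) = x).
  { intros x Hx; apply iota_eq; intro z; split; [|intros ->; auto].
    intros [Hz Ez]; apply Jf; assumption. }
  apply (embedding_le o k (fun y => app g (inv y))); [exact Ho|exact Hk|unfold inv; dd| |].
  - intros y Hy; destruct (surjection_app _ _ _ y Sf Hy) as [x [Hx <-]]; rewrite V; auto.
  - intros y y' Hy Hy' L; destruct (surjection_app _ _ _ y Sf Hy) as [x [Hx <-]].
    destruct (surjection_app _ _ _ y' Sf Hy') as [x' [Hx' <-]]; rewrite !V by assumption.
    apply Mf; assumption.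
Qed.

(** The collapse has order type at most [k], because the values lie in [k], and at least [k],
    because it is equipotent to [a]. *)
Lemma straighten_bijection (a g k : M) : card a k -> (forall x, x ∈ a -> app g x ∈ k) ->
  inj_on a (app g) -> bijection (straighten a g) a k.
Proof.
  intros Hk Hg Ig; destruct (straighten_spec a g k (proj1 Hk) Hg Ig) as [o [Ho [L [[B _] _]]]].
  assert (K : ord_le k o) by (apply (card_le a k o Hk Ho); exists (straighten a g); apply B).
  rewrite (ord_le_antisym _ _ K L); exact B.
Qed.

(** A cofinal subset of the order type of [u] pulls back along the collapse to a cofinal subset of
    [a] of no larger order type. *)
Lemma cof_trans (a u c c' : M) : ordinal a -> unbounded u a -> cof a c -> cof (ot u) c' -> ord_le c c'.
Proof.
  intros Ha Hu Hc Hc'; pose proof (unbounded_ordset u a Ha Hu) as Ou.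
  pose proof (ordinal_ot u Ou) as Oo.
  destruct (cof_elim (ot u) c' Oo Hc') as [w [[Sw Uw] [Ow ->]]].
  set (v := sep u (fun y => app (col u) y ∈ w)).
  assert (Hv : forall y, y ∈ v <-> y ∈ u /\ app (col u) y ∈ w) by (intro y; unfold v; rewrite sep_spec by dd; tauto).
  assert (Sv : subset v u) by (intros y Hy; apply Hv in Hy; tauto).
  assert (Uv : unbounded v a).
  { split; [intros y Hy; apply Hu, Sv, Hy|]. intros x Hx; destruct Hu as [Su Uu].
    destruct (Uu x Hx) as [y [Hy L]].
    destruct (Uw _ (col_in u y Ou Hy)) as [i [Hi Li]].
    destruct (col_surj u i Ou (Sw i Hi)) as [z [Hz Ez]]; subst i.
    exists z; split; [apply Hv; auto|]. apply (ord_le_trans x y z (Ou z Hz) L).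
    apply ord_not_lt; [apply Ou, Hz|apply Ou, Hy|]. intro K.
    apply (col_mono u) in K; [|assumption..]. exact (ord_lt_not_le _ _ K Li). }
  apply (ord_le_trans c (ot v)); [apply ordinal_ot, Ow|exact (cof_le a c v Ha Hc Uv)|].
  apply (ot_le_of_increasing v (ot w) (fun y => app (col w) (app (col u) y))); [exact (ordset_subset _ _ Ou Sv)|
    apply ordinal_ot, Ow|dd| |].
  - intros y Hy; apply Hv in Hy; apply col_in; tauto.
  - intros y z Hy Hz L; apply Hv in Hy, Hz. apply -> (col_mono w); try tauto. apply -> (col_mono u); tauto.
Qed.

(** Enumerate [a] by [f] in order type [k] and keep the records, the indices whose value exceeds all
    earlier ones. The values at records are cofinal, since the first index with a value at or above
    a given [x] is a record, and [f] is increasing on the records. *)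
Lemma cof_le_card (a c k : M) : ordinal a -> card a k -> cof a c -> ord_le c k.
Proof.
  intros Ha Hk Hc; pose proof Hk as [Ok [E _]]; apply equipotent_sym in E; destruct E as [f [If Sf]].
  pose proof (injection_app _ _ _ If) as Jf.
  assert (Ff : forall i, i ∈ k -> app f i ∈ a) by (intros i Hi; exact (func_app _ _ _ _ (proj1 If) Hi)).
  set (I := sep k (fun i => forall j, j ∈ i -> app f j ∈ app f i)).
  assert (HI : forall i, i ∈ I <-> i ∈ k /\ forall j, j ∈ i -> app f j ∈ app f i)
    by (intro i; unfold I; rewrite sep_spec by dd; tauto).
  set (u := image I (app f)).
  assert (Hu : forall y, y ∈ u <-> exists i, i ∈ I /\ y = app f i) by (intro y; apply image_spec; dd).
  assert (U : unbounded u a).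
  { split; [intros y Hy; apply Hu in Hy; destruct Hy as [i [Hi ->]]; apply HI in Hi; apply Ff; tauto|].
    intros x Hx; destruct (wo_least (@mem M) k (fun i => ord_le x (app f i))) as [i [Hi [Li Mi]]];
      [apply Ok|dd|destruct (surjection_app _ _ _ x Sf Hx) as [i [Hi <-]]; exists i; split; [exact Hi|apply ord_le_refl]|].
    exists (app f i); split; [|exact Li]. apply Hu; exists i; split; [|reflexivity].
    apply HI; split; [exact Hi|]. intros j Hj.
    assert (Hjk : j ∈ k) by exact (ord_trans k j i Ok Hj Hi).
    apply (ord_lt_le _ x); [apply (ord_mem a); auto| |exact Li].
    apply NNPP; intro N; apply ord_not_lt in N; [|apply (ord_mem a); auto|apply (ord_mem a); auto].
    destruct (Mi j Hjk N) as [->|K]; [exact (not_mem_self _ Hj)|exact (mem_asym _ _ Hj K)]. }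
  pose proof (unbounded_ordset u a Ha U) as Ou.
  apply (ord_le_trans c (ot u) k Ok); [exact (cof_le a c u Ha Hc U)|].
  set (inv := fun y => iota (fun i => i ∈ k /\ app f i = y)).
  assert (V : forall i, i ∈ k -> inv (app f i) = i).
  { intros i Hi; apply iota_eq; intro z; split; [|intros ->; auto].
    intros [Hz Ez]; apply Jf; assumption. }
  apply (ot_le_of_increasing u k inv Ou Ok); [unfold inv; dd| |].
  - intros y Hy; apply Hu in Hy; destruct Hy as [i [Hi ->]]; apply HI in Hi; rewrite V; tauto.
  - intros y z Hy Hz L; apply Hu in Hy, Hz; destruct Hy as [i [Hi ->]], Hz as [j [Hj ->]].
    apply HI in Hi, Hj; destruct Hi as [Hi Ki], Hj as [Hj Kj]; rewrite !V by assumption.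
    destruct (ordinal_tri k i j Ok Hi Hj) as [K|[K|K]]; [exact K| |].
    + subst j; destruct (not_mem_self _ L).
    + destruct (mem_asym _ _ L (Ki j K)).
Qed.

(** If cf(a) were [k] itself, [a] would have a cofinal subset of order type [k], so its cofinality
    would be at most cf(k), which is below [k]. This makes the bounds on Hartogs numbers below |a|
    apply to cf(a). *)
Lemma cof_lt_singular (a c k : M) : ordinal a -> card a k -> singular k -> cof a c -> c ∈ k.
Proof.
  intros Ha Hk [_ [c' [Hc' L]]] Hc; destruct (cof_le_card a c k Ha Hk Hc) as [K|E]; [exact K|].
  destruct (cof_elim a c Ha Hc) as [u [Hu [_ Eu]]].
  assert (K : ord_le c c') by (apply (cof_trans a u c c' Ha Hu Hc); rewrite <- Eu, E; exact Hc').
  rewrite E in K; destruct (ord_lt_not_le _ _ L K).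
Qed.

Lemma Ax4cov_cover (d l : M) : cardinal l -> Ax4cov d l -> exists S r,
  well_orders (maps r) S /\ (forall s, s ∈ S -> in_pow_lt l d s) /\
  (forall u, subset u l -> inj u omega -> exists s, s ∈ S /\ subset u s).
Proof.
  intros Hl [_ [S [[r W] [HS Cov]]]]; exists S, r; split; [exact W|split; [exact HS|]].
  intros u Su Cu; destruct aleph1_exists as [a1 [A1 Wa]]; apply (Cov a1); [exact A1|].
  apply countable_in_pow_lt; auto. destruct A1 as [w [_ [_ [O _]]]]; exact O.
Qed.

Lemma crd_eq (a k : M) : card a k -> crd a = k.
Proof.
  intro H; apply iota_eq; intro k'; split; [intro H'; exact (card_unique a k' k H' H)|intros ->; exact H].
Qed.

(** The recursion visits successors too: there the singleton of the predecessor [Union a] is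
    unbounded. Zero is excluded by the infinite cardinality. *)
Lemma small_unbounded (d l a k : M) (L : M -> M) : ordinal l ->
  (forall a, limit_ordinal a -> subset a l -> unbounded (L a) a /\
     forall c h, cof a c -> hrtg_pow d c h -> ot (L a) ∈ h) ->
  a ∈ l -> card a k -> singular k -> (forall b, b ∈ k -> exists h, hrtg_pow d b h /\ ord_le h k) ->
  unbounded (ite (limit_ordinal a) (L a) (upair (Union a) (Union a))) a /\
  ot (ite (limit_ordinal a) (L a) (upair (Union a) (Union a))) ∈ k.
Proof.
  intros Hl HL Ha Hk Sk H; pose proof (ord_mem l a Hl Ha) as Oa.
  pose proof (cardinal_limit k (proj1 Sk)) as Lk; apply limit_spec in Lk; destruct Lk as [Ok [Nk Ck]].
  destruct (classic (limit_ordinal a)) as [La|La].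
  - rewrite ite_true by exact La. destruct (HL a La) as [U O]; [apply Hl, Ha|]. split; [exact U|].
    destruct (cof_exists a Oa) as [c [Hc _]].
    destruct (H c (cof_lt_singular a c k Oa Hk Sk Hc)) as [h [Hh Lh]].
    exact (ord_lt_le _ h k Ok (O c h Hc Hh) Lh).
  - rewrite ite_false by exact La. destruct (ordinal_cases a Oa) as [->|[[b [Hb ->]]|La']]; [| |contradiction].
    + destruct Nk; apply inj_emp, card_inj_sym, Hk.
    + assert (E : Union (suc b) = b).
      { apply extensionality; intro z; rewrite Union_spec; split.
        - intros [y [Hy Hz]]; apply suc_spec in Hy; destruct Hy as [Hy| ->]; [exact (ord_trans b z y Hb Hz Hy)|exact Hz].
        - intro Hz; exists b; split; [apply suc_mem|exact Hz]. }
      rewrite E.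
      assert (Eb : forall y, y ∈ upair b b -> y = b) by (intros y Hy; apply upair_spec in Hy; tauto).
      split; [split|].
      * intros y Hy; rewrite (Eb y Hy); apply suc_mem.
      * intros x Hx; exists b; split; [apply upair_spec; auto|apply mem_suc_le, Hx].
      * apply (ord_le_lt _ (suc emp) k Ok); [|apply Ck, ordinal_emp_mem; assumption].
        apply (ot_le_of_increasing _ _ (fun _ => emp)); [intros y Hy; rewrite (Eb y Hy); exact Hb|apply ordinal_suc, ordinal_emp|dd| |].
        -- intros; apply suc_mem.
        -- intros x y Hx Hy K; rewrite (Eb x Hx), (Eb y Hy) in K; destruct (not_mem_self _ K).
Qed.

(** The recursion runs over all of [l], which avoids restricting it to a scattered domain; the
    induction claims injectivity only at good ordinals. It closes up because the elements of a
    ladder in [a] are either below |a| or good with the same cardinality. *)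
Lemma good_smooth (d l : M) : cardinal d -> cardinal l -> Ax4cov d l ->
  smooth (sep l (good d)).
Proof.
  intros Hd Cl Hcov; destruct (Ax4cov_cover d l Cl Hcov) as [S [r [W [HS Cov]]]].
  pose proof (cardinal_ordinal l Cl) as Hl.
  assert (HU : forall a, a ∈ sep l (good d) <-> a ∈ l /\ good d a) by (intro a; apply sep_spec; dd).
  set (L := ladder l S r).
  assert (TL : forall t, term_definable t -> term_definable (fun e => L (t e))) by (intros; apply T_ladder; assumption).
  assert (HL := ladder_spec d l S r Hd Hl W HS Cov); fold L in HL.
  set (uu := fun a => ite (limit_ordinal a) (L a) (upair (Union a) (Union a))).
  assert (Tuu : forall t, term_definable t -> term_definable (fun e => uu (t e))) by (intros; unfold uu; dd).
  (* An ordinal [y] below |a| is already a subset of |a| and takes the identity; a larger one takes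
     the injection built before. *)
  set (H := fun a f y x => ite (y ∈ crd a) x (app (app f y) x)).
  assert (TH : forall t t0 t1 t2, term_definable t -> term_definable t0 -> term_definable t1 -> term_definable t2 -> term_definable (fun e => H (t e) (t0 e) (t1 e) (t2 e)))
    by (intros; unfold H; dd).
  set (G := fun a f => lam a (step (crd a) (uu a) (app (col (uu a))) (H a f))).
  assert (TG : forall t u, term_definable t -> term_definable u -> term_definable (fun e => G (t e) (u e))).
  { intros t u Ht Hu; unfold G; apply T_lam; [exact Ht|].
    apply T_step; intros; dd. }
  destruct (recursion (@mem M) l G (proj2 Hl)) as [f [_ Ef]]; [intros; dd|exact TG|].
  assert (K : forall a, a ∈ l -> forall k, good d a -> card a k ->
    (forall x, x ∈ a -> app (app f a) x ∈ k) /\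
    (forall x y, x ∈ a -> y ∈ a -> app (app f a) x = app (app f a) y -> x = y)).
  { apply (wo_ind (@mem M) l (fun a => forall k, good d a -> card a k ->
      (forall x, x ∈ a -> app (app f a) x ∈ k) /\
      (forall x y, x ∈ a -> y ∈ a -> app (app f a) x = app (app f a) y -> x = y)) (proj2 Hl)); [dd|].
    intros a Ha IH k Ga Ck; pose proof (ord_mem l a Hl Ha) as Oa.
    destruct Ga as [k' [Ck' [Sk Bk]]]; rewrite <- (card_unique a k k' Ck Ck') in Sk, Bk; clear k' Ck'.
    pose proof (proj1 Ck) as Ok.
    destruct (small_unbounded d l a k L Hl HL Ha Ck Sk Bk) as [U Ou]; fold (uu a) in U, Ou.
    pose proof (unbounded_ordset _ a Oa U) as OS.
    set (h := lam (sep l (fun y => y ∈ a)) (app f)) in *.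
    assert (Eh : forall y, y ∈ a -> app h y = app f y).
    { intros y Hy; apply app_lam; [dd|]. apply sep_spec; [dd|]. split; [exact (ord_trans l y a Hl Hy Ha)|exact Hy]. }
    assert (P : forall y, y ∈ uu a -> (forall x, x ∈ y -> H a h y x ∈ k) /\ inj_on y (H a h y)).
    { intros y Hy; pose proof (proj1 U y Hy) as Hya; pose proof (ord_mem a y Oa Hya) as Oy.
      unfold H, inj_on; rewrite (crd_eq a k Ck), (Eh y Hya). destruct (classic (y ∈ k)) as [Yk|Yk].
      - split; [intros x Hx; rewrite ite_true by exact Yk; exact (ord_trans k x y Ok Hx Yk)|].
        intros x z _ _; rewrite !(ite_true _ _ _ Yk); auto.
      (* An ordinal between [k] and [a] has cardinality [k], and goodness depends on the cardinality
         only, so the induction hypothesis applies to [y]. *)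
      - assert (Cy : card y k).
        { apply card_eq; [exact (card_initial a k Ck)|..].
          - apply (inj_trans _ a); [apply inj_subset, Oa, Hya|exact (card_inj a k Ck)].
          - apply inj_subset, ord_le_subset; [exact Oy|apply ord_not_lt; assumption]. }
        destruct (IH y) with (k := k) as [P1 P2]; [exact (ord_trans l y a Hl Hya Ha)|exact Hya|exists k; auto|exact Cy|].
        split; [intros x Hx; rewrite ite_false by exact Yk; auto|].
        intros x z Hx Hz; rewrite !(ite_false _ _ _ Yk); auto. }
    assert (Est : forall x, x ∈ a -> app (app f a) x = step k (uu a) (app (col (uu a))) (H a h) x).
    { intros x Hx; rewrite (Ef a Ha); fold h; unfold G; rewrite (crd_eq a k Ck).
      apply app_lam; [|exact Hx]. apply T_step; intros; dd. }
    destruct (step_injective a k (uu a) (app (col (uu a))) (H a h)) as [Q1 Q2].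
    - apply Sk.
    - exact Oa.
    - exact U.
    - intros y Hy; apply (ord_trans k _ _ Ok (col_in _ y OS Hy) Ou).
    - apply col_inj, OS.
    - intros y x Hy; apply P, Hy.
    - intros y Hy; apply P, Hy.
    - split; [intros x Hx; rewrite Est by exact Hx; auto|].
      intros x y Hx Hy; rewrite !Est by assumption; auto. }
  split; [intros a Ha; apply HU in Ha; apply (ord_mem l); tauto|].
  assert (TF : term_definable (fun e => straighten (e 0) (app f (e 0)))) by dd.
  exists (lam (sep l (good d)) (fun a => straighten a (app f a))); split; [apply fun_on_lam, TF|].
  intros a g Ha Hg; apply maps_lam in Hg; [|exact TF]. destruct Hg as [_ ->].
  apply HU in Ha; destruct Ha as [Ha Ga]; pose proof Ga as [k [Ck _]]; exists k; split; [exact Ck|].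
  destruct (K a Ha k Ga Ck) as [K1 K2]; apply straighten_bijection; assumption.
Qed.

(** * Successor cardinals and sequences of ladders *)

Lemma fun_on_iff (f : M) (P Q : M -> Prop) : (forall x, P x <-> Q x) -> fun_on f P -> fun_on f Q.
Proof.
  intros H [H1 H2]; split.
  - intros p Hp; destruct (H1 p Hp) as [x [y [Hx K]]]; exists x, y; rewrite <- H; auto.
  - intros x Hx; apply H2, H, Hx.
Qed.

Lemma interval_spec (m l x : M) : x ∈ sep l (fun x => ord_le m x) <-> in_interval m l x.
Proof. unfold in_interval; rewrite sep_spec by dd; tauto. Qed.

(** A larger cardinality of some [a] in the interval would be a cardinal above [m] and below [l]. *)
Lemma succ_cardinal_elim (m l : M) : succ_cardinal m l ->
  cardinal m /\ cardinal l /\ m ∈ l /\ forall a, in_interval m l a -> ordinal a /\ card a m.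
Proof.
  intros [Cm [Ol [[Cl Hml] Ll]]]; split; [exact Cm|split; [exact Cl|split; [exact Hml|]]].
  intros a [L Ha]; pose proof (ord_mem l a Ol Ha) as Oa; split; [exact Oa|].
  pose proof Cm as Cm'; apply cardinal_iff in Cm'; destruct Cm' as [Im Wm].
  destruct (card_exists a a Oa) as [c [Hc Lc]]; [apply inj_subset; intro; auto|].
  assert (M1 : ord_le m c).
  { apply initial_le; [exact Im|apply Hc|]. apply (inj_trans _ a); [|exact (card_inj a c Hc)].
    apply inj_subset, ord_le_subset; assumption. }
  destruct M1 as [M1| ->]; [|exact Hc].
  destruct (ord_lt_not_le c l (ord_le_lt c a l Ol Lc Ha)). apply Ll; [apply Hc|split; [|exact M1]].
  apply cardinal_iff; split; [exact (card_initial a c Hc)|].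
  left; exact (ord_le_lt omega m c (proj1 Hc) Wm M1).
Qed.

(** Elements of [l]^aleph_0 are infinite, whereas a cover must also contain the finite sets; adding
    omega turns any countable set into a legitimate element. *)
Lemma cup_omega_countable (u : M) : inj u omega -> card (cup u omega) omega.
Proof.
  intro H; destruct (inj_elim _ _ H) as [f [Hf If]]; apply card_omega_intro.
  - assert (E1 : suc emp ∈ omega) by apply suc_omega, emp_omega.
    pose proof cardinal_omega as Cw; pose proof emp_omega as E0.
    apply inj_intro with (fun x => ite (x ∈ omega) (godel_pair omega emp x) (godel_pair omega (suc emp) (app f x))).
    + pose proof T_omega; dd.
    + intros x Hx; apply cup_spec in Hx; destruct (classic (x ∈ omega)) as [E|E].
      * rewrite ite_true by exact E; apply godel_pair_in; assumption.
      * rewrite ite_false by exact E; apply godel_pair_in; try assumption; apply Hf; tauto.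
    + intros x y Hx Hy; apply cup_spec in Hx, Hy.
      destruct (classic (x ∈ omega)) as [E|E]; [rewrite (ite_true _ _ _ E)|rewrite (ite_false _ _ _ E)];
      (destruct (classic (y ∈ omega)) as [E'|E']; [rewrite (ite_true _ _ _ E')|rewrite (ite_false _ _ _ E')]);
      intro K; (apply godel_pair_inj in K; [destruct K as [K1 K2]|try assumption; apply Hf; tauto..]).
      * exact K2.
      * destruct (suc_not_emp _ (eq_sym K1)).
      * destruct (suc_not_emp _ K1).
      * apply If; tauto.
  - intro F; apply omega_not_Fin, (Fin_subset _ (cup u omega)); [|exact F].
    intros x Hx; apply cup_spec; auto.
Qed.

(** The well-orderable set [l]^aleph_0 is itself the cover: its members have size below aleph_1. *)
Lemma Ax4_cov (d l : M) : cardinal l -> omega ∈ l -> Ax4 l -> is_aleph1 d -> Ax4cov d l.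
Proof.
  intros Cl Wl [P [HP WP]] [w [Hw [_ [Od [[Cd Hwd] Ld]]]]]; apply is_omega_eq in Hw; subst w.
  pose proof (cardinal_ordinal l Cl) as Ol.
  split; [apply Ld; auto|]. exists P; split; [exact WP|split].
  - intros u Hu; apply HP in Hu; destruct Hu as [Su [w [Hw Cu]]]; apply is_omega_eq in Hw; subst w.
    split; [exact Su|eauto].
  - intros a1 u1 [w [Hw [_ [Oa [_ La]]]]] [Su [n [Hn Cn]]]; apply is_omega_eq in Hw; subst w.
    assert (Hu : inj u1 omega).
    { apply (inj_trans _ n); [exact (card_inj u1 n Cn)|].
      apply inj_subset, ord_le_subset; [apply ordinal_omega|].
      apply ord_not_lt; [apply ordinal_omega|apply Cn|]. intro K.
      apply (ord_lt_not_le n a1 Hn), La; [apply Cn|split; [|exact K]].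
      apply cardinal_iff; split; [exact (card_initial u1 n Cn)|left; exact K]. }
    exists (cup u1 omega); split; [|intros x Hx; apply cup_spec; auto].
    apply HP; split; [|exists omega; split; [apply omega_is_omega|apply cup_omega_countable, Hu]].
    intros x Hx; apply cup_spec in Hx; destruct Hx as [Hx|Hx]; [auto|exact (ord_trans l x omega Ol Hx Wl)].
Qed.

(** Every ordinal in the interval has cardinality [m] and is therefore good, so the smooth sequence
    restricted to the interval is a witness. *)
Lemma singular_true_successor (d m l : M) : cardinal d -> succ_cardinal m l ->
  (Ax4 l /\ is_aleph1 d) \/ Ax4cov d l -> singular m ->
  (forall a, a ∈ m -> exists h, hrtg_pow d a h /\ h ∈ m) -> true_successor l.
Proof.
  intros Hd Hml HA Sm Hm; destruct (succ_cardinal_elim m l Hml) as [Cm [Cl [L I]]].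
  pose proof (cardinal_ordinal l Cl) as Ol.
  assert (Cov : Ax4cov d l).
  { destruct HA as [[HA Hd1]|HA]; [|exact HA]. apply Ax4_cov; try assumption.
    apply (ord_le_lt omega m l Ol); [apply cardinal_iff in Cm; apply Cm|exact L]. }
  destruct (good_smooth d l Hd Cl Cov) as [_ [f [Ff Hf]]].
  exists m; split; [exact Hml|].
  assert (TF : term_definable (fun e => app f (e 0))) by dd.
  assert (Ff' : fun_on (lam (sep l (fun x => ord_le m x)) (app f)) (in_interval m l)).
  { apply (fun_on_iff _ (fun x => x ∈ sep l (fun x => ord_le m x))); [apply interval_spec|apply fun_on_lam, TF]. }
  exists (lam (sep l (fun x => ord_le m x)) (app f)); split; [exact Ff'|].
  intros a g Ha Hg; apply maps_lam in Hg; [|exact TF]. destruct Hg as [_ ->].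
  destruct (I a Ha) as [Oa Ca].
  assert (Ga : a ∈ sep l (good d)).
  { apply sep_spec; [dd|]. split; [apply Ha|]. exists m; split; [exact Ca|split; [exact Sm|]].
    intros b Hb; destruct (Hm b Hb) as [h [Hh Lh]]; exists h; split; [exact Hh|left; exact Lh]. }
  destruct (Hf a (app f a) Ga) as [k [Ck B]]; [apply (maps_app _ _ _ _ Ff Ga); reflexivity|].
  rewrite (card_unique a m k Ca Ck); apply B.
Qed.

Lemma ladder_system (d astar : M) : cardinal d -> Ax4all d -> ordinal astar ->
  exists u, fun_on u (fun a => a ∈ astar /\ limit_ordinal a) /\
    forall a v, a ∈ astar -> limit_ordinal a -> maps u a v ->
      subset v a /\ is_sup v a /\
      exists o c h, otp v o /\ cof a c /\ hrtg_pow d c h /\ o ∈ h.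
Proof.
  intros Hd HA Oa; pose proof (cardinal_ordinal d Hd) as Od.
  assert (Wd : ord_le omega d) by (apply cardinal_iff in Hd; apply Hd).
  assert (B : exists b, ordinal b /\ ord_le d b /\ ord_le astar b).
  { destruct (ord_le_total d astar Od Oa) as [K|K]; [exists astar|exists d];
      (split; [assumption|split; [|]]); first [assumption|apply ord_le_refl|left; assumption]. }
  (* The Hartogs number of the larger of [d] and [astar] is a cardinal above both, so a single cover
     serves all [a] below [astar]. *)
  destruct B as [b [Ob [Ldb Lab]]], (hrtg_exists b) as [l Hl].
  destruct (hrtg_cardinal b l Ob (ord_le_trans _ _ _ Ob Wd Ldb) Hl) as [Cl Hbl].
  pose proof (cardinal_ordinal l Cl) as Ol.
  destruct (Ax4cov_cover d l Cl) as [S [r [W [HS Cov]]]];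
    [apply HA; [exact Cl|left; exact (ord_le_lt d b l Ol Ldb Hbl)]|].
  assert (HL := ladder_spec d l S r Hd Ol W HS Cov).
  assert (TL : term_definable (fun e => ladder l S r (e 0))) by (apply T_ladder, T_var).
  assert (HI : forall a, a ∈ sep astar limit_ordinal <-> a ∈ astar /\ limit_ordinal a) by (intro a; apply sep_spec; dd).
  exists (lam (sep astar limit_ordinal) (ladder l S r)); split.
  { apply (fun_on_iff _ (fun x => x ∈ sep astar limit_ordinal)); [exact HI|apply fun_on_lam, TL]. }
  intros a v Ha La Hv; apply maps_lam in Hv; [|exact TL]. destruct Hv as [_ ->].
  assert (Oa' : ordinal a) by apply La.
  assert (Sal : subset a l).
  { apply Ol, (ord_lt_le a astar l Ol Ha). left; exact (ord_le_lt astar b l Ol Lab Hbl). }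
  destruct (HL a La Sal) as [[Su U] O]; split; [exact Su|split].
  (* Since [a] is a limit, an upper bound [y] below [a] would also have to bound an element at or
     above [suc y]. *)
  - split; [exact Oa'|split; [intros x Hx; left; apply Su, Hx|]].
    intros y Oy Hy; apply ord_not_lt; [exact Oy|exact Oa'|]. intro K.
    apply limit_spec in La; destruct La as [_ [_ Sa]].
    destruct (U (suc y) (Sa y K)) as [z [Hz Lz]].
    apply (ord_lt_not_le y (suc y) (suc_mem y)), (ord_le_trans _ z y Oy Lz), Hy, Hz.
  - destruct (cof_exists a Oa') as [c [Hc _]], (hrtg_pow_exists d c) as [h Hh].
    exists (ot (ladder l S r a)), c, h; split; [|split; [exact Hc|split; [exact Hh|eauto]]].
    apply otp_eq; [|reflexivity]. exact (ordset_subset _ a (ordinal_ordset a Oa') Su).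
Qed.

(** * Regularity and onto-witnesses of true successors *)

(** A cofinal set of order type below [l] is indexed by [m], and the witness injects its members
    into [m] uniformly, with no choice. [step_injective] would then inject [l] into [m]. *)
Lemma succ_cardinal_regular (m l f : M) : succ_cardinal m l -> witness m l f -> regular l.
Proof.
  intros Hml [Ff Hf]; destruct (succ_cardinal_elim m l Hml) as [Cm [Cl [Lm I]]].
  pose proof (cardinal_ordinal l Cl) as Ol; pose proof (cardinal_ordinal m Cm) as Om.
  split; [exact Cl|]. destruct (cof_exists l Ol) as [c [Hc [Lc| ->]]]; [|exact Hc].
  destruct (cof_elim l c Ol Hc) as [u [Hu [Ou Ec]]].
  assert (J : inj c m).
  { destruct (ord_le_total m c Om (proj1 Hc)) as [K|K].
    - apply card_inj, I; split; assumption.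
    - apply inj_subset, Om, K. }
  destruct (inj_elim _ _ J) as [j [Hj Ij]].
  assert (P : forall y, y ∈ u -> ~ y ∈ m -> injection (app f y) y m).
  { intros y Hy N; pose proof (proj1 Hu y Hy) as Hyl; pose proof (ord_mem l y Ol Hyl) as Oy.
    assert (Iy : in_interval m l y) by (split; [apply ord_not_lt; assumption|exact Hyl]).
    apply (Hf y); [exact Iy|]. apply (maps_app _ _ _ _ Ff Iy); reflexivity. }
  (* The witness starts at [m]; elements of [u] below [m] are subsets of [m] and take the
     identity. *)
  destruct (step_injective l m u (fun y => app j (app (col u) y)) (fun y x => ite (y ∈ m) x (app (app f y) x)))
    as [Q1 Q2]; try assumption.
  - intros y Hy; apply Hj; rewrite Ec; apply col_in; assumption.
  - intros y z Hy Hz E; apply (col_inj u Ou y z Hy Hz), Ij; [rewrite Ec; apply col_in; assumption..|exact E].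
  - intros y x Hy Hx; destruct (classic (y ∈ m)) as [K|K].
    + rewrite ite_true by exact K; exact (ord_trans m x y Om Hx K).
    + rewrite ite_false by exact K; exact (func_app _ _ _ _ (proj1 (P y Hy K)) Hx).
  - intros y Hy x z Hx Hz; destruct (classic (y ∈ m)) as [K|K].
    + rewrite !(ite_true _ _ _ K); auto.
    + rewrite !(ite_false _ _ _ K); apply (injection_app _ _ _ (P y Hy K)); assumption.
  - destruct (initial_not_inj l m (proj1 Cl) Lm).
    apply (inj_intro l m _ ) with (2 := Q1) (3 := Q2). apply T_step; intros; dd.
Qed.

(* The graph of the onto-witness computed from [f]: at [a] it takes the
   order-preserving collapse of the range of [f(a)]. *)
Definition straightened (f q : M) : Prop :=
  exists a g h, is_pair a h q /\ maps f a g /\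
    exists o, ordinal o /\ bijection h a o /\
      forall x x' y y' z z', maps g x y -> maps g x' y' -> maps h x z -> maps h x' z' ->
        (y ∈ y' <-> z ∈ z').

(** [straightened] uses neither [app] nor [iota], so that one formula can express it in every model;
    the target [o] of the collapse need not be named, since uniqueness of order isomorphisms
    determines [h] from [f]. The work is to identify this relation with the graph of
    [straighten]. *)
Lemma straightened_onto_witness (m l f : M) : succ_cardinal m l -> witness m l f ->
  exists g, onto_witness m l g /\
    forall g', (forall q, q ∈ g' <-> straightened f q) <-> g' = g.
Proof.
  intros Hml [Ff Hf]; destruct (succ_cardinal_elim m l Hml) as [Cm [Cl [Lm I]]].
  set (J := sep l (fun x => ord_le m x)).
  assert (TF : term_definable (fun e => straighten (e 0) (app f (e 0)))) by dd.
  set (g := lam J (fun a => straighten a (app f a))).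
  assert (Hg : fun_on g (in_interval m l)).
  { apply (fun_on_iff _ (fun x => x ∈ J)); [apply interval_spec|apply fun_on_lam, TF]. }
  assert (P : forall a, in_interval m l a -> injection (app f a) a m).
  { intros a Ia; apply (Hf a); [exact Ia|]. apply (maps_app _ _ _ _ Ff Ia); reflexivity. }
  assert (B : forall a h, in_interval m l a -> maps g a h -> bijection h a m).
  { intros a h Ia Hh; apply maps_lam in Hh; [|exact TF]. destruct Hh as [_ ->].
    apply straighten_bijection; [apply I, Ia| |exact (injection_app _ _ _ (P a Ia))].
    intros x Hx; exact (func_app _ _ _ _ (proj1 (P a Ia)) Hx). }
  assert (E : forall q, q ∈ g <-> straightened f q).
  { intro q; unfold g; rewrite lam_spec by exact TF; split.
    - intros [a [Ha ->]]; apply interval_spec in Ha. pose proof (P a Ha) as Pa.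
      destruct (straighten_spec a (app f a) m (cardinal_ordinal m Cm)) as [o [Oo [_ [[Bo Mo] _]]]];
        [intros x Hx; exact (func_app _ _ _ _ (proj1 Pa) Hx)|exact (injection_app _ _ _ Pa)|].
      exists a, (app f a), (straighten a (app f a)).
      split; [apply is_pair_pair; reflexivity|split; [apply (maps_app _ _ _ _ Ff Ha); reflexivity|]].
      exists o; split; [exact Oo|split; [exact Bo|]].
      intros x x' y y' z z' H1 H2 H3 H4.
      rewrite (maps_iff _ _ _ _ (proj1 (proj1 Pa))) in H1; rewrite (maps_iff _ _ _ _ (proj1 (proj1 Pa))) in H2.
      rewrite (maps_iff _ _ _ _ (proj1 (proj1 (proj1 Bo)))) in H3; rewrite (maps_iff _ _ _ _ (proj1 (proj1 (proj1 Bo)))) in H4.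
      destruct H1 as [Hx ->], H2 as [Hx' ->], H3 as [_ ->], H4 as [_ ->]; apply Mo; assumption.
    - intros [a [k [h [Hq [Hk [o [Oo [Bo Mo]]]]]]]].
      apply is_pair_pair in Hq; subst q; rewrite (maps_iff _ _ _ _ Ff) in Hk; destruct Hk as [Ha ->].
      pose proof (P a Ha) as Pa; exists a; split; [apply interval_spec, Ha|f_equal].
      destruct (straighten_spec a (app f a) m (cardinal_ordinal m Cm)) as [o' [_ [_ [_ U]]]];
        [intros x Hx; exact (func_app _ _ _ _ (proj1 Pa) Hx)|exact (injection_app _ _ _ Pa)|].
      apply (U h o Oo); split; [exact Bo|]. intros x y Hx Hy; unfold by_value.
      apply (Mo x y); apply (maps_app _ _ _ (fun x => x ∈ a)); auto; first [apply Pa|apply Bo]. }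
  exists g; split; [split; [split; [exact Hg|]|]|].
  - intros a h Ia Hh; apply (B a h Ia Hh).
  - intros a h Ia Hh; apply (B a h Ia Hh).
  - intro g'; split; [|intros ->; exact E].
    intro H; apply extensionality; intro q; rewrite E; apply H.
Qed.

End Model.

(* One formula for all models, without parameters, unlike [definable]. *)
Definition uniformly_definable (P : forall M : structure, (nat -> M) -> Prop) : Prop :=
  exists p : formula, forall (M : structure) (e : nat -> M), sat e p <-> P M e.

(** * Connectives and quantifiers for formulas common to all models *)

Lemma UD_mem (i j : nat) : uniformly_definable (fun M e => e i ∈ e j).
Proof. exists (fMem i j); reflexivity. Qed.

Lemma UD_eq (i j : nat) : uniformly_definable (fun M e => e i = e j).
Proof. exists (fEq i j); reflexivity. Qed.

Lemma UD_false : uniformly_definable (fun M e => False).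
Proof. exists fBot; reflexivity. Qed.

Lemma UD_and (P Q : forall M : structure, (nat -> M) -> Prop) :
  uniformly_definable P -> uniformly_definable Q -> uniformly_definable (fun M e => P M e /\ Q M e).
Proof. intros [p Hp] [q Hq]; exists (fAnd p q); intros; simpl; rewrite Hp, Hq; reflexivity. Qed.

Lemma UD_or (P Q : forall M : structure, (nat -> M) -> Prop) :
  uniformly_definable P -> uniformly_definable Q -> uniformly_definable (fun M e => P M e \/ Q M e).
Proof. intros [p Hp] [q Hq]; exists (fOr p q); intros; simpl; rewrite Hp, Hq; reflexivity. Qed.

Lemma UD_imp (P Q : forall M : structure, (nat -> M) -> Prop) :
  uniformly_definable P -> uniformly_definable Q -> uniformly_definable (fun M e => P M e -> Q M e).
Proof. intros [p Hp] [q Hq]; exists (fImp p q); intros; simpl; rewrite Hp, Hq; reflexivity. Qed.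

Lemma UD_all (P : forall M : structure, (nat -> M) -> M -> Prop) :
  uniformly_definable (fun M e => P M (fun n => e (S n)) (e 0)) -> uniformly_definable (fun M e => forall x : M, P M e x).
Proof.
  intros [p Hp]; exists (fAll p); intros M e; simpl.
  split; intros H x; [apply (Hp M (scons x e)), H|apply Hp, H].
Qed.

Lemma UD_ex (P : forall M : structure, (nat -> M) -> M -> Prop) :
  uniformly_definable (fun M e => P M (fun n => e (S n)) (e 0)) -> uniformly_definable (fun M e => exists x : M, P M e x).
Proof.
  intros [p Hp]; exists (fEx p); intros M e; simpl.
  split; intros [x H]; exists x; [apply (Hp M (scons x e)), H|apply Hp, H].
Qed.

Ltac ud := repeat (cbv beta;
  lazymatch goal with
  | |- uniformly_definable (fun M e => _ /\ _) => apply UD_and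
  | |- uniformly_definable (fun M e => _ \/ _) => apply UD_or
  | |- uniformly_definable (fun M e => False) => apply UD_false
  | |- uniformly_definable (fun M e => ex _) => apply UD_ex
  | |- uniformly_definable (fun M e => _ = _) => apply UD_eq
  | |- uniformly_definable (fun M e => _ ∈ _) => apply UD_mem
  | |- uniformly_definable (fun M e => forall _, _) => first [apply UD_imp | apply UD_all]
  end).

Lemma UD_straightened : uniformly_definable (fun M e => forall q : M, q ∈ e 1 <-> straightened (e 0) q).
Proof.
  unfold straightened, bijection, injection, surjection, func, fun_on, ordinal, well_orders,
    subset, maps, is_pair, is_upair, unique, not, iff.
  ud.
Qed.

Theorem claim2p28 :
  (exists p : formula, forall M : structure, ZFDC M ->
     (forall l : M, true_successor l -> regular l /\ has_onto_witness l) /\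
     computes_onto_witness p M)
  /\
  (forall M : structure, ZFDC M ->
   forall d : M, cardinal d -> (forall a1, is_aleph1 a1 -> ord_le a1 d) ->
   (forall m l : M, succ_cardinal m l ->
      (Ax4 l /\ is_aleph1 d) \/ Ax4cov d l ->
      singular m ->
      (forall a, a ∈ m -> exists h, hrtg_pow d a h /\ h ∈ m) ->
      true_successor l)
   /\
   (forall l : M, cardinal l -> Ax4cov d l ->
      exists U,
        (forall a, a ∈ U <->
           a ∈ l /\ exists k, card a k /\ singular k /\
             forall b, b ∈ k -> exists h, hrtg_pow d b h /\ ord_le h k) /\
        smooth U)
   /\
   (Ax4all d ->
    forall astar : M, ordinal astar ->
      exists u, fun_on u (fun a => a ∈ astar /\ limit_ordinal a) /\
        forall a v, a ∈ astar -> limit_ordinal a -> maps u a v ->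
          subset v a /\ is_sup v a /\
          exists o c h, otp v o /\ cof a c /\ hrtg_pow d c h /\ o ∈ h)).
Proof.
  destruct UD_straightened as [p Hp]; split.
  (* The formula is fixed before any model is introduced; this is the uniformity claimed. *)
  - exists p; intros M [HZF HDC].
    assert (C : computes_onto_witness p M).
    { intros m l f Hml Hf.
      destruct (@straightened_onto_witness M HZF m l f Hml Hf) as [g [Hg U]].
      exists g; split; [exact Hg|]. intros e g'; rewrite Hp; apply U. }
    split; [|exact C]. intros l [m [Hml [f Hf]]]; split.
    + exact (@succ_cardinal_regular M HZF m l f Hml Hf).
    + destruct (C m l f Hml Hf) as [g [Hg _]]; exists m; split; [exact Hml|exists g; exact Hg].
  - intros M [HZF HDC] d Hd _; split; [|split].
    + intros m l Hml HA Sm Hm; exact (@singular_true_successor M HZF HDC d m l Hd Hml HA Sm Hm).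
    + intros l Cl HA; exists (@sep M HZF l (good d)); split; [|exact (@good_smooth M HZF HDC d l Hd Cl HA)].
      intro a; refine (@sep_spec M HZF l (good d) _ a). apply D_good; [apply T_const|apply T_var].
    + intros HA astar Oa; exact (@ladder_system M HZF HDC d astar Hd HA Oa).
Qed.
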